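(* Let $p\in H^\infty\cap C(\overline{\mathbb D})$. Then the Toeplitz operator $T_{\overline{z}+p}$ is invertible on the Bergman space $L^2_a$ if and only if the following two conditions hold: (i) $1+zp(z)$ has no zeros on the unit circle $\partial\mathbb D$; (ii) $1+zp(z)$ has exactly one zero $z_0$ in the open disk $\mathbb D$, this zero is simple, and $$z_0^2p'(z_0)-\frac{n+2}{n+1}\neq 0$$ for every nonnegative integer $n$.
   Context: $\mathbb D$ is the open unit disk, $dA$ normalized area measure on $\mathbb D$, $L^2_a$ the Bergman space of analytic functions in $L^2(\mathbb D,dA)$, $P$ the orthogonal projection of $L^2(\mathbb D,dA)$ onto $L^2_a$, and for $\varphi\in L^\infty(\mathbb D)$ the Toeplitz operator is $T_\varphi f=P(\varphi f)$ for $f\in L^2_a$. $H^\infty\cap C(\overline{\mathbb D})$ is the disk algebra. *)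

(* Defs.v *)
From HB Require Import structures.
From mathcomp Require Import all_boot all_order all_algebra.
From mathcomp Require Export complex.
From mathcomp Require Import all_classical all_reals all_analysis.
Export Order.TTheory GRing.Theory Num.Theory.
Export numFieldNormedType.Exports.
Export ComplexField.

Set Implicit Arguments.
Unset Strict Implicit.
Unset Printing Implicit Defensive.

Local Open Scope ring_scope.
Local Open Scope classical_set_scope.

(** The complex plane: R[i], viewed as a normed module over itself, so that
    [derivable f z 1] / [f^`()] are complex derivatives. *)
Definition CC (R : realType) := (R[i])^o.

Section Bergman.
Variable R : realType.
Local Notation C := (CC R).

Definition leb2 := ((@lebesgue_measure R) \x (@lebesgue_measure R))%E.

Definition toC (x : R * R) : C := Complex x.1 x.2.

Definition disk : set C := [set z | `|z| < 1].
Definition cldisk : set C := [set z | `|z| <= 1].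
Definition circle : set C := [set z | `|z| = 1].
Definition diskRR : set (R * R) := toC @^-1` disk.

Definition abs2 (w : C) : R := (complex.Re w) ^+ 2 + (complex.Im w) ^+ 2.

Definition intD (f : C -> R) : R :=
  pi^-1 * Rintegral leb2 diskRR (fun x => f (toC x)).

Definition sqnorm (f : C -> C) : \bar R :=
  ((pi^-1)%:E * \int[leb2]_(x in diskRR) (abs2 (f (toC x)))%:E)%E.

Definition L2D (f : C -> C) : Prop :=
  measurable_fun diskRR (fun x => complex.Re (f (toC x))) /\
  measurable_fun diskRR (fun x => complex.Im (f (toC x))) /\
  (sqnorm f < +oo)%E.

Definition inner (f g : C -> C) : C :=
  Complex (intD (fun z => complex.Re (f z * conjc (g z))))
          (intD (fun z => complex.Im (f z * conjc (g z)))).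

Definition holo_on (A : set C) (f : C -> C) : Prop :=
  forall z, A z -> derivable f z 1.

Definition bergman (f : C -> C) : Prop := holo_on disk f /\ L2D f.

Definition disk_algebra (p : C -> C) : Prop :=
  holo_on disk p /\ {within cldisk, continuous p}.

(** Orthogonal projection P of L^2(D) onto L^2_a: P g is the (a.e.-unique,
    here unique on D) h in L^2_a with g - h orthogonal to L^2_a. *)
Definition bergman_proj (g : C -> C) : C -> C :=
  xget (fun _ => 0)
    [set h | bergman h /\ forall k, bergman k -> inner (g \- h) k = 0].

Definition toeplitz (phi : C -> C) (f : C -> C) : C -> C :=
  bergman_proj (phi \* f).

(** Invertibility of an operator T on L^2_a (elements of L^2_a identified
    when they agree on D): T maps L^2_a to L^2_a and has a bounded
    two-sided inverse on L^2_a. *)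
Definition invertible_on_bergman (T : (C -> C) -> (C -> C)) : Prop :=
  (forall f, bergman f -> bergman (T f)) /\
  exists S : (C -> C) -> (C -> C),
    (forall g, bergman g -> bergman (S g)) /\
    (exists c : R, 0 < c /\
       forall g, bergman g -> (sqnorm (S g) <= c%:E * sqnorm g)%E) /\
    (forall f, bergman f -> forall z, disk z -> S (T f) z = f z) /\
    (forall g, bergman g -> forall z, disk z -> T (S g) z = g z).

End Bergman.

(* Main.v *)
Require Import Defs.
From HB Require Import structures.
From mathcomp Require Import all_boot all_order all_algebra.
From mathcomp Require Import complex.
From mathcomp Require Import all_classical all_reals all_analysis.
From mathcomp Require Import measurable_realfun.
From mathcomp Require Import ring lra zify.
Import Order.TTheory GRing.Theory Num.Theory.
Import numFieldNormedType.Exports.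
Import ComplexField.
Set Implicit Arguments.
Unset Strict Implicit.
Unset Printing Implicit Defensive.
Local Open Scope ring_scope.
Local Open Scope classical_set_scope.

(** Write an analytic [f] as [(z G)'].  On the Bergman space the projection of
    [zbar f] is [G'], so the Toeplitz operator becomes the first order operator
    [L G = q G' + p G] with [q = 1 + z p], from the functions with
    [sum (n+1) |G_n|^2] finite to the Bergman space.
    A zero [zeta] of [q] on the circle is incompatible with a lower bound for [L]:
    test on [G' = sum_(n < N) (conj(zeta) z)^n], whose norm diverges like the
    harmonic series while [L G] stays comparatively small.  If [q] has no zero in
    the closed disk, the solution [exp (- int p / q)] of [L G = 0] lies in the domain.
    If [q] has two zeros (or a double zero) in the disk, evaluation at them and the
    first Taylor coefficients give one more functional than there are monomials
    [L z^j] to kill, hence a functional [psi] with [psi (L G) = psi (p x)] for a far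
    tail [x] of [G]; since [x] is small, surjectivity of [L] forces [psi = 0].
    If [z0] is the only zero and is simple, write [q = (z - z0) u] and
    [p / u = - al + (z - z0) w] with [al = 1 / (z0 q'(z0))].  With [F' = w F] and
    [H = F G], [L G = (u / F) ((z - z0) H' - al H)], i.e. the recursion
    [(n - al) h_n - z0 (n + 1) h_(n+1) = g_n].  It is solved backwards with bounds,
    uniquely, unless [al] is one of [1, 2, ...], when [(z - z0)^al] is in the kernel. *)

(** The projection of [zbar f] has the Taylor coefficients [(n+1)/(n+2) f_(n+1)]; dividing [f_n] by
    [n+1], which is what [f = (z G)'] does, removes this weight and turns the shift into a
    derivative. As [z0 p(z0) = -1], the excluded values in the statement say that [z0 q'(z0)] is
    never [1/(n+1)], hence that [al] is no positive integer; [al] is not 0, being an inverse, and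
    [z0] is not 0, because [q(0) = 1]. The symbol is only continuous up to the circle, so a zero
    [zeta] gives nothing better than [|q| <= e + K |z - zeta|]. The test functions must therefore
    have unbounded norm: the part with [e] is absorbed, and [|z - zeta|] cancels the peak of the
    geometric sum. With several zeros in the disk, counting [m+2] functionals against [m+1]
    monomials replaces an index computation. The count becomes a contradiction because a bound
    [|psi g|^2 <= M |g|^2] reproduces itself with [M/2]: on tails beyond [m] the Bergman norm of [x]
    gains a factor of order [1/m] over the norm of the domain. A bounded inverse belongs to the
    definition of invertibility, so each of these arguments starts from an explicit constant. *)

(** * The real-valued modulus and the topology of the complex plane *)

Section Modulus.
Variable R : realType.
Local Notation C := (CC R).
Local Notation nm := (@Normc.normc R).
Local Notation toR := (real_complex R : R -> C).
Implicit Types (z w : C) (x y : R).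

Lemma nmE z : nm z = Num.sqrt (abs2 z).
Proof. by case: z. Qed.

Lemma nm_ge0 z : 0 <= nm z.
Proof. by rewrite nmE sqrtr_ge0. Qed.

Lemma nm_sqr z : nm z ^+ 2 = abs2 z.
Proof. by rewrite nmE sqr_sqrtr // addr_ge0 // sqr_ge0. Qed.

Lemma nmM z w : nm (z * w) = nm z * nm w.
Proof. exact: Normc.normcM. Qed.

Lemma nmD z w : nm (z + w) <= nm z + nm w.
Proof. exact: le_normcD. Qed.

Lemma nmN z : nm (- z) = nm z.
Proof. exact: normcN. Qed.

Lemma nmB z w : nm (z - w) <= nm z + nm w.
Proof. by rewrite -(nmN w) nmD. Qed.

Lemma nmBC z w : nm (z - w) = nm (w - z).
Proof. by rewrite -nmN opprB. Qed.

Lemma nm0 : nm (0 : C) = 0.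
Proof. exact: Normc.normc0. Qed.

Lemma nm1 : nm (1 : C) = 1.
Proof. exact: Normc.normc1. Qed.

Lemma nmV z : nm z^-1 = (nm z)^-1.
Proof. exact: Normc.normcV. Qed.

Lemma nmX z n : nm (z ^+ n) = nm z ^+ n.
Proof. by elim: n => [|n IH]; rewrite ?expr0 ?nm1 // !exprS nmM IH. Qed.

Lemma nm_eq0 z : (nm z == 0) = (z == 0).
Proof.
by apply/eqP/eqP => [/Normc.eq0_normc //|->]; rewrite nm0.
Qed.

Lemma nm_gt0 z : (0 < nm z) = (z != 0).
Proof. by rewrite lt_def nm_ge0 andbT nm_eq0. Qed.

Lemma nm_real x : nm (toR x) = `|x|.
Proof. by rewrite nmE /abs2 /= expr0n addr0 sqrtr_sqr. Qed.

Lemma nm_nat n : nm (n%:R : C) = n%:R.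
Proof. by rewrite -(rmorph_nat toR n) nm_real ger0_norm. Qed.

Lemma nm_conj z : nm (conjc z) = nm z.
Proof. by rewrite !nmE /abs2; case: z => a b /=; rewrite sqrrN. Qed.

Lemma nm_sum (I : Type) (r : seq I) (P : pred I) (F : I -> C) :
  nm (\sum_(i <- r | P i) F i) <= \sum_(i <- r | P i) nm (F i).
Proof.
elim/big_rec2 : _ => [|i y z _ h]; first by rewrite nm0.
by rewrite (le_trans (nmD _ _)) // lerD2l.
Qed.

Lemma normr_nm z : `|z| = toR (nm z).
Proof. by rewrite complex.normc_def /= nmE. Qed.

Lemma nm_Re z : `|complex.Re z| <= nm z.
Proof.
by rewrite nmE -sqrtr_sqr ler_wsqrtr // /abs2 lerDl sqr_ge0.
Qed.

Lemma nm_Im z : `|complex.Im z| <= nm z.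
Proof.
by rewrite nmE -sqrtr_sqr ler_wsqrtr // /abs2 lerDr sqr_ge0.
Qed.

Lemma nm_le_ReIm z : nm z <= `|complex.Re z| + `|complex.Im z|.
Proof.
rewrite -(@ler_pXn2r _ 2) // ?nnegrE ?addr_ge0 ?nm_ge0 // nm_sqr /abs2.
rewrite sqrrD !real_normK ?num_real //.
by rewrite -addrA lerD2l lerDr mulrn_wge0 // mulr_ge0.
Qed.

Lemma ReD z w : complex.Re (z + w) = complex.Re z + complex.Re w.
Proof. by case: z w => [a b] [c d]. Qed.
Lemma ImD z w : complex.Im (z + w) = complex.Im z + complex.Im w.
Proof. by case: z w => [a b] [c d]. Qed.
Lemma ReN z : complex.Re (- z) = - complex.Re z.
Proof. by case: z. Qed.
Lemma ImN z : complex.Im (- z) = - complex.Im z.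
Proof. by case: z. Qed.
Lemma ReM z w : complex.Re (z * w) =
  complex.Re z * complex.Re w - complex.Im z * complex.Im w.
Proof. by case: z w => [a b] [c d]. Qed.
Lemma ImM z w : complex.Im (z * w) =
  complex.Re z * complex.Im w + complex.Im z * complex.Re w.
Proof. by case: z w => [a b] [c d]. Qed.
Lemma ReMr z x : complex.Re (z * toR x) = complex.Re z * x.
Proof. by rewrite ReM /= mulr0 subr0. Qed.
Lemma ImMr z x : complex.Im (z * toR x) = complex.Im z * x.
Proof. by rewrite ImM /= mulr0 add0r. Qed.

Lemma complexP z w :
  complex.Re z = complex.Re w -> complex.Im z = complex.Im w -> z = w.
Proof. by case: z w => [a b] [c d] /= -> ->. Qed.

Lemma nm_eq_small z : (forall e, 0 < e -> nm z <= e) -> z = 0.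
Proof.
move=> h; apply/eqP; rewrite -nm_eq0; apply/negPn/negP => n0.
have p : 0 < nm z by rewrite lt_def n0 nm_ge0.
have p2 : 0 < nm z / 2 by rewrite divr_gt0.
by have := h _ p2; lra.
Qed.

Lemma diskE z : disk z <-> nm z < 1.
Proof. by rewrite /disk /= normr_nm (_ : 1 = toR 1) // ltcR. Qed.
Lemma cldiskE z : cldisk z <-> nm z <= 1.
Proof. by rewrite /cldisk /= normr_nm (_ : 1 = toR 1) // lecR. Qed.
Lemma circleE z : circle z <-> nm z = 1.
Proof.
rewrite /circle /= normr_nm (_ : 1 = toR 1) //.
by split=> [/complexI //|->].
Qed.

(** In the order of [R[i]] comparable numbers have equal imaginary parts, so positive radii of balls
    in [C] are real. This lets neighbourhoods be described with radii in [R]. *)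
Lemma gt0_toR (e : R[i]) : 0 < e -> e = toR (complex.Re e) /\ 0 < complex.Re e.
Proof.
case: e => a b; rewrite ltcE /= => /andP[/eqP -> ap]; by split.
Qed.

Lemma nbhsC z (P : set C) :
  nbhs z P <-> exists2 d, 0 < d & forall w, nm (w - z) < d -> P w.
Proof.
split=> [/nbhs_normP [e /= e0 h]|[d d0 h]].
  have [ee e0'] := gt0_toR e0.
  exists (complex.Re e) => // w wz; apply: h => /=.
  by rewrite normr_nm ee ltcR nmBC.
apply/(@nbhs_normP _ C z); exists (toR d) => /=; first by rewrite ltcR.
by move=> w /=; rewrite normr_nm ltcR nmBC; exact: h.
Qed.

Lemma cvgC (T : Type) (F : set_system T) (FF : Filter F) (f : T -> C) (l : C) :
  f x @[x --> F] --> l <->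
  (forall e, 0 < e -> \forall x \near F, nm (f x - l) < e).
Proof.
split.
  move=> h e e0; apply: (h [set w | nm (w - l) < e]).
  by apply/nbhsC; exists e.
move=> h P /nbhsC[d d0 dP]; apply: filterS (h _ d0) => x; exact: dP.
Qed.

Lemma contC (f : C -> C) z : {for z, continuous f} <->
  forall e, 0 < e -> exists2 d, 0 < d &
    forall w, nm (w - z) < d -> nm (f w - f z) < e.
Proof.
split=> [/(@cvgC _ (nbhs z)) h e e0|h].
  by have /nbhsC := h e e0.
by apply/(@cvgC _ (nbhs z)) => e e0; apply/nbhsC; exact: h.
Qed.

Lemma continuous_toR : continuous toR.
Proof.
move=> x; apply/(@cvgC _ (nbhs x)) => e e0; apply/nbhs_normP; exists e => // y.
by rewrite -(rmorphB (real_complex R)) nm_real distrC.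
Qed.

Lemma continuous_Re : continuous (fun z : C => complex.Re z).
Proof.
move=> z; apply/(@cvgrPdist_lt _ _ _ (nbhs z)) => e e0; apply/nbhsC.
exists e => // w wz; rewrite -ReN -ReD.
by rewrite (le_lt_trans (nm_Re _)) // nmBC.
Qed.

Lemma continuous_Im : continuous (fun z : C => complex.Im z).
Proof.
move=> z; apply/(@cvgrPdist_lt _ _ _ (nbhs z)) => e e0; apply/nbhsC.
exists e => // w wz; rewrite -ImN -ImD.
by rewrite (le_lt_trans (nm_Im _)) // nmBC.
Qed.

Lemma continuous_conj : continuous (fun z : C => (conjc z : C)).
Proof.
move=> z; apply/contC => e e0; exists e => // w.
by rewrite -rmorphB nm_conj.
Qed.

Lemma continuous_nm : continuous (fun z : C => nm z).
Proof.
move=> z; apply/(@cvgrPdist_lt _ _ _ (nbhs z)) => e e0; apply/nbhsC.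
exists e => // w; rewrite nmBC => wz; rewrite (le_lt_trans _ wz) //.
rewrite ler_norml; apply/andP; split.
  by rewrite lerNl opprB lerBlDr nmBC (le_trans _ (nmD _ _)) // subrK.
by rewrite lerBlDr (le_trans _ (nmD _ _)) // subrK.
Qed.

Lemma continuous_Complex (T : topologicalType) (a b : T -> R) (x : T) :
  {for x, continuous a} -> {for x, continuous b} ->
  {for x, continuous (fun t => (Complex (a t) (b t) : C))}.
Proof.
move=> ca cb; apply/(@cvgC _ (nbhs x)) => e e0.
have e2 : 0 < e / 2 by rewrite divr_gt0.
have /(@cvgrPdist_lt _ _ _ (nbhs x)) /(_ _ e2) h1 := ca.
have /(@cvgrPdist_lt _ _ _ (nbhs x)) /(_ _ e2) h2 := cb.
near=> t.
rewrite (le_lt_trans (nm_le_ReIm _)) //= [ltRHS]splitr ltrD //.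
  by rewrite distrC; near: t.
by rewrite distrC; near: t.
Unshelve. all: by end_near. Qed.

End Modulus.

(** * Differential calculus of curves and of complex functions *)

Section Calculus.
Variable R : realType.
Local Notation C := (CC R).
Local Notation nm := (@Normc.normc R).
Local Notation toR := (real_complex R : R -> C).

(** A record rather than a definition, to stop conversion from unfolding filters. *)
Record cont (X : topologicalType) (f : X -> C) (x : X) : Prop :=
  Cont { contP : {for x, continuous f} }.

Section Continuity.
Variable X : topologicalType.
Implicit Types (f g : X -> C) (x : X).

Lemma contD f g x : cont f x -> cont g x -> cont (fun y => f y + g y) x.
Proof. by case=> cf; case=> cg; split; exact: (@cvgD R[i] C X (nbhs x) _ f g (f x) (g x) cf cg). Qed.
Lemma contN f x : cont f x -> cont (fun y => - f y) x.
Proof. by case=> cf; split; exact: (@cvgN R[i] C X (nbhs x) _ f (f x) cf). Qed.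
Lemma contM f g x : cont f x -> cont g x -> cont (fun y => f y * g y) x.
Proof. by case=> cf; case=> cg; split; exact: (@cvgM R[i] X (nbhs x) _ f g (f x) (g x) cf cg). Qed.
Lemma contV f x : f x != 0 -> cont f x -> cont (fun y => (f y)^-1) x.
Proof. by move=> f0; case=> cf; split; exact: (@cvgV R[i] X (nbhs x) _ f (f x) f0 cf). Qed.
Lemma contB f g x : cont f x -> cont g x -> cont (fun y => f y - g y) x.
Proof. by move=> cf cg; apply: contD => //; apply: contN. Qed.
Lemma cont_cst (c : C) x : cont (fun _ : X => c) x.
Proof. by split; exact: cvg_cst. Qed.
Lemma cont_comp (f : C -> C) g x : cont g x -> cont f (g x) ->
  cont (fun y => f (g y)) x.
Proof. by case=> cg; case=> cf; split; exact: (@continuous_comp X C C g f x cg cf). Qed.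

End Continuity.

(** Caratheodory's form of "[f] has derivative [d] with respect to the
    coordinate [i] at [x]": complex derivatives are the case [i = id] on [C],
    derivatives of curves the case of the embedding of [R] in [C]. *)
Definition cat (X : topologicalType) (i f : X -> C) (x : X) (d : C) : Prop :=
  exists phi : X -> C, [/\ forall y, f y - f x = phi y * (i y - i x),
    cont phi x & phi x = d].

Section Cat.
Variables (X : topologicalType) (i : X -> C).
Implicit Types (f g : X -> C) (x : X) (d e : C).

Lemma cat_eq f x d e : cat i f x d -> d = e -> cat i f x e.
Proof. by move=> h <-. Qed.

Lemma cat_ext f g x d : (forall y, f y = g y) -> cat i f x d -> cat i g x d.
Proof. by move=> /funext ->. Qed.

Lemma cat_cst (c : C) x : cat i (fun _ => c) x 0.
Proof.
by exists (fun _ => 0); split => [y||//]; [rewrite subrr mul0r|exact: cont_cst].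
Qed.

Lemma cat_id x : cat i i x 1.
Proof.
by exists (fun _ => 1); split => [y||//]; [rewrite mul1r|exact: cont_cst].
Qed.

Lemma cat_continuous f x d :
  cont i x -> cat i f x d -> cont f x.
Proof.
move=> ci [phi [h c _]].
have -> : f = (fun y => f x + phi y * (i y - i x)).
  by apply/funext => y; rewrite -h addrC subrK.
apply: contD; first exact: cont_cst.
by apply: contM => //; apply: contB => //; exact: cont_cst.
Qed.

Lemma catD f g x d e :
  cat i f x d -> cat i g x e -> cat i (fun y => f y + g y) x (d + e).
Proof.
move=> [p [hp cp <-]] [q [hq cq <-]].
exists (fun y => p y + q y); split => // [y|]; last exact: contD.
by rewrite mulrDl -hp -hq; ring.
Qed.

Lemma catN f x d : cat i f x d -> cat i (fun y => - f y) x (- d).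
Proof.
move=> [p [hp cp <-]]; exists (fun y => - p y); split => // [y|]; last exact: contN.
by rewrite mulNr -hp; ring.
Qed.

Lemma catB f g x d e :
  cat i f x d -> cat i g x e -> cat i (fun y => f y - g y) x (d - e).
Proof. by move=> hf hg; apply: catD => //; exact: catN. Qed.

Lemma catM f g x d e : cont i x ->
  cat i f x d -> cat i g x e -> cat i (fun y => f y * g y) x (d * g x + f x * e).
Proof.
move=> ci hf hg; have cg := cat_continuous ci hg.
move: hf hg => [p [hp cp <-]] [q [hq cq <-]].
exists (fun y => p y * g y + f x * q y); split => // [y|].
  by rewrite mulrDl mulrAC -hp -mulrA -hq; ring.
apply: contD; first exact: contM.
by apply: contM => //; exact: cont_cst.
Qed.

Lemma catZ (c : C) f x d : cat i f x d -> cat i (fun y => c * f y) x (c * d).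
Proof.
move=> [p [hp cp <-]]; exists (fun y => c * p y); split => // [y|].
  by rewrite -mulrA -hp; ring.
by apply: contM => //; exact: cont_cst.
Qed.

Lemma catX n f x d : cont i x ->
  cat i f x d -> cat i (fun y => f y ^+ n) x (n%:R * f x ^+ n.-1 * d).
Proof.
move=> ci hf; elim: n => [|n IH].
  by apply: cat_eq (cat_cst 1 x) _; rewrite !mul0r.
apply: (@cat_ext (fun y => f y * f y ^+ n)) => [y|]; first by rewrite exprS.
apply: cat_eq (catM ci hf IH) _.
case: n {IH} => [|n] /=; first by rewrite !expr0; ring.
by rewrite (exprS _ n) -!natr1; ring.
Qed.

(** The factorisation in [cat] is required at every point and not only near [x], hence the
    nonvanishing of [f] on all of [X]. *)
Lemma catV f x d : cont i x -> (forall y, f y != 0) ->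
  cat i f x d -> cat i (fun y => (f y)^-1) x (- d / f x ^+ 2).
Proof.
move=> ci f0 hf; have cf := cat_continuous ci hf.
move: hf => [p [hp cp <-]].
exists (fun y => - p y * ((f y)^-1 / f x)); split => // [y||].
- rewrite mulrAC mulNr -hp; field; by rewrite !f0.
- apply: contM; first exact: contN.
  by apply: contM; [apply: contV|exact: cont_cst].
- by field; rewrite f0.
Qed.

End Cat.

Lemma cat_comp (X : topologicalType) (i : X -> C) (g : X -> C) (f : C -> C)
    (x : X) (d e : C) : cont i x ->
  cat i g x e -> cat (fun z => z) f (g x) d -> cat i (fun y => f (g y)) x (d * e).
Proof.
move=> ci hg; have cg := cat_continuous ci hg.
move: hg => [q [hq cq <-]] [p [hp cp <-]].
exists (fun y => p (g y) * q y); split => // [y|].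
  by rewrite hp hq mulrA.
by apply: contM => //; exact: (cont_comp cg).
Qed.

Definition cdf (f : C -> C) (z d : C) := cat (fun w : C => w) f z d.
Definition cder (f : R -> C) (t : R) (d : C) := cat toR f t d.

Lemma cont_id (z : C) : cont (fun w : C => w) z.
Proof. by split; exact: cvg_id. Qed.

Lemma cdf_eps f z d : cdf f z d <->
  forall e, 0 < e -> exists2 r, 0 < r &
    forall w, nm (w - z) < r -> nm (f w - f z - d * (w - z)) <= e * nm (w - z).
Proof.
split.
  move=> [phi [h [/contC c] <-]] e /c [r r0 hr]; exists r => // w /hr hw.
  by rewrite h -mulrBl nmM ler_wpM2r ?nm_ge0 // ltW.
move=> h.
pose phi w := if w == z then d else (f w - f z) / (w - z).
exists phi; split => [y||]; last by rewrite /phi eqxx.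
  rewrite /phi; case: eqVneq => [->|yz]; first by rewrite !subrr mulr0.
  by rewrite mulfVK // subr_eq0.
split; apply/contC => e e0.
have e2 : 0 < e / 2 by rewrite divr_gt0.
have [r r0 hr] := h _ e2; exists r => // w /hr hw.
rewrite {2}/phi eqxx /phi; case: eqVneq hw => [->|wz] hw.
  by rewrite subrr nm0.
have wz0 : w - z != 0 by rewrite subr_eq0.
have -> : (f w - f z) / (w - z) - d = (f w - f z - d * (w - z)) / (w - z).
  by field.
rewrite nmM nmV ltr_pdivrMr ?nm_gt0 // (le_lt_trans hw) //.
by rewrite ltr_pM2r ?nm_gt0 //; lra.
Qed.

Lemma is_derive_cdf (f : C -> C) (z d : C) : is_derive z 1 f d <-> cdf f z d.
Proof.
suff e : ((fun h : C => h^-1 *: ((f \o shift z) (h *: (1 : C)) - f z)) @ dnbhs (0 : C) --> d)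
    <-> cdf f z d.
  split=> [[h1 h2]|]; first by apply/e; rewrite -h2.
  move=> /e h; split; first by apply/cvg_ex; exists d.
  exact: cvg_lim h.
rewrite cdf_eps; split.
  move=> /cvgC h e e0.
  have /nbhsC [r r0 hr] := h _ e0.
  exists r => // w wz.
  have [->|wz0] := eqVneq w z; first by rewrite !subrr mulr0 subr0 nm0 mulr0.
  have wzn : w - z != 0 by rewrite subr_eq0.
  have := hr (w - z); rewrite /= subr0 => /(_ wz wzn).
  rewrite /GRing.scale /= mulr1 subrK => hh.
  have -> : f w - f z - d * (w - z) = ((w - z)^-1 * (f w - f z) - d) * (w - z).
    by field.
  by rewrite nmM ler_wpM2r ?nm_ge0 // ltW.
move=> h; apply/cvgC => e e0.
have e2 : 0 < e / 2 by rewrite divr_gt0.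
have [r r0 hr] := h _ e2.
apply/nbhsC; exists r => // w; rewrite subr0 => wr /= w0.
have := hr (w + z); rewrite addrK => /(_ wr) hh.
rewrite /GRing.scale /= mulr1.
have -> : w^-1 * (f (w + z) - f z) - d = (f (w + z) - f z - d * w) / w by field.
rewrite nmM nmV ltr_pdivrMr ?nm_gt0 // (le_lt_trans hh) //.
by rewrite ltr_pM2r ?nm_gt0 //; lra.
Qed.

Lemma cdf_near (f g : C -> C) (z d : C) (r : R) : 0 < r ->
  (forall w, nm (w - z) < r -> f w = g w) -> cdf f z d -> cdf g z d.
Proof.
move=> r0 h /cdf_eps hf; apply/cdf_eps => e /hf [s s0 hs].
exists (Num.min r s); first by rewrite lt_min r0.
move=> w; rewrite lt_min => /andP[wr ws]; rewrite -!h ?hs //.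
by rewrite subrr nm0.
Qed.

Lemma cdf_uniq (f : C -> C) (z d e : C) : cdf f z d -> cdf f z e -> d = e.
Proof. by move=> /is_derive_cdf [_ <-] /is_derive_cdf [_ <-]. Qed.

Lemma derive1_cdf (f : C -> C) (z d : C) : cdf f z d -> f^`() z = d.
Proof. by move=> /is_derive_cdf [_ <-]; rewrite derive1E. Qed.

Lemma derivable_cdf (f : C -> C) (z : C) : derivable f z 1 -> cdf f z (f^`() z).
Proof. by move=> /derivableP /is_derive_cdf; rewrite derive1E. Qed.

Lemma cder_Re f t d : cder f t d ->
  is_derive t 1 (fun s => complex.Re (f s)) (complex.Re d).
Proof.
move=> [p [hp cp <-]]; apply/is_derive1_caratheodory.
exists (fun s => complex.Re (p s)); split => //.
- by move=> s; rewrite -ReMr rmorphB -hp ReD ReN.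
- case: cp => cp; apply: (@continuous_comp R C R p (fun z => complex.Re z)); [exact: cp|exact: continuous_Re].
Qed.

Lemma cder_Im f t d : cder f t d ->
  is_derive t 1 (fun s => complex.Im (f s)) (complex.Im d).
Proof.
move=> [p [hp cp <-]]; apply/is_derive1_caratheodory.
exists (fun s => complex.Im (p s)); split => //.
- by move=> s; rewrite -ImMr rmorphB -hp ImD ImN.
- case: cp => cp; apply: (@continuous_comp R C R p (fun z => complex.Im z)); [exact: cp|exact: continuous_Im].
Qed.

Lemma cder_Complex (a b : R -> R) (t da db : R) :
  is_derive t 1 a da -> is_derive t 1 b db ->
  cder (fun s => Complex (a s) (b s) : C) t (Complex da db).
Proof.
move=> /is_derive1_caratheodory [p [hp cp <-]].
move=> /is_derive1_caratheodory [q [hq cq <-]].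
exists (fun s => Complex (p s) (q s)); split => //.
- move=> s; rewrite -rmorphB; apply: complexP; rewrite ?ReMr ?ImMr /=.
  + by rewrite -hp.
  + by rewrite -hq.
- by split; exact: continuous_Complex.
Qed.

Lemma cder_toR (a : R -> R) (t da : R) : is_derive t 1 a da ->
  cder (fun s => toR (a s)) t (toR da).
Proof. by move=> h; exact: cder_Complex h (is_derive_cst _ _ _). Qed.

Lemma cder_conj f t d : cder f t d -> cder (fun s => (conjc (f s) : C)) t (conjc d).
Proof.
move=> [p [hp cp <-]]; exists (fun s => conjc (p s)); split => // [s|].
  rewrite -rmorphB hp rmorphM -(rmorphB (real_complex R)); congr (_ * _).
  exact: conjc_real.
by apply: (cont_comp cp); split; exact: continuous_conj.
Qed.

Lemma cder_cont f t d : cder f t d -> cont f t.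
Proof. by apply: cat_continuous; split; exact: continuous_toR. Qed.

Lemma cdf_cont f z d : cdf f z d -> cont f z.
Proof. by apply: cat_continuous; exact: cont_id. Qed.

(** Mean value inequality: the real mean value theorem is applied to the component of [f] along its
    own increment [c], and the increment of that component is [|c|^2]. *)
Lemma cder_bound (f df : R -> C) (a b M : R) : a <= b ->
  (forall t, a <= t <= b -> cder f t (df t)) ->
  (forall t, a <= t <= b -> nm (df t) <= M) ->
  nm (f b - f a) <= M * (b - a).
Proof.
rewrite le_eqVlt => /orP[/eqP <-|ab] hd hM; first by rewrite !subrr nm0 mulr0.
set c := f b - f a.
have [->|c0] := eqVneq c 0.
  rewrite nm0 mulr_ge0 ?subr_ge0 ?(ltW ab) //.
  by apply: le_trans (nm_ge0 _) (hM a _); rewrite lexx ltW.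
pose g t := complex.Re (conjc c * f t).
have dg t : a <= t <= b -> is_derive t 1 g (complex.Re (conjc c * df t)).
  by move=> tab; apply: cder_Re; apply: catZ; exact: hd.
have cg : {within `[a, b], continuous g}.
  apply: derivable_within_continuous => t.
  by rewrite in_itv /= => /dg [].
have dg' t : t \in `]a, b[%R -> is_derive t 1 g (complex.Re (conjc c * df t)).
  by rewrite in_itv /= => /andP[/ltW u /ltW v]; apply: dg; rewrite u v.
have [t tab] := MVT ab dg' cg.
have -> : g b - g a = nm c ^+ 2.
  rewrite nm_sqr /g -ReN -ReD -mulrBr -/c ReM /abs2.
  by case: (c) => u v /=; rewrite mulNr opprK !expr2.
move=> e.
have tab' : a <= t <= b by move: tab; rewrite in_itv /= => /andP[/ltW -> /ltW ->].
have : nm c ^+ 2 <= nm c * (M * (b - a)).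
  rewrite e mulrA ler_wpM2r ?subr_ge0 ?(ltW ab) //.
  rewrite (le_trans (ler_norm _)) // (le_trans (nm_Re _)) // nmM nm_conj.
  by rewrite ler_wpM2l ?nm_ge0 // hM.
by rewrite expr2 ler_pM2l // nm_gt0.
Qed.

(** The primitive is the integral from [A], differentiable to the right of [A]; this is the origin
    of the base point carried by [cint]. *)
Lemma primitiveR (A : R) (f : R -> R) : continuous f ->
  exists F : R -> R, forall t : R, A < t -> is_derive t (1 : R) F (f t).
Proof.
move=> cf; exists (fun x => \int[lebesgue_measure]_(t in `[A, x]) f t).
move=> t At.
have it : lebesgue_measure.-integrable `[A, t + 1] (EFin \o f).
  apply: continuous_compact_integrable; first exact: segment_compact.
  exact: continuous_subspaceT.
have [] := @continuous_FTC1 R f (BLeft A) t (t + 1) _ it _ (cf t).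
- by rewrite ltrDl.
- by rewrite lte_fin.
- move=> h1 h2; split; [exact: h1|rewrite -derive1E; exact: h2].
Qed.

Lemma primitiveC (A : R) (f : R -> C) : (forall t, cont f t) ->
  exists F : R -> C, forall t : R, A < t -> cder F t (f t).
Proof.
move=> cf.
have [|F hF] := @primitiveR A (fun t => complex.Re (f t)).
  move=> t; have [h] := cf t.
  by apply: (@continuous_comp R C R f (fun z => complex.Re z)) => //; exact: continuous_Re.
have [|G hG] := @primitiveR A (fun t => complex.Im (f t)).
  move=> t; have [h] := cf t.
  by apply: (@continuous_comp R C R f (fun z => complex.Im z)) => //; exact: continuous_Im.
exists (fun t => Complex (F t) (G t)) => t At.
apply: cat_eq (cder_Complex (hF _ At) (hG _ At)) _.
by apply: complexP.
Qed.

(** Taking the increment of a chosen primitive makes additivity over adjacent intervals an identity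
    and leaves all estimates to the mean value inequality. *)
Definition cint (A : R) (f : R -> C) (a b : R) : C :=
  let F := xget (fun _ => 0) [set F | forall t : R, A < t -> cder F t (f t)] in
  F b - F a.

Section Cint.
Variable A : R.
Implicit Types (f g F : R -> C) (a b c : R).

Lemma cintP f : (forall t, cont f t) -> exists2 F : R -> C,
  (forall t : R, A < t -> cder F t (f t)) &
  forall a b, cint A f a b = F b - F a.
Proof.
move=> /(primitiveC A) h.
exists (xget (fun _ => 0) [set F | forall t : R, A < t -> cder F t (f t)]) => //.
by case: h => F hF; case: xgetP => // /(_ F).
Qed.

Lemma cint_cat f a b c : cint A f a b + cint A f b c = cint A f a c.
Proof. by rewrite /cint; ring. Qed.

Lemma le_cint f a b M : (forall t, cont f t) -> A < a -> a <= b ->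
  (forall t, a <= t <= b -> nm (f t) <= M) -> nm (cint A f a b) <= M * (b - a).
Proof.
move=> cf Aa ab fM; have [F hF ->] := cintP cf.
apply: (@cder_bound F f) => // t /andP[at_ _]; apply: hF.
exact: lt_le_trans Aa at_.
Qed.

Lemma cint_primitive f F a b : (forall t, cont f t) -> A < a -> a <= b ->
  (forall t, a <= t <= b -> cder F t (f t)) -> cint A f a b = F b - F a.
Proof.
move=> cf Aa ab hF; have [G hG ->] := cintP cf.
apply/eqP; rewrite -subr_eq0 -nm_eq0 eq_le nm_ge0 andbT.
have -> : G b - G a - (F b - F a) = (G b - F b) - (G a - F a) by ring.
have := @cder_bound (fun t => G t - F t) (fun _ => 0) a b 0 ab.
rewrite mul0r; apply => [t tab|t _]; last by rewrite nm0.
apply: cat_eq (catB (hG t _) (hF t tab)) _; last by rewrite subrr.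
by case/andP: tab => h _; exact: lt_le_trans Aa h.
Qed.

Lemma cintD f g a b : (forall t, cont f t) -> (forall t, cont g t) ->
  A < a -> a <= b ->
  cint A (fun t => f t + g t) a b = cint A f a b + cint A g a b.
Proof.
move=> cf cg Aa ab; have [F hF ->] := cintP cf; have [G hG ->] := cintP cg.
rewrite (@cint_primitive _ (fun t => F t + G t)) //; first by ring.
  by move=> t; apply: contD.
move=> t /andP[h _]; have At := lt_le_trans Aa h.
by apply: catD; [exact: hF|exact: hG].
Qed.

Lemma cintZ (k : C) f a b : (forall t, cont f t) -> A < a -> a <= b ->
  cint A (fun t => k * f t) a b = k * cint A f a b.
Proof.
move=> cf Aa ab; have [F hF ->] := cintP cf.
rewrite (@cint_primitive _ (fun t => k * F t)) //; first by ring.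
  by move=> t; apply: contM => //; exact: cont_cst.
move=> t /andP[h _]; have At := lt_le_trans Aa h.
by apply: catZ; exact: hF.
Qed.

Lemma cintB f g a b : (forall t, cont f t) -> (forall t, cont g t) ->
  A < a -> a <= b ->
  cint A (fun t => f t - g t) a b = cint A f a b - cint A g a b.
Proof.
move=> cf cg Aa ab; have [F hF ->] := cintP cf; have [G hG ->] := cintP cg.
rewrite (@cint_primitive _ (fun t => F t - G t)) //; first by ring.
  by move=> t; apply: contB.
move=> t /andP[h _]; have At := lt_le_trans Aa h.
by apply: catB; [exact: hF|exact: hG].
Qed.

End Cint.
End Calculus.

(** * Power series *)

Section PowerSeries.
Variable R : realType.
Local Notation C := (CC R).
Local Notation nm := (@Normc.normc R).
Implicit Types (a b : nat -> C) (z w : C).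

Lemma nm_lim_le (u : nat -> C) (l : C) (B : R) :
  u n @[n --> \oo] --> l -> (forall n, nm (u n) <= B) -> nm l <= B.
Proof.
move=> /cvgC ul h; apply/ler_addgt0Pr => e e0.
have [N _ hN] := ul _ e0; have /= hh := hN N (leqnn N).
rewrite -(subrK (u N) l) (le_trans (nmD _ _)) // addrC lerD //.
by rewrite nmBC ltW.
Qed.

Lemma cvgC_uniq (u : nat -> C) (l m : C) :
  u n @[n --> \oo] --> l -> u n @[n --> \oo] --> m -> l = m.
Proof.
move=> /cvgC h /cvgC h'; apply/eqP; rewrite -subr_eq0; apply/eqP.
apply: nm_eq_small => e e0.
have e2 : 0 < e / 2 by rewrite divr_gt0.
have [N _ hN] := h _ e2; have [M _ hM] := h' _ e2.
have /= h1 := hN (N + M)%N (leq_addr _ _).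
have /= h2 := hM (N + M)%N (leq_addl _ _).
have -> : l - m = (u (N + M)%N - m) - (u (N + M)%N - l) by ring.
by rewrite (le_trans (nmB _ _)) //; lra.
Qed.

Definition clim (u : nat -> C) : C :=
  Complex (limn (fun n => complex.Re (u n))) (limn (fun n => complex.Im (u n))).

Lemma clim_cvg (u : nat -> C) (b : nat -> R) :
  (forall N M, (N <= M)%N -> nm (u M - u N) <= b N) ->
  b n @[n --> \oo] --> (0 : R) -> u n @[n --> \oo] --> clim u.
Proof.
move=> h b0.
have key (f : C -> R) : (forall z w, `|f z - f w| <= nm (z - w)) ->
    cvgn (fun n => f (u n)).
  move=> hf; apply: cauchy_cvg; apply/cauchy_exP => e e0.
  move/cvgrPdist_lt : b0 => /(_ _ e0) [N _ hN].
  exists (f (u N)); exists N => // M /= NM.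
  rewrite /ball /= distrC (le_lt_trans (hf _ _)) // (le_lt_trans (h _ _ NM)) //.
  have /= := hN N (leqnn N); rewrite sub0r normrN.
  exact: le_lt_trans (ler_norm _).
have c1 : cvgn (fun n => complex.Re (u n)).
  by apply: key => z w; rewrite -ReN -ReD nm_Re.
have c2 : cvgn (fun n => complex.Im (u n)).
  by apply: key => z w; rewrite -ImN -ImD nm_Im.
apply/cvgC => e e0.
have e2 : 0 < e / 2 by rewrite divr_gt0.
move/cvgrPdist_lt : c1 => /(_ _ e2) h1.
move/cvgrPdist_lt : c2 => /(_ _ e2) h2.
near=> n.
rewrite (le_lt_trans (nm_le_ReIm _)) // ReD ReN ImD ImN /= [ltRHS]splitr ltrD //.
  by rewrite distrC; near: n.
by rewrite distrC; near: n.
Unshelve. all: by end_near. Qed.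

Definition psm a n z := \sum_(k < n) a k * z ^+ k.
Definition psum a z : C := clim (fun n => psm a n z).
(** Radius of convergence at least 1, in the form used by Abel's lemma. *)
Definition rad a := forall r : R, 0 < r < 1 ->
  exists K, forall n, nm (a n) * r ^+ n <= K.

Lemma psmS a n z : psm a n.+1 z = psm a n z + a n * z ^+ n.
Proof. by rewrite /psm big_ord_recr. Qed.

Lemma psm_tail a z r K N M : 0 < r -> nm z < r ->
  (forall n, nm (a n) * r ^+ n <= K) -> (N <= M)%N ->
  nm (psm a M z - psm a N z) <= K * (nm z / r) ^+ N / (1 - nm z / r).
Proof.
move=> r0 zr hK NM; set t := nm z / r.
have t0 : 0 <= t by rewrite divr_ge0 ?nm_ge0 // ltW.
have t1 : t < 1 by rewrite ltr_pdivrMr // mul1r.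
have K0 : 0 <= K.
  by apply: le_trans (hK 0%N); rewrite mulr_ge0 ?nm_ge0 // exprn_ge0 // ltW.
rewrite ler_pdivlMr ?subr_gt0 // -(subnKC NM).
(* The induction carries the exact geometric remainder, with its factor [1 - t^(M-N)], so that
   adding one term telescopes. *)
suff /le_trans : nm (psm a (N + (M - N)) z - psm a N z) * (1 - t) <=
    K * t ^+ N * (1 - t ^+ (M - N)).
  apply; rewrite ler_piMr ?mulr_ge0 ?exprn_ge0 //.
  by rewrite lerBlDr lerDl exprn_ge0.
elim: (M - N)%N => [|m IH]; first by rewrite addn0 !subrr nm0 mul0r mulr0.
rewrite addnS psmS.
have -> : psm a (N + m) z + a (N + m)%N * z ^+ (N + m) - psm a N z =
  (psm a (N + m) z - psm a N z) + a (N + m)%N * z ^+ (N + m) by ring.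
have hm : nm (a (N + m)%N * z ^+ (N + m)) <= K * t ^+ N * t ^+ m.
  rewrite -mulrA -exprD nmM nmX.
  have -> : nm z ^+ (N + m) = r ^+ (N + m) * t ^+ (N + m).
    by rewrite -exprMn mulrC divfK // gt_eqF.
  by rewrite mulrA ler_wpM2r ?exprn_ge0.
have t1' : 0 <= 1 - t by rewrite subr_ge0 ltW.
apply: le_trans (ler_wpM2r t1' (nmD _ _)) _.
rewrite mulrDl.
have : nm (a (N + m)%N * z ^+ (N + m)) * (1 - t) <= K * t ^+ N * t ^+ m * (1 - t).
  by rewrite ler_wpM2r // subr_ge0 ltW.
by move: IH; rewrite exprS; lra.
Qed.

Lemma geo_cvg0 (K t : R) : 0 <= t < 1 -> (K * t ^+ n) @[n --> \oo] --> (0 : R).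
Proof.
move=> /andP[t0 t1]; rewrite -[X in _ --> X](mulr0 K).
by apply: cvgM; [exact: cvg_cst|apply: cvg_expr; rewrite ger0_norm].
Qed.

Lemma psum_cvg1 a z r K : 0 < r -> nm z < r ->
  (forall n, nm (a n) * r ^+ n <= K) -> psm a n z @[n --> \oo] --> psum a z.
Proof.
move=> r0 zr hK.
apply: (clim_cvg (b := fun N => K * (nm z / r) ^+ N / (1 - nm z / r))).
  by move=> N M; exact: psm_tail.
have t0 : 0 <= nm z / r by rewrite divr_ge0 ?nm_ge0 // ltW.
have t1 : nm z / r < 1 by rewrite ltr_pdivrMr // mul1r.
under eq_fun do rewrite mulrAC.
by apply: geo_cvg0; rewrite t0.
Qed.

Lemma between z : nm z < 1 -> exists2 r : R, 0 < r < 1 & nm z < r.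
Proof.
move=> z1; exists ((1 + nm z) / 2); last by lra.
by have := nm_ge0 z; move=> ?; apply/andP; split; lra.
Qed.

Lemma psum_cvg a z : rad a -> nm z < 1 -> psm a n z @[n --> \oo] --> psum a z.
Proof.
move=> ra /between[r r01 zr]; have [K hK] := ra _ r01.
by apply: psum_cvg1 zr hK; case/andP: r01.
Qed.

Lemma psum_tail a z r K N : 0 < r -> nm z < r ->
  (forall n, nm (a n) * r ^+ n <= K) ->
  nm (psum a z - psm a N z) <= K * (nm z / r) ^+ N / (1 - nm z / r).
Proof.
move=> r0 zr hK.
have /cvgC h := psum_cvg1 r0 zr hK.
apply/ler_addgt0Pr => e /h [M _ hM].
have /= h1 := hM (N + M)%N (leq_addl _ _).
have := psm_tail r0 zr hK (leq_addr M N).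
have -> : psum a z - psm a N z = (psm a (N + M) z - psm a N z) -
  (psm a (N + M) z - psum a z) by ring.
by move=> h2; rewrite (le_trans (nmB _ _)) // lerD // ltW.
Qed.

Lemma psum_eq a z l : rad a -> nm z < 1 ->
  psm a n z @[n --> \oo] --> l -> psum a z = l.
Proof. by move=> ra z1; apply: cvgC_uniq; exact: psum_cvg. Qed.

Lemma geo_sum (t : R) N : 0 <= t < 1 -> \sum_(k < N) t ^+ k <= (1 - t)^-1.
Proof.
move=> /andP[t0 t1]; rewrite -div1r ler_pdivlMr ?subr_gt0 //.
suff -> : (\sum_(k < N) t ^+ k) * (1 - t) = 1 - t ^+ N.
  by rewrite lerBlDr lerDl exprn_ge0.
elim: N => [|N IH]; first by rewrite big_ord0 expr0; ring.
by rewrite big_ord_recr /= mulrDl IH exprS; ring.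
Qed.

Lemma rad_abs a (r : R) : rad a -> 0 < r < 1 ->
  exists B, forall N, \sum_(k < N) nm (a k) * r ^+ k <= B.
Proof.
move=> ra /andP[r0 r1].
pose s := (1 + r) / 2.
have s01 : 0 < s < 1 by apply/andP; rewrite /s; split; lra.
have s0 : 0 < s by case/andP: s01.
have [K hK] := ra _ s01.
have t01 : 0 <= r / s < 1.
  by rewrite divr_ge0 ?ltW //= ltr_pdivrMr // mul1r /s; lra.
exists (K * (1 - r / s)^-1) => N.
have K0 : 0 <= K.
  by apply: le_trans (hK 0%N); rewrite mulr_ge0 ?nm_ge0 // exprn_ge0 // ltW.
apply: (@le_trans _ _ (\sum_(k < N) K * (r / s) ^+ k)).
  apply: ler_sum => k _.
  have -> : r ^+ k = s ^+ k * (r / s) ^+ k by rewrite -exprMn mulrC divfK // gt_eqF.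
  by rewrite mulrA ler_wpM2r ?exprn_ge0 //; case/andP: t01.
by rewrite -mulr_sumr ler_wpM2l // geo_sum.
Qed.

(** Each of the [n+1] terms of the geometric sum up to [t^n] is at least [t^n]. *)
Lemma lin_geo_bound (t : R) : 0 < t < 1 -> exists K, forall n, n.+1%:R * t ^+ n <= K.
Proof.
move=> /andP[t0 t1]; exists (1 - t)^-1 => n.
apply: le_trans (geo_sum n.+1 _); last by rewrite ltW.
rewrite mulr_natl -[X in _ *+ X]card_ord -sumr_const; apply: ler_sum => k _.
by rewrite ler_wiXn2l ?ltW // -ltnS.
Qed.

Lemma rad_natM a : rad a -> rad (fun n => n.+1%:R * a n).
Proof.
move=> ra r /andP[r0 r1].
pose s := (1 + r) / 2.
have s01 : 0 < s < 1 by apply/andP; rewrite /s; split; lra.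
have s0 : 0 < s by case/andP: s01.
have [K hK] := ra _ s01.
have t01 : 0 < r / s < 1.
  by rewrite divr_gt0 //= ltr_pdivrMr // mul1r /s; lra.
have [L hL] := lin_geo_bound t01.
exists (L * K) => n.
have -> : nm (n.+1%:R * a n) * r ^+ n =
    (n.+1%:R * (r / s) ^+ n) * (nm (a n) * s ^+ n).
  have -> : r ^+ n = s ^+ n * (r / s) ^+ n by rewrite -exprMn mulrC divfK // gt_eqF.
  by rewrite nmM nm_nat; ring.
rewrite ler_pM // mulr_ge0 ?exprn_ge0 ?nm_ge0 ?ltW //.
by rewrite divr_gt0.
Qed.

Definition dfs a n := n.+1%:R * a n.+1.
Definition shift a n := if n is m.+1 then a m else 0 : C.

Lemma rad_le a b (K : R) : (forall n, nm (b n) <= K * nm (a n)) -> rad a -> rad b.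
Proof.
move=> h ra r r01; have [L hL] := ra _ r01.
have [K0|K0] := leP 0 K.
  exists (K * L) => n; apply: le_trans (_ : K * nm (a n) * r ^+ n <= _).
    by rewrite ler_wpM2r // exprn_ge0 //; case/andP: r01 => /ltW.
  by rewrite -mulrA ler_wpM2l.
exists L => n; apply: le_trans (hL n); rewrite ler_wpM2r ?exprn_ge0 //.
  by case/andP: r01 => /ltW.
apply: le_trans (h n) _; apply: le_trans (nm_ge0 _).
by rewrite nmulr_rle0 // nm_ge0.
Qed.

Lemma rad_behead a : rad a -> rad (fun n => a n.+1).
Proof.
move=> ra r r01; have [K hK] := ra _ r01; have r0 : 0 < r by case/andP: r01.
exists (K / r) => n; rewrite ler_pdivlMr //.
by rewrite -mulrA -exprSr.
Qed.

Lemma rad_shift a : rad a -> rad (shift a).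
Proof.
move=> ra r r01; have [K hK] := ra _ r01; have [r0 r1] := andP r01.
have K0 : 0 <= K.
  by apply: le_trans (hK 0%N); rewrite mulr_ge0 ?nm_ge0 // exprn_ge0 // ltW.
exists K => n; case: n => [|n]; first by rewrite nm0 mul0r.
rewrite /shift.
rewrite exprS mulrCA (le_trans _ (hK n)) // ler_piMl ?(ltW r1) //.
by rewrite mulr_ge0 ?nm_ge0 // exprn_ge0 // ltW.
Qed.

Lemma rad_dfs a : rad a -> rad (dfs a).
Proof.
move=> /rad_natM/rad_behead; apply: (@rad_le _ _ 1) => n.
by rewrite mul1r /dfs !nmM !nm_nat ler_wpM2r ?nm_ge0 // ler_nat.
Qed.

Lemma radD a b : rad a -> rad b -> rad (fun n => a n + b n).
Proof.
move=> ra rb r r01; have [K hK] := ra _ r01; have [L hL] := rb _ r01.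
exists (K + L) => n; apply: le_trans (lerD (hK n) (hL n)).
rewrite -mulrDl ler_wpM2r ?nmD // exprn_ge0 //.
by case/andP: r01 => /ltW.
Qed.

Lemma radZ (c : C) a : rad a -> rad (fun n => c * a n).
Proof. by apply: (@rad_le _ _ (nm c)) => n; rewrite nmM. Qed.

Lemma radN a : rad a -> rad (fun n => - a n).
Proof. by apply: (@rad_le _ _ 1) => n; rewrite nmN mul1r. Qed.

Lemma psmD a b n z : psm (fun n => a n + b n) n z = psm a n z + psm b n z.
Proof. by rewrite /psm -big_split; apply: eq_bigr => k _; rewrite mulrDl. Qed.

Lemma psmZ c a n z : psm (fun n => c * a n) n z = c * psm a n z.
Proof. by rewrite /psm mulr_sumr; apply: eq_bigr => k _; rewrite mulrA. Qed.

Lemma cvgCM (u v : nat -> C) (l m : C) : u n @[n --> \oo] --> l ->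
  v n @[n --> \oo] --> m -> (u n * v n) @[n --> \oo] --> l * m.
Proof. exact: (@cvgM R[i] nat \oo _ u v l m). Qed.

Lemma cvgCD (u v : nat -> C) (l m : C) : u n @[n --> \oo] --> l ->
  v n @[n --> \oo] --> m -> (u n + v n) @[n --> \oo] --> l + m.
Proof. exact: (@cvgD R[i] C nat \oo _ u v l m). Qed.

Lemma cvgC_cst (c : C) : (fun _ : nat => c) n @[n --> \oo] --> c.
Proof. exact: cvg_cst. Qed.

Lemma cvgCB (u v : nat -> C) (l m : C) : u n @[n --> \oo] --> l ->
  v n @[n --> \oo] --> m -> (u n - v n) @[n --> \oo] --> l - m.
Proof.
move=> hu hv; have := cvgCD hu (cvgCM (@cvgC_cst (-1)) hv).
rewrite mulN1r; apply: cvg_trans; apply: near_eq_cvg; near=> n.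
by rewrite mulN1r.
Unshelve. all: by end_near. Qed.

Lemma cvgC_succ (u : nat -> C) (l : C) :
  u n.+1 @[n --> \oo] --> l <-> u n @[n --> \oo] --> l.
Proof. by split => h; [rewrite -cvg_shiftS|rewrite cvg_shiftS]. Qed.

Lemma psumD a b z : rad a -> rad b -> nm z < 1 ->
  psum (fun n => a n + b n) z = psum a z + psum b z.
Proof.
move=> ra rb z1; apply: psum_eq => //; first exact: radD.
under eq_fun do rewrite psmD.
by apply: cvgCD; exact: psum_cvg.
Qed.

Lemma psumZ c a z : rad a -> nm z < 1 -> psum (fun n => c * a n) z = c * psum a z.
Proof.
move=> ra z1; apply: psum_eq => //; first exact: radZ.
under eq_fun do rewrite psmZ.
by apply: cvgCM; [exact: cvgC_cst|exact: psum_cvg].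
Qed.

Lemma psumB a b z : rad a -> rad b -> nm z < 1 ->
  psum (fun n => a n - b n) z = psum a z - psum b z.
Proof.
move=> ra rb z1; have -> : (fun n => a n - b n) = (fun n => a n + (-1) * b n).
  by apply/funext => n; rewrite mulN1r.
by rewrite psumD ?psumZ ?mulN1r //; exact: radZ.
Qed.

Lemma psm_shift a n z : psm (shift a) n.+1 z = z * psm a n z.
Proof.
rewrite /psm big_ord_recl /= mul0r add0r mulr_sumr; apply: eq_bigr => k _.
by rewrite /bump /= add1n exprS mulrCA.
Qed.

Lemma psum_shift a z : rad a -> nm z < 1 -> psum (shift a) z = z * psum a z.
Proof.
move=> ra z1; apply: psum_eq => //; first exact: rad_shift.
apply/cvgC_succ; under eq_fun do rewrite psm_shift.
by apply: cvgCM; [exact: cvgC_cst|exact: psum_cvg].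
Qed.

Lemma rad_fin a N : (forall n, (N <= n)%N -> a n = 0) -> rad a.
Proof.
move=> h r /andP[r0 r1]; exists (\sum_(k < N) nm (a k) * r ^+ k) => n.
have p k : 0 <= nm (a k) * r ^+ k by rewrite mulr_ge0 ?nm_ge0 // exprn_ge0 // ltW.
case: (ltnP n N) => nN; last by rewrite h // nm0 mul0r sumr_ge0.
by rewrite (bigD1 (Ordinal nN)) //= lerDl sumr_ge0.
Qed.

Lemma psum_fin a z N : (forall n, (N <= n)%N -> a n = 0) -> nm z < 1 ->
  psum a z = psm a N z.
Proof.
move=> h z1; apply: psum_eq => //; first exact: rad_fin h.
apply: cvg_near_cst; exists N => // n /= /subnKC <-.
elim: (n - N)%N => [|m IH]; first by rewrite addn0.
by rewrite addnS psmS IH h ?leq_addr // mul0r addr0.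
Qed.

Lemma psum0 a : rad a -> psum a 0 = a 0%N.
Proof.
move=> ra; apply: psum_eq => //; first by rewrite nm0.
apply/cvgC_succ; apply: cvg_near_cst; apply: nearW => n.
rewrite /psm big_ord_recl /= expr0 mulr1 big1 ?addr0 // => k _.
by rewrite expr0n /= mulr0.
Qed.

(** Second order Taylor remainder of a power, of size [k^2 r^(k-2)]. Both sides carry [r^2] to keep
    exponents natural. The remainder of order [k+1] is [w] times that of order [k] plus
    [k z^(k-1) (w-z)^2]. *)
Lemma pow_taylor z w (r : R) k : 0 < r -> nm z <= r -> nm w <= r ->
  r ^+ 2 * nm (w ^+ k - z ^+ k - k%:R * z ^+ k.-1 * (w - z)) <=
  k%:R ^+ 2 * r ^+ k * nm (w - z) ^+ 2.
Proof.
move=> r0 zr wr; elim: k => [|k IH].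
  by rewrite !expr0 subrr !mul0r subr0 nm0 mulr0 expr0n /= !mul0r.
set T := w ^+ k - z ^+ k - k%:R * z ^+ k.-1 * (w - z) in IH *.
have -> : w ^+ k.+1 - z ^+ k.+1 - k.+1%:R * z ^+ k.+1.-1 * (w - z) =
    w * T + k%:R * z ^+ k.-1 * (w - z) ^+ 2.
  rewrite /T /= -natr1; case: (k) => [|j] /=; first by rewrite !expr0 !expr1; ring.
  by rewrite !exprS; ring.
have h1 : nm (w * T + k%:R * z ^+ k.-1 * (w - z) ^+ 2) <=
    r * nm T + k%:R * r ^+ k.-1 * nm (w - z) ^+ 2.
  have e : nm (k%:R * z ^+ k.-1 * (w - z) ^+ 2) = k%:R * nm z ^+ k.-1 * nm (w - z) ^+ 2.
    by rewrite nmM nmM nm_nat nmX nmX.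
  rewrite (le_trans (nmD _ _)) // e nmM lerD //.
    by rewrite ler_wpM2r ?nm_ge0.
  rewrite ler_wpM2r ?exprn_ge0 ?nm_ge0 // ler_wpM2l //.
  by apply: lerXn2r => //; rewrite nnegrE ?nm_ge0 // ltW.
apply: le_trans (ler_wpM2l (exprn_ge0 2 (ltW r0)) h1) _.
rewrite mulrDr mulrCA.
apply: le_trans (lerD (ler_wpM2l (ltW r0) IH) (lexx _)) _.
have -> : r ^+ 2 * (k%:R * r ^+ k.-1 * nm (w - z) ^+ 2) =
    k%:R * r ^+ k.+1 * nm (w - z) ^+ 2.
  case: (k) => [|j] /=; first by rewrite !mul0r mulr0.
  by rewrite !exprS; ring.
have -> : r * (k%:R ^+ 2 * r ^+ k * nm (w - z) ^+ 2) =
  k%:R ^+ 2 * r ^+ k.+1 * nm (w - z) ^+ 2 by rewrite (exprS r k); ring.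
rewrite -!mulrDl ler_wpM2r ?exprn_ge0 ?nm_ge0 // ler_wpM2r ?exprn_ge0 ?(ltW r0) //.
rewrite -natr1; have : 0 <= k%:R :> R by []. 
by nra.
Qed.

(** Termwise differentiation: summing the remainders of the powers leaves [B/r^2 |w-z|^2], where [B]
    bounds the sums of [(k+1)^2 |a_k| r^k]. *)
Lemma psum_cdf a z : rad a -> nm z < 1 -> cdf (psum a) z (psum (dfs a) z).
Proof.
move=> ra z1; have [r r01 zr] := between z1.
have [r0 r1] := andP r01.
have [B hB] := rad_abs (rad_natM (rad_natM ra)) r01.
have est w : nm w < r ->
    nm (psum a w - psum a z - psum (dfs a) z * (w - z)) <= B / r ^+ 2 * nm (w - z) ^+ 2.
  move=> wr; have w1 := lt_trans wr r1.
  pose u n := psm a n.+1 w - psm a n.+1 z - psm (dfs a) n z * (w - z).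
  apply: (@nm_lim_le u).
    apply: cvgCB; first by apply: cvgCB; [exact: (proj2 (cvgC_succ (psm a ^~ w) _) (psum_cvg ra w1))|exact: (proj2 (cvgC_succ (psm a ^~ z) _) (psum_cvg ra z1))].
    by apply: cvgCM; [apply: psum_cvg => //; exact: rad_dfs|exact: cvgC_cst].
  move=> n.
  have -> : u n = \sum_(k < n.+1) a k * (w ^+ k - z ^+ k - k%:R * z ^+ k.-1 * (w - z)).
    elim: n => [|n IH].
      by rewrite /u !psmS /psm !big_ord0 big_ord1 /= !expr0; ring.
    rewrite big_ord_recr -IH /u !(psmS _ n.+1) (psmS (dfs a)) /dfs /=; ring.
  rewrite (le_trans (nm_sum _ _ _)) //.
  rewrite -(@ler_pM2l _ (r ^+ 2)) ?exprn_gt0 //.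
  have -> : r ^+ 2 * (B / r ^+ 2 * nm (w - z) ^+ 2) = B * nm (w - z) ^+ 2.
    by field; rewrite gt_eqF.
  rewrite mulr_sumr.
  apply: le_trans (ler_wpM2r (exprn_ge0 2 (nm_ge0 _)) (hB n.+1)).
  rewrite mulr_suml; apply: ler_sum => k _.
  rewrite nmM mulrCA.
  have := pow_taylor k r0 (ltW zr) (ltW wr).
  move=> /(ler_wpM2l (nm_ge0 (a k))) /le_trans; apply.
  have -> : nm (k.+1%:R * (k.+1%:R * a k)) = k.+1%:R ^+ 2 * nm (a k).
    by rewrite nmM nmM nm_nat expr2 mulrA.
  rewrite mulrA [nm (a k) * _]mulrA ler_wpM2r ?exprn_ge0 ?nm_ge0 //.
  rewrite ler_wpM2r ?exprn_ge0 ?(ltW r0) // mulrC ler_wpM2r ?nm_ge0 //.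
  by apply: lerXn2r; rewrite ?nnegrE // ler_nat.
have B0 : 0 <= B by have := hB 0%N; rewrite big_ord0.
apply/cdf_eps => e e0.
pose s := Num.min (r - nm z) (e / (B / r ^+ 2 + 1)).
have D0 : 0 < B / r ^+ 2 + 1.
  by rewrite ltr_wpDl // divr_ge0 // exprn_ge0 // ltW.
exists s; first by rewrite lt_min subr_gt0 zr divr_gt0.
move=> w; rewrite lt_min => /andP[h1 h2].
have wr : nm w < r.
  by rewrite -(subrK z w) (le_lt_trans (nmD _ _)) // -ltrBrDr.
rewrite (le_trans (est _ wr)) // expr2 mulrA ler_wpM2r ?nm_ge0 //.
move: h2; rewrite ltr_pdivlMr // => h2.
by have := nm_ge0 (w - z); nra.
Qed.

Lemma psum_inj0 a : rad a -> (forall z, nm z < 1 -> psum a z = 0) ->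
  forall n, a n = 0.
Proof.
move=> ra h n; elim: n a ra h => [|n IH] a ra h.
  by rewrite -psum0 ?h ?nm0.
have : dfs a n = 0.
  apply: IH; first exact: rad_dfs.
  move=> z z1; have d := psum_cdf ra z1.
  apply: (cdf_uniq d); apply: (@cdf_near _ (fun=> 0) _ _ _ (1 - nm z)).
  - by rewrite subr_gt0.
  - move=> w hw; rewrite h //.
    by rewrite -(subrK z w) (le_lt_trans (nmD _ _)) // -ltrBrDr.
  - exact: cat_cst.
by rewrite /dfs => /eqP; rewrite mulf_eq0 pnatr_eq0 /= => /eqP.
Qed.

Lemma psum_inj a b : rad a -> rad b ->
  (forall z, nm z < 1 -> psum a z = psum b z) -> forall n, a n = b n.
Proof.
move=> ra rb h n; apply/eqP; rewrite -subr_eq0; apply/eqP.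
apply: (@psum_inj0 (fun n => a n - b n)).
  by apply: radD => //; exact: radN.
by move=> z z1; rewrite psumB // h // subrr.
Qed.

(** The quotient by [z - c] has the scaled tails of [a] at [c] as coefficients. *)
Lemma psum_div a (c : C) : rad a -> c != 0 -> nm c < 1 ->
  exists2 b, rad b &
    forall z, nm z < 1 -> psum a z = psum a c + (z - c) * psum b z.
Proof.
move=> ra c0 c1.
pose T k := psum a c - psm a k c.
pose b k := T k.+1 / c ^+ k.+1.
have cn0 : 0 < nm c by rewrite nm_gt0.
have est (s : R) : 0 < s < 1 -> exists K, forall k, nm (T k) * s ^+ k <= K * nm c ^+ k.
  move=> s01; have [r r01 cr] := between c1.
  pose t := Num.max r s.
  have t01 : 0 < t < 1.
    case/andP: r01 => r0 r1; case/andP: s01 => s0 s1.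
    by rewrite lt_max r0 /= gt_max r1 s1.
  have t0 : 0 < t by case/andP: t01.
  have ct : nm c < t by rewrite lt_max cr.
  have [K hK] := ra _ t01.
  exists (K / (1 - nm c / t)) => k.
  have s0 : 0 <= s by case/andP: s01 => /ltW.
  apply: le_trans (_ : nm (T k) * t ^+ k <= _).
    rewrite ler_wpM2l ?nm_ge0 //; apply: lerXn2r; rewrite ?nnegrE ?(ltW t0) //.
    by rewrite le_max lexx orbT.
  apply: le_trans (ler_wpM2r (exprn_ge0 k (ltW t0)) (psum_tail k t0 ct hK)) _.
  rewrite exprMn exprVn le_eqVlt; apply/orP; left; apply/eqP.
  field; rewrite ?gt_eqF ?exprn_gt0 ?subr_gt0 //=.
have rb : rad b.
  move=> s s01; have [K hK] := est _ s01; have s0 : 0 < s by case/andP: s01.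
  exists (K / s) => n; rewrite ler_pdivlMr // /b nmM nmV nmX.
  have -> : nm (T n.+1) / nm c ^+ n.+1 * s ^+ n * s =
    nm (T n.+1) * s ^+ n.+1 / nm c ^+ n.+1 by rewrite (exprS s); ring.
  by rewrite ler_pdivrMr ?exprn_gt0.
exists b => // z z1.
suff h : (z - c) * psum b z = psum a z - psum a c by rewrite h addrC subrK.
apply: (@cvgC_uniq (fun n => (z - c) * psm b n z)).
  by apply: cvgCM; [exact: cvgC_cst|exact: psum_cvg].
(* Summation by parts. The boundary term [T n (z/c)^n] tends to 0, since [est] bounds the tail [T n]
   by a multiple of [(|c|/r)^n] for some [r > |z|]. *)
have e n : (z - c) * psm b n z = T n / c ^+ n * z ^+ n - psum a c + psm a n z.
  elim: n => [|n IH].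
    by rewrite /psm !big_ord0 /T /psm big_ord0 !expr0; field.
  have hT : T n = T n.+1 + a n * c ^+ n by rewrite /T psmS; ring.
  rewrite !psmS mulrDr IH /b hT (exprS c) (exprS z); field.
  by rewrite c0 expf_neq0.
under eq_fun do rewrite e.
have -> : psum a z - psum a c = 0 - psum a c + psum a z by rewrite sub0r addrC.
apply: cvgCD; last exact: psum_cvg.
apply: cvgCB; last exact: cvgC_cst.
have [r r01 zr] := between z1; have [K hK] := est _ r01.
have r0 : 0 < r by case/andP: r01.
have t01 : 0 <= nm z / r < 1 by rewrite divr_ge0 ?nm_ge0 ?ltW //= ltr_pdivrMr // mul1r.
apply/cvgC => eps eps0.
have /cvgrPdist_lt /(_ _ eps0) := geo_cvg0 K t01.
apply: filterS => n; rewrite sub0r normrN subr0; apply: le_lt_trans.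
apply: le_trans (ler_norm _).
rewrite !nmM nmV !nmX expr_div_n mulrA ler_pdivlMr ?exprn_gt0 //.
have -> : nm (T n) / nm c ^+ n * nm z ^+ n * r ^+ n =
  nm (T n) * r ^+ n / nm c ^+ n * nm z ^+ n by ring.
by rewrite ler_wpM2r ?exprn_ge0 ?nm_ge0 // ler_pdivrMr ?exprn_gt0.
Qed.

End PowerSeries.

(** * Analytic functions on the disk are sums of power series *)

Section Bisection.
Variable R : realType.

(** Nested bisection, as in Goursat's lemma: a subadditive function of
    rectangles which is infinitesimal with respect to the area vanishes. *)
Variable Q : R -> R -> R -> R -> R.
Hypothesis Qs : forall a b c d, Q a b c d <= Q a ((a + b) / 2) c d + Q ((a + b) / 2) b c d.
Hypothesis Qt : forall a b c d, Q a b c d <= Q a b c ((c + d) / 2) + Q a b ((c + d) / 2) d.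

Definition halve (q : R -> R -> R) (p : R * R) : R * R :=
  let m := (p.1 + p.2) / 2 in if q p.1 p.2 <= 2 * q p.1 m then (p.1, m) else (m, p.2).

Lemma halveP (q : R -> R -> R) p : p.1 <= p.2 ->
  q p.1 p.2 <= q p.1 ((p.1 + p.2) / 2) + q ((p.1 + p.2) / 2) p.2 ->
  let p' := halve q p in
  [/\ p.1 <= p'.1, p'.1 <= p'.2, p'.2 <= p.2,
      p'.2 - p'.1 = (p.2 - p.1) / 2 & q p.1 p.2 <= 2 * q p'.1 p'.2].
Proof.
case: p => a b /= ab h; rewrite /halve /=; case: ifPn => [h'|]; last rewrite -ltNge => h'.
  by split => //=; lra.
by split => /=; lra.
Qed.

Definition step (x : (R * R) * (R * R)) : (R * R) * (R * R) :=
  let p := halve (fun a b => Q a b x.2.1 x.2.2) x.1 in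
  (p, halve (fun c d => Q p.1 p.2 c d) x.2).

Lemma bisection (a b c d : R) : a <= b -> c <= d ->
  (forall s t : R, a <= s <= b -> c <= t <= d -> forall e, 0 < e ->
    exists2 r, 0 < r & forall a' b' c' d', a <= a' -> b' <= b -> c <= c' -> d' <= d ->
      a' <= s <= b' -> c' <= t <= d' -> b' - a' < r -> d' - c' < r ->
      Q a' b' c' d' <= e * ((b' - a') + (d' - c')) ^+ 2) ->
  Q a b c d <= 0.
Proof.
move=> ab cd hQ.
pose x n := iter n step ((a, b), (c, d)).
have xS n : x n.+1 = step (x n) by [].
have inv n : [/\ (x n).1.1 <= (x n).1.2, (x n).2.1 <= (x n).2.2,
    (x n).1.2 - (x n).1.1 = (b - a) / 2 ^+ n, (x n).2.2 - (x n).2.1 = (d - c) / 2 ^+ n &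
    Q a b c d <= 4 ^+ n * Q (x n).1.1 (x n).1.2 (x n).2.1 (x n).2.2].
  elim: n => [|n [h1 h2 h3 h4 h5]]; first by rewrite /x /= !expr0 !divr1 mul1r.
  rewrite xS /step /=.
  have [_ k1 _ k2 k3] := @halveP (fun a b => Q a b (x n).2.1 (x n).2.2) (x n).1 h1 (Qs _ _ _ _).
  set p := halve _ (x n).1 in k1 k2 k3 *.
  have [_ l1 _ l2 l3] := @halveP (fun c d => Q p.1 p.2 c d) (x n).2 h2 (Qt _ _ _ _).
  split => //.
  - by rewrite k2 h3 exprS; field; rewrite expf_neq0.
  - by rewrite l2 h4 exprS; field; rewrite expf_neq0.
  - apply: le_trans h5 _; rewrite exprS (mulrC 4) -mulrA ler_wpM2l ?exprn_ge0 //.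
    by lra.
have mon n : [/\ (x n).1.1 <= (x n.+1).1.1, (x n.+1).1.2 <= (x n).1.2,
    (x n).2.1 <= (x n.+1).2.1 & (x n.+1).2.2 <= (x n).2.2].
  have [h1 h2 _ _ _] := inv n.
  rewrite xS /step /=.
  have [k0 k1 k2 _ _] := @halveP (fun a b => Q a b (x n).2.1 (x n).2.2) (x n).1 h1 (Qs _ _ _ _).
  set p := halve _ (x n).1 in k0 k1 k2 *.
  by have [l0 l1 l2 _ _] := @halveP (fun c d => Q p.1 p.2 c d) (x n).2 h2 (Qt _ _ _ _).
have mon2 n m : (n <= m)%N -> [/\ (x n).1.1 <= (x m).1.1, (x m).1.2 <= (x n).1.2,
    (x n).2.1 <= (x m).2.1 & (x m).2.2 <= (x n).2.2].
  move=> /subnKC <-; elim: (m - n)%N => [|k [i1 i2 i3 i4]]; first by rewrite addn0.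
  rewrite addnS; have [j1 j2 j3 j4] := mon (n + k)%N.
  by split; [exact: le_trans i1 j1|exact: le_trans j2 i2|exact: le_trans i3 j3|exact: le_trans j4 i4].
have sep (u v : nat -> R) : (forall n, u n <= v n) -> (forall n m, (n <= m)%N -> u n <= u m) ->
    (forall n m, (n <= m)%N -> v m <= v n) -> exists s, forall n, u n <= s <= v n.
  move=> uv um vm.
  have ub n m : u m <= v n.
    case: (leqP n m) => [nm|/ltnW mn]; first exact: le_trans (uv m) (vm _ _ nm).
    exact: le_trans (um _ _ mn) (uv n).
  exists (sup (range u)) => n; apply/andP; split.
    apply: ub_le_sup; last by exists n.
    by exists (v 0%N) => _ [m _ <-].
  apply: ge_sup; first by exists (u 0%N); exists 0%N.
  by move=> _ [m _ <-].
have [s hs] : exists s, forall n, (x n).1.1 <= s <= (x n).1.2.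
  by apply: sep => [n|n m /mon2[]|n m /mon2[]] //; have [] := inv n.
have [t ht] : exists t, forall n, (x n).2.1 <= t <= (x n).2.2.
  by apply: sep => [n|n m /mon2[]|n m /mon2[]] //; have [] := inv n.
set L := (b - a) + (d - c).
have L0 : 0 <= L by rewrite /L; lra.
apply/ler_addgt0Pr => e e0; rewrite add0r.
(* After [N] steps the factor [4^N] meets the square of the perimeter term [L/2^N], which leaves
   [e L^2/(L^2+1)]; the [+ 1] covers the degenerate rectangle [L = 0]. *)
have e0' : 0 < e / (L ^+ 2 + 1) by rewrite divr_gt0 // ltr_wpDl ?exprn_ge0.
have [r r0 hr] := hQ _ _ (hs 0%N) (ht 0%N) _ e0'.
have [N hN] : exists N, L / 2 ^+ N < r.
  have t01 : 0 <= (1 / 2 : R) < 1 by lra.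
  have /cvgrPdist_lt /(_ _ r0) [N _ hN] := @geo_cvg0 R L _ t01.
  exists N; have /= := hN N (leqnn N); rewrite sub0r normrN ger0_norm.
    by rewrite expr_div_n expr1n div1r.
  by rewrite mulr_ge0 // exprn_ge0.
have [h1 h2 h3 h4 h5] := inv N.
have [m1 m2 m3 m4] := mon2 _ _ (leq0n N).
have p2 : 0 < (2 : R) ^+ N by rewrite exprn_gt0.
have w1 : (x N).1.2 - (x N).1.1 < r.
  rewrite h3; apply: le_lt_trans hN.
  by rewrite ler_wpM2r ?invr_ge0 ?(ltW p2) // /L; lra.
have w2 : (x N).2.2 - (x N).2.1 < r.
  rewrite h4; apply: le_lt_trans hN.
  by rewrite ler_wpM2r ?invr_ge0 ?(ltW p2) // /L; lra.
have := hr _ _ _ _ m1 m2 m3 m4 (hs N) (ht N) w1 w2.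
rewrite h3 h4 -mulrDl -/L => hh.
have p4 : 0 <= (4 : R) ^+ N by rewrite exprn_ge0.
apply: le_trans h5 _; apply: le_trans (ler_wpM2l p4 hh) _.
have -> : 4 ^+ N * (e / (L ^+ 2 + 1) * (L / 2 ^+ N) ^+ 2) = e * (L ^+ 2 / (L ^+ 2 + 1)).
  have -> : (4 : R) ^+ N = 2 ^+ N * 2 ^+ N by rewrite -exprMn; congr (_ ^+ N); ring.
  have key (u v : R) : u != 0 -> v + 1 != 0 ->
      u * u * (e / (v + 1) * (L / u) ^+ 2) = e * (L ^+ 2 / (v + 1)).
    by move=> u0 v0; field; rewrite ?u0 ?v0.
  by apply: key; rewrite gt_eqF // ltr_wpDl ?exprn_ge0.
rewrite ler_piMr ?(ltW e0) // ler_pdivrMr ?mul1r ?lerDl // ltr_wpDl ?exprn_ge0 //.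
Qed.

End Bisection.

(** * Goursat's lemma and Cauchy's formula on a circle *)

Section Cauchy.
Variable R : realType.
Local Notation C := (CC R).
Local Notation nm := (@Normc.normc R).
Local Notation toR := (real_complex R : R -> C).
Local Notation I := (Complex 0 1 : C).

Definition cis (t : R) : C := Complex (cos t) (sin t).

Lemma nm_cis t : nm (cis t) = 1.
Proof. by rewrite nmE /abs2 /= cos2Dsin2 sqrtr1. Qed.

Lemma cder_cis t : cder cis t (I * cis t).
Proof.
apply: cat_eq (cder_Complex (is_derive_cos t) (is_derive_sin t)) _.
by apply: complexP; rewrite ?ReM ?ImM /= ?mul0r ?mul1r ?add0r ?sub0r ?addr0.
Qed.

Lemma cder_expR t : cder (fun s => toR (expR s)) t (toR (expR t)).
Proof. exact: cder_toR (is_derive_expR t). Qed.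

Lemma cder_id t : cder toR t 1.
Proof. exact: cat_id. Qed.

Lemma contR_cst (c : C) t : cont (fun _ : R => c) t.
Proof. exact: cont_cst. Qed.

Lemma nm_I : nm I = 1.
Proof. by rewrite nmE /abs2 /= expr0n expr1n add0r sqrtr1. Qed.

Variables (w : C) (r : R).
Hypotheses (r0 : 0 < r) (r1 : r <= 1) (wr : nm w < r).

Definition gam t := toR r * cis t.
Definition ker t := I * gam t / (gam t - w).
(** Contracts the circle to [w] as [s] goes to minus infinity. With this exponential scale
    [dz/(z-w)] pulls back to [ds + ker t dt], a form with no singularity, where [ker] is the
    logarithmic derivative of [gam - w]. *)
Definition cone s t := w + toR (expR s) * (gam t - w).

Lemma nm_gam t : nm (gam t) = r.
Proof. by rewrite nmM nm_real nm_cis mulr1 ger0_norm // ltW. Qed.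

Lemma gam_neq0 t : gam t != 0.
Proof. by rewrite -nm_gt0 nm_gam. Qed.

Lemma nm_gam_w t : r - nm w <= nm (gam t - w).
Proof.
rewrite lerBlDr -(nm_gam t); apply: le_trans (nmD _ _).
by rewrite subrK.
Qed.

Lemma gam_w_neq0 t : gam t - w != 0.
Proof. by rewrite -nm_gt0 (lt_le_trans _ (nm_gam_w t)) // subr_gt0. Qed.

Definition kmax := 1 / (r - nm w).

Lemma kmax_gt0 : 0 < kmax.
Proof. by rewrite divr_gt0 // subr_gt0. Qed.

Lemma nm_ker t : nm (ker t) <= kmax.
Proof.
rewrite nmM nmV nmM nm_I mul1r nm_gam /kmax.
apply: ler_pM; rewrite ?invr_ge0 ?nm_ge0 ?(ltW r0) //.
rewrite lef_pV2 ?posrE ?nm_gt0 ?gam_w_neq0 ?subr_gt0 //.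
exact: nm_gam_w.
Qed.

Lemma cder_gam t : cder gam t (I * gam t).
Proof.
apply: cat_eq (catZ _ (cder_cis t)) _.
by rewrite /gam mulrCA.
Qed.

Lemma cont_gam t : cont gam t.
Proof. exact: cder_cont (cder_gam t). Qed.

Lemma cont_ker t : cont ker t.
Proof.
apply: contM; first by apply: contM; [exact: contR_cst|exact: cont_gam].
apply: contV; first exact: gam_w_neq0.
by apply: contB; [exact: cont_gam|exact: contR_cst].
Qed.

Lemma cont_cone_t s t : cont (cone s) t.
Proof.
apply: contD; first exact: contR_cst.
apply: contM; first exact: contR_cst.
by apply: contB; [exact: cont_gam|exact: contR_cst].
Qed.

Lemma cont_cone_s s t : cont (fun s => cone s t) s.
Proof.
apply: contD; first exact: contR_cst.
by apply: contM; [exact: cder_cont (cder_expR s)|exact: contR_cst].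
Qed.

Lemma nm_cone s t : s <= 0 -> nm (cone s t) <= r.
Proof.
move=> s0; have e1 : expR s <= 1 by rewrite -expR0 ler_expR.
have e0 := expR_ge0 s.
have -> : cone s t = toR (1 - expR s) * w + toR (expR s) * gam t.
  by rewrite /cone rmorphB rmorph1; ring.
rewrite (le_trans (nmD _ _)) // [nm (_ * w)]nmM [nm (_ * gam t)]nmM !nm_real nm_gam !ger0_norm ?subr_ge0 //.
have e1' : 0 <= 1 - expR s by rewrite subr_ge0.
have rw : 0 <= r - nm w by rewrite subr_ge0 ltW.
by have := mulr_ge0 e1' rw; lra.
Qed.

Lemma cone_lip s t s' t' : s <= 0 -> s' <= 0 ->
  nm (cone s t - cone s' t') <= 2 * (`|s - s'| + `|t - t'|).
Proof.
move=> s0 s0'.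
have lipe : nm (toR (expR s) - toR (expR s')) <= `|s - s'|.
  wlog ss : s s' s0 s0' / s <= s'.
    move=> h; case: (leP s s') => [|/ltW] ss; first exact: h.
    by rewrite nmBC distrC; exact: h.
  rewrite nmBC distrC (@ger0_norm _ (s' - s)) ?subr_ge0 // -[leRHS]mul1r.
  apply: (@cder_bound _ (fun s => toR (expR s)) (fun s => toR (expR s))) => // u.
    by move=> _; exact: cder_expR.
  move=> /andP[_ us]; rewrite nm_real ger0_norm ?expR_ge0 //.
  by rewrite -expR0 ler_expR (le_trans us).
have lipg : nm (gam t - gam t') <= `|t - t'|.
  wlog tt : t t' / t <= t'.
    move=> h; case: (leP t t') => [|/ltW] tt; first exact: h.
    by rewrite nmBC distrC; exact: h.
  rewrite nmBC distrC (@ger0_norm _ (t' - t)) ?subr_ge0 // -[leRHS]mul1r.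
  apply: (@cder_bound _ gam (fun t => I * gam t)) => // u.
    by move=> _; exact: cder_gam.
  by move=> _; rewrite nmM nm_I mul1r nm_gam.
have -> : cone s t - cone s' t' = (toR (expR s) - toR (expR s')) * (gam t - w) +
    toR (expR s') * (gam t - gam t') by rewrite /cone; ring.
rewrite (le_trans (nmD _ _)) // !nmM nm_real ger0_norm ?expR_ge0 // mulrDr lerD //.
  rewrite mulrC ler_pM ?nm_ge0 // (le_trans (nmB _ _)) // nm_gam.
  by move: wr r1; lra.
rewrite ler_pM ?nm_ge0 ?expR_ge0 // (@le_trans _ _ 1) //; last by lra.
by rewrite -expR0 ler_expR.
Qed.

Section Eta.
Variable A : R.

(** The integral of [g dz/(z-w)] along the image under [cone] of the boundary of the rectangle,
    written with the form [g (ds + ker dt)]. *)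
Definition eta (g : C -> C) (s1 s2 t1 t2 : R) : C :=
  (cint A (fun t => g (cone s2 t) * ker t) t1 t2 -
   cint A (fun t => g (cone s1 t) * ker t) t1 t2) -
  (cint A (fun s => g (cone s t2)) s1 s2 - cint A (fun s => g (cone s t1)) s1 s2).

Lemma eta_split_s g a m b c d : eta g a b c d = eta g a m c d + eta g m b c d.
Proof.
rewrite /eta -(cint_cat A (fun s => g (cone s d)) a m b)
  -(cint_cat A (fun s => g (cone s c)) a m b).
by do 7 (move: (cint _ _ _ _) => ?); ring.
Qed.

Lemma eta_split_t g a b c m d : eta g a b c d = eta g a b c m + eta g a b m d.
Proof.
rewrite /eta -(cint_cat A (fun t => g (cone a t) * ker t) c m d)
  -(cint_cat A (fun t => g (cone b t) * ker t) c m d).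
by do 7 (move: (cint _ _ _ _) => ?); ring.
Qed.

Variables (s1 s2 t1 t2 : R).
Hypotheses (As : A < s1) (At : A < t1) (s12 : s1 <= s2) (t12 : t1 <= t2).

Section ContinuousWeight.
Variables (g k : C -> C).
Hypotheses (cg : forall z, cont g z) (ck : forall z, cont k z).

Lemma cont_gt (f : C -> C) (cf : forall z, cont f z) s t :
  cont (fun t => f (cone s t) * ker t) t.
Proof.
by apply: contM; [exact: (cont_comp (cont_cone_t s t) (cf _))|exact: cont_ker].
Qed.

Lemma cont_gs (f : C -> C) (cf : forall z, cont f z) s t :
  cont (fun s => f (cone s t)) s.
Proof. exact: (cont_comp (cont_cone_s s t) (cf _)). Qed.

Lemma etaD : eta (fun z => g z + k z) s1 s2 t1 t2 = eta g s1 s2 t1 t2 + eta k s1 s2 t1 t2.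
Proof.
rewrite /eta.
have e s : cint A (fun t => (g (cone s t) + k (cone s t)) * ker t) t1 t2 =
   cint A (fun t => g (cone s t) * ker t) t1 t2 + cint A (fun t => k (cone s t) * ker t) t1 t2.
  rewrite -cintD //; last 2 first.
  - by move=> t; exact: cont_gt.
  - by move=> t; exact: cont_gt.
  by congr (cint A _ _ _); apply/funext => t; rewrite mulrDl.
have e' t : cint A (fun s => g (cone s t) + k (cone s t)) s1 s2 =
   cint A (fun s => g (cone s t)) s1 s2 + cint A (fun s => k (cone s t)) s1 s2.
  by rewrite -cintD // => s; exact: cont_gs.
by rewrite !e !e'; do 8 (move: (cint _ _ _ _) => ?); ring.
Qed.

Lemma le_eta e :
  (forall s t, s1 <= s <= s2 -> t1 <= t <= t2 -> nm (g (cone s t)) <= e) ->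
  nm (eta g s1 s2 t1 t2) <= 2 * e * ((s2 - s1) + kmax * (t2 - t1)).
Proof.
move=> he.
have e0 : 0 <= e by apply: le_trans (nm_ge0 _) (he s1 t1 _ _); rewrite lexx.
have b1 s : s1 <= s <= s2 ->
    nm (cint A (fun t => g (cone s t) * ker t) t1 t2) <= e * kmax * (t2 - t1).
  move=> hs; apply: le_cint => // [t|t ht]; first exact: cont_gt.
  by rewrite nmM ler_pM ?nm_ge0 ?nm_ker ?he.
have b2 t : t1 <= t <= t2 ->
    nm (cint A (fun s => g (cone s t)) s1 s2) <= e * (s2 - s1).
  move=> ht; apply: le_cint => // [s|s hs]; first exact: cont_gs.
  exact: he.
rewrite /eta (le_trans (nmB _ _)) //.
have h1 := b1 s1; have h2 := b1 s2; have h3 := b2 t1; have h4 := b2 t2.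
rewrite !lexx ?s12 ?t12 /= in h1 h2 h3 h4.
have := lerD (lerD (h2 isT) (h1 isT)) (lerD (h4 isT) (h3 isT)).
have n1 := nmB (cint A (fun t => g (cone s2 t) * ker t) t1 t2) (cint A (fun t => g (cone s1 t) * ker t) t1 t2).
have n2 := nmB (cint A (fun s => g (cone s t2)) s1 s2) (cint A (fun s => g (cone s t1)) s1 s2).
move=> h; apply: le_trans (lerD n1 n2) _; apply: le_trans h _.
by rewrite le_eqVlt; apply/orP; left; apply/eqP; ring.
Qed.

End ContinuousWeight.

(** For a constant the integrals over opposite sides are equal; for [d (z-w)] the form becomes
    [d dz], which has an explicit primitive on each side. *)
Lemma eta_affine (c d : C) : eta (fun z => c + d * (z - w)) s1 s2 t1 t2 = 0.
Proof.
rewrite etaD; last 2 first.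
- by move=> z; exact: cont_cst.
- move=> z; apply: contM; first exact: cont_cst.
  by apply: contB; [exact: cont_id|exact: cont_cst].
have -> : eta (fun=> c) s1 s2 t1 t2 = 0 by rewrite /eta !subrr.
have E s : cint A (fun t => d * (cone s t - w) * ker t) t1 t2 =
    d * toR (expR s) * (gam t2 - gam t1).
  rewrite (@cint_primitive _ _ _ (fun t => d * toR (expR s) * gam t)) //.
  - by ring.
  - move=> t; apply: contM; last exact: cont_ker.
    apply: contM; first exact: contR_cst.
    by apply: contB; [exact: cont_cone_t|exact: contR_cst].
  - move=> t _; apply: cat_eq (catZ _ (cder_gam t)) _.
    by rewrite /ker /cone; field; exact: gam_w_neq0.
have F t : cint A (fun s => d * (cone s t - w)) s1 s2 =
    d * (gam t - w) * (toR (expR s2) - toR (expR s1)).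
  rewrite (@cint_primitive _ _ _ (fun s => d * (gam t - w) * toR (expR s))) //.
  - by ring.
  - move=> s; apply: contM; first exact: contR_cst.
    by apply: contB; [exact: cont_cone_s|exact: contR_cst].
  - move=> s _; apply: cat_eq (catZ _ (cder_expR s)) _.
    by rewrite /cone; ring.
by rewrite /eta !E !F; ring.
Qed.

End Eta.

Variable f : C -> C.
Hypothesis cf : forall z, cont f z.
Variable q : R.
Hypotheses (rq : r < q) (hf : forall z, nm z < q -> exists d, cdf f z d).

(** Around a point of the rectangle [f] is affine up to [e |z - z'|]. The affine part contributes
    nothing, so [eta] is at most a multiple of [e] times the square of the side lengths, as
    [bisection] requires. The condition [b <= 0] keeps the cone in the disk where [f] is
    differentiable. *)
Lemma goursat A a b c d : A < a -> A < c -> a <= b -> b <= 0 -> c <= d ->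
  eta A f a b c d = 0.
Proof.
move=> Aa Ac ab b0 cd.
apply/eqP; rewrite -nm_eq0 eq_le nm_ge0 andbT.
apply: (@bisection _ (fun a b c d => nm (eta A f a b c d))) => //.
- by move=> a' b' c' d'; rewrite (eta_split_s A f a' ((a' + b') / 2) b') nmD.
- by move=> a' b' c' d'; rewrite (eta_split_t A f a' b' c' ((c' + d') / 2)) nmD.
move=> s t /andP[as_ sb] tcd e e0.
have s0 : s <= 0 := le_trans sb b0.
have [D hD] : exists D, cdf f (cone s t) D.
  by apply: hf; apply: le_lt_trans rq; exact: nm_cone.
(* One factor 2 comes from the Lipschitz constant of [cone], one from [le_eta], and [1 + kmax] from
   the weight of the two kinds of sides. *)
set k := 4 * (1 + kmax).
have k0 : 0 < k by rewrite mulr_gt0 // addr_gt0 // kmax_gt0.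
move/cdf_eps : hD => /(_ _ (divr_gt0 e0 k0)) [rr rr0 hrr].
exists (rr / 4); first by rewrite divr_gt0.
move=> a' b' c' d' aa' bb' cc' dd' /andP[a's sb'] /andP[c't td'] hs ht.
have ab' := le_trans a's sb'; have cd' := le_trans c't td'.
have Aa' := lt_le_trans Aa aa'; have Ac' := lt_le_trans Ac cc'.
pose c0 := f (cone s t) + D * (w - cone s t).
pose g z := f z - (c0 + D * (z - w)).
have cg z : cont g z.
  apply: contB => //; apply: contD; first exact: cont_cst.
  apply: contM; first exact: cont_cst.
  by apply: contB; [exact: cont_id|exact: cont_cst].
have -> : eta A f a' b' c' d' = eta A g a' b' c' d'.
  transitivity (eta A (fun z => (c0 + D * (z - w)) + g z) a' b' c' d').
    congr (eta A _ _ _ _ _); apply/funext => z; rewrite /g; ring.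
  rewrite etaD ?eta_affine ?add0r // => z.
  apply: contD; first exact: cont_cst.
  apply: contM; first exact: cont_cst.
  by apply: contB; [exact: cont_id|exact: cont_cst].
set l := (b' - a') + (d' - c').
have l0 : 0 <= l by rewrite /l; lra.
apply: (le_trans (@le_eta A a' b' c' d' Aa' Ac' ab' cd' g cg (e / k * (2 * l)) _)).
  move=> s' t' /andP[u1 u2] /andP[v1 v2].
  have s0' : s' <= 0 by apply: le_trans u2 (le_trans bb' b0).
  have lip : nm (cone s' t' - cone s t) <= 2 * l.
    apply: le_trans (cone_lip t' t s0' s0) _; rewrite ler_wpM2l //.
    rewrite /l lerD // ler_norml; apply/andP; split; lra.
  have := hrr (cone s' t').
  have -> : f (cone s' t') - f (cone s t) - D * (cone s' t' - cone s t) = g (cone s' t').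
    by rewrite /g /c0; ring.
  move=> /(_ (le_lt_trans lip _)) hh; apply: (le_trans (hh _)).
    by rewrite /l; lra.
  by rewrite ler_wpM2l // divr_ge0 ?(ltW e0) ?(ltW k0).
have K0 := kmax_gt0.
have : (b' - a') + kmax * (d' - c') <= (1 + kmax) * l by rewrite /l; nra.
move=> hk.
have ek : 0 <= 2 * (e / k * (2 * l)).
  by rewrite mulr_ge0 // mulr_ge0 ?divr_ge0 ?(ltW e0) ?(ltW k0) // mulr_ge0.
apply: (le_trans (ler_wpM2l ek hk)).
rewrite le_eqVlt; apply/orP; left; apply/eqP.
rewrite /k; field; rewrite gt_eqF // addr_gt0 //.
Qed.

Lemma cis_2pi : cis (2 * pi) = cis 0.
Proof. by rewrite /cis mulr_natl cos2pi sin2pi cos0 sin0. Qed.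

(** The sides [t = 0] and [t = 2 pi] of the rectangle have the same image, so they cancel and the
    integral over the shrunken circle equals the one over the circle. *)
Lemma cauchy_cone A s : A < s -> s <= 0 ->
  cint A (fun t => f (cone s t) * ker t) 0 (2 * pi) =
  cint A (fun t => f (gam t) * ker t) 0 (2 * pi).
Proof.
move=> As s0.
have p0 : 0 <= 2 * pi :> R by rewrite mulr_ge0 // pi_ge0.
have := @goursat A s 0 0 (2 * pi) As (lt_le_trans As s0) s0 (lexx 0) p0.
rewrite /eta.
have -> : (fun s => f (cone s (2 * pi))) = (fun s => f (cone s 0)).
  by apply/funext => u; rewrite /cone /gam cis_2pi.
rewrite subrr subr0 => /eqP; rewrite subr_eq0 => /eqP <-.
congr (cint A _ _ _); apply/funext => t.
by rewrite /cone expR0 rmorph1 mul1r addrC subrK.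
Qed.

Lemma cint_indep A A' g a b : (forall t, cont g t) -> A < a -> A' < a -> a <= b ->
  @cint R A g a b = cint A' g a b.
Proof.
move=> cg Aa Aa' ab; have [F hF ->] := cintP A' cg.
apply: cint_primitive => // t /andP[at_ _]; apply: hF; exact: lt_le_trans Aa' at_.
Qed.

(** As [s] decreases the shrunken circle concentrates at [w], where [f] is nearly [f w], while the
    integral does not change. The integral of [ker] itself is evaluated later. *)
Lemma cauchy_ker : f w * cint (-1) ker 0 (2 * pi) =
  cint (-1) (fun t => f (gam t) * ker t) 0 (2 * pi).
Proof.
have p0 : 0 <= 2 * pi :> R by rewrite mulr_ge0 // pi_ge0.
have N10 : (-1 : R) < 0 by lra.
apply/eqP; rewrite -subr_eq0; apply/eqP; apply: nm_eq_small => e e0.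
have K0 := kmax_gt0.
have D0 : 0 < kmax * (2 * pi + 1) by rewrite mulr_gt0 // ltr_wpDl.
have [/contC] := cf w => /(_ _ (divr_gt0 e0 D0)) [d d0 hd].
(* [|gam t - w|] is below 2, so the curve [cone s] stays within [d] of [w]. *)
have [s sd s0] : exists2 s : R, expR s * 2 < d & s <= 0.
  exists (Num.min 0 (ln (d / 4))); last by rewrite ge_min lexx.
  apply: (@le_lt_trans _ _ (expR (ln (d / 4)) * 2)).
    by rewrite ler_wpM2r // ler_expR ge_min lexx orbT.
  by rewrite lnK ?posrE ?divr_gt0 //; lra.
set A := s - 1.
have As : A < s by rewrite /A; lra.
have A0 : A < 0 by rewrite /A; lra.
have ck t : cont ker t := cont_ker t.
have cfk t : cont (fun t => f (gam t) * ker t) t.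
  by apply: contM => //; exact: (cont_comp (cont_gam t) (cf _)).
have cfc t : cont (fun t => f (cone s t) * ker t) t := cont_gt cf s t.
rewrite (@cint_indep (-1) A ker) // (@cint_indep (-1) A _ _ _ cfk) //.
rewrite -(cauchy_cone As s0) -cintZ // -cintB //; last first.
  by move=> t; apply: contM => //; exact: contR_cst.
apply: (@le_trans _ _ (e / (kmax * (2 * pi + 1)) * kmax * (2 * pi - 0))).
  apply: le_cint => // [t|t _].
    by apply: contB => //; apply: contM => //; exact: contR_cst.
  rewrite -mulrBl nmM ler_pM ?nm_ge0 ?nm_ker // nmBC ltW // hd //.
  rewrite /cone addrC addKr nmM nm_real ger0_norm ?expR_ge0 //.
  apply: le_lt_trans sd; rewrite ler_wpM2l ?expR_ge0 //.
  rewrite (le_trans (nmB _ _)) // nm_gam; move: r1 wr; lra.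
rewrite subr0.
have -> : e / (kmax * (2 * pi + 1)) * kmax * (2 * pi) = e * (2 * pi / (2 * pi + 1)).
  have P1 : 2 * pi + 1 != 0 :> R by rewrite gt_eqF // ltr_wpDl.
  have K1 : kmax != 0 by rewrite gt_eqF.
  have key (u v : R) : u != 0 -> v + 1 != 0 -> e / (u * (v + 1)) * u * v = e * (v / (v + 1)).
    by move=> u0 v0; field; rewrite ?u0 ?v0.
  exact: key.
rewrite ler_piMr ?(ltW e0) // ler_pdivrMr ?ltr_wpDl // mul1r; lra.
Qed.

Definition fcoef (g : R -> C) n := I * cint (-1) (fun t => g t / gam t ^+ n) 0 (2 * pi).

Lemma cont_gamV n t : cont (fun t => (gam t ^+ n)^-1) t.
Proof.
apply: contV; first by rewrite expf_neq0 // gam_neq0.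
elim: n => [|n IH]; first exact: contR_cst.
have -> : (fun t => gam t ^+ n.+1) = (fun t => gam t * gam t ^+ n).
  by apply/funext => u; rewrite exprS.
by apply: contM => //; exact: cont_gam.
Qed.

(** Expansion of the kernel in a geometric series under the integral. *)
Lemma ker_series (g : R -> C) : (forall t, cont g t) ->
  (exists M, forall t, 0 <= t <= 2 * pi -> nm (g t) <= M) ->
  psm (fcoef g) n w @[n --> \oo] --> cint (-1) (fun t => g t * ker t) 0 (2 * pi).
Proof.
move=> cg [M hM].
have p0 : 0 <= 2 * pi :> R by rewrite mulr_ge0 // pi_ge0.
have N10 : (-1 : R) < 0 by lra.
have crem n t : cont (fun t => g t * (w ^+ n / gam t ^+ n) * ker t) t.
  apply: contM; last exact: cont_ker.
  by apply: contM => //; apply: contM; [exact: contR_cst|exact: cont_gamV].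
have rem n : cint (-1) (fun t => g t * ker t) 0 (2 * pi) - psm (fcoef g) n w =
   cint (-1) (fun t => g t * (w ^+ n / gam t ^+ n) * ker t) 0 (2 * pi).
  elim: n => [|n IH].
    rewrite /psm big_ord0 subr0; congr (cint _ _ _ _); apply/funext => t.
    by rewrite !expr0 divr1 mulr1.
  rewrite psmS opprD addrA IH /fcoef.
  have -> : I * cint (-1) (fun t => g t / gam t ^+ n) 0 (2 * pi) * w ^+ n =
     cint (-1) (fun t => I * w ^+ n * (g t / gam t ^+ n)) 0 (2 * pi).
    rewrite cintZ //; first by ring.
    by move=> t; apply: contM => //; exact: cont_gamV.
  rewrite -cintB //; last first.
    move=> t; apply: contM; first exact: contR_cst.
    by apply: contM => //; exact: cont_gamV.
  congr (cint _ _ _ _); apply/funext => t; rewrite /ker (exprS w) (exprS (gam t)); field.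
  by rewrite gam_w_neq0 gam_neq0 expf_neq0 // gam_neq0.
have M0 : 0 <= M by apply: le_trans (nm_ge0 _) (hM 0 _); rewrite lexx.
apply/cvgC => e e0.
have t01 : 0 <= nm w / r < 1.
  by rewrite divr_ge0 ?nm_ge0 ?(ltW r0) //= ltr_pdivrMr // mul1r.
have /cvgrPdist_lt /(_ _ e0) := geo_cvg0 (M * kmax * (2 * pi)) t01.
apply: filterS => n; rewrite sub0r normrN => hn.
rewrite nmBC rem; apply: le_lt_trans (le_lt_trans (ler_norm _) hn).
have -> : M * kmax * (2 * pi) * (nm w / r) ^+ n = M * (nm w / r) ^+ n * kmax * (2 * pi - 0).
  by ring.
apply: le_cint => // t t2.
rewrite nmM ler_pM ?nm_ge0 ?nm_ker // nmM ler_pM ?nm_ge0 ?hM //.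
by rewrite nmM nmV !nmX nm_gam expr_div_n.
Qed.

Lemma fcoef1 n : fcoef (fun=> 1) n = if n == 0%N then I * toR (2 * pi) else 0.
Proof.
have p0 : 0 <= 2 * pi :> R by rewrite mulr_ge0 // pi_ge0.
have N10 : (-1 : R) < 0 by lra.
have c1 m t : cont (fun t => 1 / gam t ^+ m) t.
  by apply: contM; [exact: contR_cst|exact: cont_gamV].
rewrite /fcoef; case: n => [|n] /=.
  rewrite (@cint_primitive _ _ _ toR) //; first by rewrite rmorph0 subr0.
  by move=> t _; rewrite expr0 divr1; exact: cder_id.
have d t : cder (fun t => I / (n.+1)%:R * (gam t ^+ n.+1)^-1) t (1 / gam t ^+ n.+1).
  have ct : cont toR t by exact: cder_cont (cder_id t).
  have g0 u : gam u ^+ n.+1 != 0 by rewrite expf_neq0 // gam_neq0.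
  apply: cat_eq (catZ _ (catV ct g0 (catX n.+1 ct (cder_gam t)))) _.
  have II : I * I = -1 :> C by rewrite -expr2 sqr_i.
  have -> : I / n.+1%:R * (- (n.+1%:R * gam t ^+ n.+1.-1 * (I * gam t)) / (gam t ^+ n.+1) ^+ 2)
    = - (I * I) * (n.+1%:R / n.+1%:R) * ((gam t ^+ n * gam t) / (gam t ^+ n.+1) ^+ 2) by ring.
  rewrite II opprK mul1r divff ?pnatr_eq0 // mul1r -exprSr; field.
  by rewrite expf_neq0 // gam_neq0.
rewrite (@cint_primitive _ _ _ _ _ _ (c1 n.+1) N10 p0 (fun t _ => d t)).
by rewrite /gam cis_2pi subrr mulr0.
Qed.

(** The missing value [2 pi i] of the integral of [ker] is read off from the same kernel expansion,
    applied to the constant function 1. *)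
Lemma cauchy_series : (exists M, forall t, 0 <= t <= 2 * pi -> nm (f (gam t)) <= M) ->
  psm (fun n => fcoef (fun t => f (gam t)) n / (I * toR (2 * pi))) n w @[n --> \oo] --> f w.
Proof.
move=> hM.
have k2 : cint (-1) ker 0 (2 * pi) = I * toR (2 * pi).
  have h : psm (fcoef (fun=> 1)) n w @[n --> \oo] --> cint (-1) ker 0 (2 * pi).
    have -> : ker = (fun t => 1 * ker t) by apply/funext => t; rewrite mul1r.
    apply: ker_series; first exact: contR_cst.
    by exists 1 => t _; rewrite nm1.
  apply: (cvgC_uniq h); apply/cvgC_succ; apply: cvg_near_cst; apply: nearW => n.
  rewrite /psm big_ord_recl fcoef1 /= expr0 mulr1 big1 ?addr0 // => k _.
  by rewrite fcoef1 /= mul0r.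
have k0 : I * toR (2 * pi) != 0.
  rewrite -nm_gt0 nmM nm_I mul1r nm_real normr_gt0.
  by rewrite gt_eqF // mulr_gt0 // pi_gt0.
have -> : f w = (I * toR (2 * pi))^-1 * cint (-1) (fun t => f (gam t) * ker t) 0 (2 * pi).
  by rewrite -cauchy_ker k2 mulrCA mulVf ?mulr1.
have -> : (fun n => fcoef (fun t => f (gam t)) n / (I * toR (2 * pi))) =
  (fun n => (I * toR (2 * pi))^-1 * fcoef (fun t => f (gam t)) n).
  by apply/funext => n; rewrite mulrC.
under eq_fun do rewrite psmZ.
apply: cvgCM; first exact: cvgC_cst.
apply: ker_series => // t; exact: (cont_comp (cont_gam t) (cf _)).
Qed.

End Cauchy.

(** * Taylor expansion on the whole disk *)

Section Holo.
Variable R : realType.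
Local Notation C := (CC R).
Local Notation nm := (@Normc.normc R).
Local Notation toR := (real_complex R : R -> C).

Definition holo (f : C -> C) := forall z, nm z < 1 -> exists d, cdf f z d.

(** At the real point [r] the terms of a convergent series tend to 0, hence are bounded. *)
Lemma cvg_rad (a : nat -> C) :
  (forall z, nm z < 1 -> exists l : C, psm a n z @[n --> \oo] --> l) -> rad a.
Proof.
move=> h r /andP[r0 r1].
have rn : nm (toR r) = r by rewrite nm_real ger0_norm // ltW.
have [l hl] : exists l : C, psm a n (toR r) @[n --> \oo] --> l by apply: h; rewrite rn.
have := cvgCB (proj2 (cvgC_succ _ _) hl) hl; rewrite subrr => /cvgC /(_ _ ltr01) [N _ hN].
have t n : nm (a n) * r ^+ n = nm (psm a n.+1 (toR r) - psm a n (toR r)).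
  by rewrite psmS addrC addKr nmM nmX rn.
have p n : 0 <= nm (a n) * r ^+ n by rewrite t nm_ge0.
exists (1 + \sum_(k < N) nm (a k) * r ^+ k) => n.
case: (ltnP n N) => nN.
  by rewrite (bigD1 (Ordinal nN)) //= addrCA lerDl addr_ge0 // sumr_ge0.
rewrite t; have /= := hN n nN; rewrite subr0 => /ltW/le_trans; apply.
by rewrite lerDl sumr_ge0.
Qed.

(** The radial retraction onto the closed disk of radius [r]. Composing with it gives the everywhere
    continuous function on which the integrals above are defined. *)
Definition clamp (r : R) (z : C) : C := z * toR (r / Num.max r (nm z)).

Lemma clamp_id r z : 0 < r -> nm z <= r -> clamp r z = z.
Proof.
by move=> r0 zr; rewrite /clamp max_l // divff ?gt_eqF // rmorph1 mulr1.
Qed.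

Lemma nm_clamp r z : 0 < r -> nm (clamp r z) <= r.
Proof.
move=> r0; have m0 : 0 < Num.max r (nm z) by rewrite lt_max r0.
have d0 : 0 <= r / Num.max r (nm z) by rewrite divr_ge0 // ltW.
rewrite nmM nm_real (ger0_norm d0) mulrCA ler_piMr ?(ltW r0) //.
by rewrite ler_pdivrMr // mul1r le_max lexx orbT.
Qed.

Lemma cont_clamp r z : 0 < r -> cont (clamp r) z.
Proof.
move=> r0; apply: contM; first exact: cont_id.
split; apply: (@continuous_comp C R C (fun z => r / Num.max r (nm z)) toR); last exact: continuous_toR.
have m0 : Num.max r (nm z) != 0 by rewrite gt_eqF // lt_max r0.
have cm : Num.max r (nm y) @[y --> z] --> Num.max r (nm z).
  have /(@cvgrPdist_lt _ _ _ (nbhs z)) h := @continuous_nm R z.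
  apply/(@cvgrPdist_lt _ _ _ (nbhs z)) => e /h; apply: filterS => y.
  apply: le_lt_trans; rewrite ler_norml.
  have := ler_norm (nm z - nm y); have := ler_norm (nm y - nm z).
  rewrite distrC => h1 h2.
  by apply/andP; split; case: (lerP r (nm z)); case: (lerP r (nm y)); lra.
apply: (@cvgM R C (nbhs z) _ (fun=> r) (fun y => (Num.max r (nm y))^-1) r).
  exact: cvg_cst.
exact: (@cvgV R C (nbhs z) _ (fun y => Num.max r (nm y)) _ m0 cm).
Qed.

Lemma holo_cont f z : holo f -> nm z < 1 -> cont f z.
Proof. by move=> hf /hf [d /cdf_cont]. Qed.

Lemma holo_series_r f (r : R) : holo f -> 0 < r < 1 ->
  exists a : nat -> C, forall w, nm w < r -> psm a n w @[n --> \oo] --> f w.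
Proof.
move=> hf /andP[r0 r1].
(* A radius strictly between [r] and 1: the clamped function agrees with [f], and stays
   differentiable, a little beyond the circle of integration. *)
pose q := (1 + r) / 2; have rq : r < q by rewrite /q; lra.
have q0 := lt_trans r0 rq; have q1 : q < 1 by rewrite /q; lra.
pose g z := f (clamp q z).
have cg z : cont g z.
  apply: cont_comp; first exact: cont_clamp.
  by apply: holo_cont => //; apply: le_lt_trans q1; exact: nm_clamp.
have gf z : nm z < q -> g z = f z by move=> /ltW h; rewrite /g clamp_id.
have hg z : nm z < q -> exists d, cdf g z d.
  move=> zq; have [d hd] := hf _ (lt_trans zq q1); exists d.
  apply: (@cdf_near _ f _ _ _ (q - nm z)) => // [|w h]; first by rewrite subr_gt0.
  by rewrite gf // -(subrK z w) (le_lt_trans (nmD _ _)) // -ltrBrDr.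
have [M hM] : exists M, forall t, 0 <= t <= 2 * pi -> nm (g (gam r t)) <= M.
  have p0 : 0 <= 2 * pi :> R by rewrite mulr_ge0 // pi_ge0.
  have [|c _ hc] := @EVT_max R (fun t => nm (g (gam r t))) 0 (2 * pi) p0.
    apply: continuous_subspaceT => t.
    have [h] : cont (fun t => g (gam r t)) t := cont_comp (cont_gam r t) (cg _).
    exact: (@continuous_comp R C R (fun t => g (gam r t)) nm t h (@continuous_nm R _)).
  by exists (nm (g (gam r c))) => t ht; apply: hc; rewrite in_itv.
exists (fun n => fcoef r (fun t => g (gam r t)) n / (Complex 0 1 * toR (2 * pi))) => w wr.
rewrite -gf ?(lt_trans wr) //.
apply: (@cauchy_series _ w r r0 (ltW r1) wr g cg q rq hg).
by exists M.
Qed.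

(** The expansions obtained on different radii have to agree. Both converge on the disk of radius
    1/2, so their coefficients, rescaled by [2^-n], define power series on the unit disk with the
    same sum, and [psum_inj] applies. *)
Lemma holo_psum f : holo f ->
  exists2 a, rad a & forall z, nm z < 1 -> f z = psum a z.
Proof.
move=> hf.
have h12 : 0 < (1 / 2 : R) < 1 by apply/andP; split; lra.
have [a ha] := holo_series_r hf h12.
have key w : nm w < 1 -> psm a n w @[n --> \oo] --> f w.
  move=> w1; pose r := (2 + nm w) / 3.
  have w0 := nm_ge0 w.
  have wr : nm w < r by rewrite /r; lra.
  have r01 : 0 < r < 1 by apply/andP; rewrite /r; split; lra.
  have r0 : 0 < r by case/andP: r01.
  have [b hb] := holo_series_r hf r01.
  suff e n : a n = b n.
    have -> : a = b by apply: funext => n; exact: e.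
    exact: hb.
  pose sc (s : R) (c : nat -> C) n := c n * toR s ^+ n.
  have scE s c m v : psm (sc s c) m v = psm c m (toR s * v).
    by rewrite /psm; apply: eq_bigr => k _; rewrite exprMn mulrA.
  have r12 : (1 / 2 : R) < r by rewrite /r; lra.
  have e12 : 0 < (1 / 2 : R) by lra.
  have sm (s u : R) v : 0 < s -> s <= u -> nm v < 1 -> nm (toR s * v) < u.
    move=> s0 su v1; rewrite nmM nm_real ger0_norm ?(ltW s0) //.
    by apply: lt_le_trans su; rewrite -[ltRHS]mulr1 ltr_pM2l.
  have ca v : nm v < 1 -> psm (sc (1 / 2) a) n v @[n --> \oo] --> f (toR (1 / 2) * v).
    by move=> v1; under eq_fun do rewrite scE; apply: ha; exact: sm.
  have cb v : nm v < 1 -> psm (sc (1 / 2) b) n v @[n --> \oo] --> f (toR (1 / 2) * v).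
    by move=> v1; under eq_fun do rewrite scE; apply: hb; apply: sm => //; exact: ltW.
  have ra : rad (sc (1 / 2) a) by apply: cvg_rad => v /ca h; exists (f (toR (1 / 2) * v)).
  have rb : rad (sc (1 / 2) b) by apply: cvg_rad => v /cb h; exists (f (toR (1 / 2) * v)).
  have := psum_inj ra rb => /(_ _ n) h.
  apply: (@mulIf _ (toR (1 / 2) ^+ n)).
    by rewrite expf_neq0 // -nm_gt0 nm_real normr_gt0 gt_eqF.
  apply: h => v v1.
  by rewrite (psum_eq ra v1 (ca v v1)) (psum_eq rb v1 (cb v v1)).
have ra : rad a by apply: cvg_rad => z z1; exists (f z); exact: key.
by exists a => // z z1; rewrite (psum_eq ra z1 (key z z1)).
Qed.

End Holo.

(** * Parseval formula on the disk *)

Section Stokes.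
Variable R : realType.
Local Notation C := (CC R).
Local Notation nm := (@Normc.normc R).
Local Notation mu := (@leb2 R).

Definition rdisk (r : R) : set (R * R) := [set x | x.1 ^+ 2 + x.2 ^+ 2 < r ^+ 2].

Lemma measurable_rdisk r : measurable (rdisk r).
Proof.
have mg : measurable_fun setT (fun x : R * R => x.1 ^+ 2 + x.2 ^+ 2).
  by apply: measurable_funD; apply: measurable_funX; [exact: measurable_fst|exact: measurable_snd].
have -> : rdisk r = setT `&` (fun x : R * R => x.1 ^+ 2 + x.2 ^+ 2) @^-1` `]-oo, (r ^+ 2)[%classic.
  by apply/seteqP; split => x /=; rewrite in_itv /=; [move=> ?; split|case].
by apply: mg => //; exact: measurable_itv.
Qed.

Lemma rdiskE r x : 0 <= r -> rdisk r x <-> nm (toC x) < r.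
Proof.
move=> r0; rewrite nmE /rdisk /abs2 /=; split => h.
  by rewrite -(ger0_norm r0) -sqrtr_sqr ltr_sqrt // (le_lt_trans _ h) // addr_ge0 // sqr_ge0.
have := h; rewrite -(@ltr_pXn2r _ 2) // ?nnegrE ?sqrtr_ge0 //.
by rewrite sqr_sqrtr // addr_ge0 // sqr_ge0.
Qed.

Lemma diskRR_rdisk : diskRR (R := R) = rdisk 1.
Proof.
by apply/seteqP; split => x h; [apply/rdiskE => //; apply/diskE|apply/diskE; apply/rdiskE].
Qed.

Lemma measurable_box a : measurable (`[- a, a]%classic `*` `[- a, a]%classic : set (R * R)).
Proof. by apply: measurableX; exact: measurable_itv. Qed.

Lemma leb2_box (a : R) : 0 < a ->
  mu (`[- a, a]%classic `*` `[- a, a]%classic) = ((2 * a) ^+ 2)%:E.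
Proof.
move=> a0; have L : @lebesgue_measure R [set` `[- a, a]%R] = (2 * a)%:E.
  rewrite lebesgue_measure_itv /= lte_fin (_ : - a < a); last by lra.
  by rewrite -EFinD; congr (_%:E); ring.
rewrite /leb2 product_measure1E; [|exact: measurable_itv|exact: measurable_itv].
transitivity ((2 * a)%:E * (2 * a)%:E)%E; first by congr (_ * _)%E; exact: L.
by rewrite -EFinM expr2.
Qed.

Lemma leb2_rdisk_lty r : (0 < r) -> (mu (rdisk r) < +oo)%E.
Proof.
move=> r0; apply: (@le_lt_trans _ _ (mu (`[- r, r]%classic `*` `[- r, r]%classic))).
  apply: le_measure; rewrite ?inE; [exact: measurable_rdisk|exact: measurable_box|].
  move=> x /(rdiskE _ (ltW r0)) h.
  have h1 := le_lt_trans (nm_Re _) h; have h2 := le_lt_trans (nm_Im _) h.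
  by split => /=; rewrite in_itv /= -ler_norml ltW.
by rewrite leb2_box // ltry.
Qed.

Lemma leb2_rdisk_gt0 : (0 < mu (rdisk 1))%E.
Proof.
apply: (@lt_le_trans _ _ (mu (`[- (1 / 2), (1 / 2)]%classic `*` `[- (1 / 2), (1 / 2)]%classic))).
  by rewrite leb2_box ?lte_fin; lra.
apply: le_measure; rewrite ?inE; [exact: measurable_box|exact: measurable_rdisk|].
move=> [x y] [/=]; rewrite !in_itv /= => /andP[h1 h2] /andP[h3 h4].
by rewrite /rdisk /= expr1n; nra.
Qed.

Lemma integrable_rdisk r (g : R * R -> R) M : 0 < r ->
  measurable_fun (rdisk r) g -> (forall x, rdisk r x -> `|g x| <= M) ->
  mu.-integrable (rdisk r) (EFin \o g).
Proof.
move=> r0 mg hg; apply: measurable_bounded_integrable => //.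
- exact: measurable_rdisk.
- exact: leb2_rdisk_lty.
- exists M; split; first exact: num_real.
  by move=> N MN x /hg h /=; apply: le_trans h (ltW MN).
Qed.

Lemma slice_ftc (h H : R -> R) (s : R) : 0 < s ->
  (forall x : R, is_derive x (1 : R) H (h x)) -> continuous h -> H s = 0 -> H (- s) = 0 ->
  (\int[lebesgue_measure]_(x in `](- s)%R, s%R[) (h x)%:E = 0)%E.
Proof.
move=> s0 dH ch Hs HNs.
have mh D : measurable_fun D (EFin \o h).
  apply/measurable_EFinP; apply: measurable_funTS; exact: continuous_measurable_fun.
have cH : continuous H.
  move=> x; apply: differentiable_continuous; apply/derivable1_diffP.
  by have [] := dH x.
rewrite (@integral_itv_obnd_cbnd R (- s) (BLeft s) (EFin \o h) (mh _)).
rewrite (@integral_itv_bndo_bndc R (BLeft (- s)) s (EFin \o h) (mh _)).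
rewrite (@continuous_FTC2 R h H) //.
- by rewrite Hs HNs subee.
- by lra.
- exact: continuous_subspaceT.
- split; first by move=> x _; have [] := dH x.
  + exact: (cvg_at_right_filter (cH _)).
  + exact: (cvg_at_left_filter (cH _)).
- by move=> x _; rewrite derive1E; have [_ ->] := dH x.
Qed.

Lemma disk_slice (g : R -> R) (r y : R) : 0 < r ->
  (fun x : R => ((EFin \o (fun p : R * R => g p.1)) \_ (rdisk r)) (x, y)) =
  (fun x => if y ^+ 2 < r ^+ 2 then
    ((EFin \o g) \_ `](- Num.sqrt (r ^+ 2 - y ^+ 2)), (Num.sqrt (r ^+ 2 - y ^+ 2))[) x else 0%E).
Proof.
move=> r0; apply/funext => x; rewrite !patchE.
case: (ltP (y ^+ 2) (r ^+ 2)) => yr; last first.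
  rewrite memNset // /rdisk /= => h.
  by have := sqr_ge0 x; lra.
set s := Num.sqrt _.
have s2 : s ^+ 2 = r ^+ 2 - y ^+ 2 by rewrite sqr_sqrtr // subr_ge0 ltW.
have s0 : 0 <= s by rewrite sqrtr_ge0.
have e : ((x, y) \in rdisk r) = (x \in `](- s), s[%classic).
  apply/idP/idP; rewrite !inE /rdisk /= in_itv /= => h.
    rewrite -ltr_norml -(@ltr_pXn2r _ 2) // ?nnegrE // real_normK ?num_real //.
    by lra.
  move: h; rewrite -ltr_norml -(@ltr_pXn2r _ 2) // ?nnegrE // real_normK ?num_real //.
  by lra.
by rewrite e.
Qed.

Lemma disk_slice2 (gd : R * R -> R) (r x y : R) :
  ((EFin \o gd) \_ (rdisk r)) (x, y) =
  ((EFin \o (fun p : R * R => gd (x, p.1))) \_ (rdisk r)) (y, x).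
Proof.
rewrite !patchE /=.
have e : ((x, y) \in rdisk r) = ((y, x) \in rdisk r).
  by apply/idP/idP; rewrite !inE /rdisk /= addrC.
by rewrite e.
Qed.

Lemma slice_int (h H : R -> R) (r y : R) : 0 < r ->
  (forall x : R, is_derive x (1 : R) H (h x)) -> continuous h ->
  (forall x, x ^+ 2 + y ^+ 2 = r ^+ 2 -> H x = 0) ->
  (\int[lebesgue_measure]_x ((EFin \o (fun p : R * R => h p.1)) \_ (rdisk r)) (x, y) = 0)%E.
Proof.
move=> r0 dH ch bH; rewrite disk_slice //.
case: (ltP (y ^+ 2) (r ^+ 2)) => yr; last by rewrite integral0.
have s0 : 0 < Num.sqrt (r ^+ 2 - y ^+ 2) by rewrite sqrtr_gt0 subr_gt0.
rewrite -integral_mkcond; apply: (@slice_ftc h H) => //.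
- by apply: bH; rewrite sqr_sqrtr ?subr_ge0 ?ltW //; ring.
- by apply: bH; rewrite sqrrN sqr_sqrtr ?subr_ge0 ?ltW //; ring.
Qed.

Section GreenIdentity.
Variables (g gd : R * R -> R) (r M : R).
Hypotheses (r0 : 0 < r) (mg : measurable_fun setT gd).
Hypothesis (bg : forall x, rdisk r x -> `|gd x| <= M).
Hypothesis (b0 : forall x y, x ^+ 2 + y ^+ 2 = r ^+ 2 -> g (x, y) = 0).

Let ig : mu.-integrable setT ((EFin \o gd) \_ (rdisk r)).
Proof.
apply/(@integrable_mkcond _ _ _ mu (rdisk r)); first exact: measurable_rdisk.
by apply: (@integrable_rdisk r gd M) => //; exact: measurable_funTS.
Qed.

(** By Fubini: on each chord [gd] is the derivative of a function that vanishes at both ends of the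
    chord. *)
Lemma stokes_fst : (forall x y : R, is_derive x (1 : R) (fun t => g (t, y)) (gd (x, y))) ->
  (forall y, continuous (fun t => gd (t, y))) -> Rintegral mu (rdisk r) gd = 0.
Proof.
move=> dg cg; rewrite /Rintegral integral_mkcond -(integral21_prod_meas1 ig).
rewrite integral0_eq // => y _.
rewrite /fubini_G -[RHS](@slice_int (fun t => gd (t, y)) (fun t => g (t, y)) r y) //.
by move=> x; exact: b0.
Qed.

Lemma stokes_snd : (forall x y : R, is_derive y (1 : R) (fun t => g (x, t)) (gd (x, y))) ->
  (forall x, continuous (fun t => gd (x, t))) -> Rintegral mu (rdisk r) gd = 0.
Proof.
move=> dg cg; rewrite /Rintegral integral_mkcond -(integral12_prod_meas1 ig).
rewrite integral0_eq // => x _.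
rewrite /fubini_F -[RHS](@slice_int (fun t => gd (x, t)) (fun t => g (x, t)) r x) //.
  by apply: eq_integral => y _; exact: disk_slice2.
by move=> y e; apply: b0; rewrite addrC.
Qed.

End GreenIdentity.

Definition cmeas (F : R * R -> C) :=
  measurable_fun setT (fun x => complex.Re (F x)) /\
  measurable_fun setT (fun x => complex.Im (F x)).

Lemma cmeasD F G : cmeas F -> cmeas G -> cmeas (fun x => F x + G x).
Proof.
move=> [h1 h2] [k1 k2]; split.
  by under eq_fun do rewrite ReD; exact: measurable_funD.
by under eq_fun do rewrite ImD; exact: measurable_funD.
Qed.

Lemma cmeasM F G : cmeas F -> cmeas G -> cmeas (fun x => F x * G x).
Proof.
move=> [h1 h2] [k1 k2]; split.
  by under eq_fun do rewrite ReM; apply: measurable_funB; exact: measurable_funM.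
by under eq_fun do rewrite ImM; apply: measurable_funD; exact: measurable_funM.
Qed.

Lemma cmeas_cst (c : C) : cmeas (fun _ => c).
Proof. by split; exact: measurable_cst. Qed.

Lemma cmeasN F : cmeas F -> cmeas (fun x => - F x).
Proof.
move=> h; have -> : (fun x => - F x) = (fun x => (-1) * F x).
  by apply/funext => x; rewrite mulN1r.
by apply: cmeasM => //; exact: cmeas_cst.
Qed.

Lemma cmeas_toC : cmeas (@toC R).
Proof. by split; [exact: measurable_fst|exact: measurable_snd]. Qed.

Lemma cmeas_conj F : cmeas F -> cmeas (fun x => (conjc (F x) : C)).
Proof.
move=> [h1 h2]; split.
  by rewrite (_ : (fun x => _) = (fun x => complex.Re (F x))) //; apply/funext => x; case: (F x).
rewrite (_ : (fun x => _) = (fun x => - complex.Im (F x))); first exact: measurable_funN.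
by apply/funext => x; case: (F x).
Qed.

Definition cI (r : R) (F : R * R -> C) : C :=
  Complex (Rintegral mu (rdisk r) (fun x => complex.Re (F x)))
          (Rintegral mu (rdisk r) (fun x => complex.Im (F x))).

Definition good (r : R) (F : R * R -> C) :=
  cmeas F /\ exists M, forall x, rdisk r x -> nm (F x) <= M.

Section ComplexIntegral.
Variable r : R.
Hypothesis r0 : 0 < r.

Lemma good_int F : good r F ->
  mu.-integrable (rdisk r) (EFin \o (fun x => complex.Re (F x))) /\
  mu.-integrable (rdisk r) (EFin \o (fun x => complex.Im (F x))).
Proof.
move=> [[h1 h2] [M hM]]; split; apply: (@integrable_rdisk r _ M) => //.
- exact: measurable_funTS.
- by move=> x /hM; apply: le_trans; exact: nm_Re.
- exact: measurable_funTS.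
- by move=> x /hM; apply: le_trans; exact: nm_Im.
Qed.

Lemma goodD F G : good r F -> good r G -> good r (fun x => F x + G x).
Proof.
move=> [h1 [M hM]] [h2 [N hN]]; split; first exact: cmeasD.
by exists (M + N) => x xr; rewrite (le_trans (nmD _ _)) // lerD ?hM ?hN.
Qed.

Lemma goodM F G : good r F -> good r G -> good r (fun x => F x * G x).
Proof.
move=> [h1 [M hM]] [h2 [N hN]]; split; first exact: cmeasM.
by exists (M * N) => x xr; rewrite nmM ler_pM ?nm_ge0 ?hM ?hN.
Qed.

Lemma good_cst c : good r (fun _ => c).
Proof. by split; [exact: cmeas_cst|exists (nm c)]. Qed.

Lemma goodN F : good r F -> good r (fun x => - F x).
Proof.
by move=> [h1 [M hM]]; split; [exact: cmeasN|exists M => x; rewrite nmN; exact: hM].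
Qed.

Lemma goodX F n : good r F -> good r (fun x => F x ^+ n).
Proof.
move=> hF; elim: n => [|n IH]; first exact: good_cst.
by under eq_fun do rewrite exprS; exact: goodM.
Qed.

Lemma good_toC : good r (@toC R).
Proof.
split; first exact: cmeas_toC.
by exists r => x /(rdiskE _ (ltW r0)) /ltW.
Qed.

Lemma good_conj F : good r F -> good r (fun x => (conjc (F x) : C)).
Proof.
by move=> [h1 [M hM]]; split; [exact: cmeas_conj|exists M => x /hM; rewrite nm_conj].
Qed.

Lemma good_sum (J : Type) (s : seq J) (F : J -> R * R -> C) :
  (forall j, good r (F j)) -> good r (fun x => \sum_(j <- s) F j x).
Proof.
move=> h; elim: s => [|j s IH].
  by under eq_fun do rewrite big_nil; exact: good_cst.
by under eq_fun do rewrite big_cons; exact: goodD.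
Qed.

Lemma cID F G : good r F -> good r G -> cI r (fun x => F x + G x) = cI r F + cI r G.
Proof.
move=> /good_int [h1 h2] /good_int [k1 k2]; apply: complexP; rewrite ?ReD ?ImD /=.
  by under eq_Rintegral do rewrite ReD; rewrite RintegralD //; exact: measurable_rdisk.
by under eq_Rintegral do rewrite ImD; rewrite RintegralD //; exact: measurable_rdisk.
Qed.

Lemma cIZ (c : C) F : good r F -> cI r (fun x => c * F x) = c * cI r F.
Proof.
move=> hF; have [h1 h2] := good_int hF.
have mr := measurable_rdisk r.
have Z (k : R) (u : R * R -> R) : mu.-integrable (rdisk r) (EFin \o u) ->
    mu.-integrable (rdisk r) (EFin \o (fun x => k * u x)).
  move=> iu.
  have : mu.-integrable (rdisk r) (fun x => k%:E * (EFin \o u) x)%E.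
    by apply: integrableZl => //; exact: measurable_rdisk.
  by apply: eq_integrable => //; exact: measurable_rdisk.
apply: complexP; rewrite ?ReM ?ImM /=.
  by under eq_Rintegral do rewrite ReM; rewrite RintegralB ?RintegralZl //; exact: Z.
by under eq_Rintegral do rewrite ImM; rewrite RintegralD ?RintegralZl //; exact: Z.
Qed.

Lemma cI_conj F : good r F -> cI r (fun x => (conjc (F x) : C)) = conjc (cI r F).
Proof.
move=> hF; have [h1 h2] := good_int hF.
have mr := measurable_rdisk r.
apply: complexP => /=.
  by apply: eq_Rintegral => x _; case: (F x).
rewrite -[RHS]mulN1r -RintegralZl //.
by apply: eq_Rintegral => x _; rewrite mulN1r; case: (F x).
Qed.

Lemma cI_sum (J : Type) (s : seq J) (F : J -> R * R -> C) : (forall j, good r (F j)) ->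
  cI r (fun x => \sum_(j <- s) F j x) = \sum_(j <- s) cI r (F j).
Proof.
move=> h; elim: s => [|j s IH].
  rewrite big_nil (_ : (fun x => _) = (fun x => 0 * (0 : C))).
    by rewrite (@cIZ 0 (fun=> 0)) ?mul0r //; exact: good_cst.
  by apply/funext => x; rewrite big_nil mul0r.
rewrite big_cons -IH -cID //; last exact: good_sum.
by congr (cI r _); apply/funext => x; rewrite big_cons.
Qed.

End ComplexIntegral.
End Stokes.

(** * Moments of the disk, Bessel's inequality and Parseval's formula *)

Section Parseval.
Variable R : realType.
Local Notation C := (CC R).
Local Notation nm := (@Normc.normc R).
Local Notation toR := (real_complex R : R -> C).
Local Notation I := (Complex 0 1 : C).
Local Notation mu := (@leb2 R).
Local Notation cj := (fun z : C => (conjc z : C)).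

Lemma conjM (z w : C) : cj (z * w) = cj z * cj w.
Proof. exact: rmorphM. Qed.
Lemma conjX (z : C) n : cj (z ^+ n) = cj z ^+ n.
Proof. exact: rmorphXn. Qed.
Lemma conj_nat n : cj (n%:R : C) = n%:R.
Proof. exact: conjc_nat. Qed.
Lemma conjK (z : C) : cj (cj z) = z.
Proof. exact: conjcK. Qed.
Lemma conj_real (x : R) : cj (toR x) = toR x.
Proof. exact: conjc_real. Qed.

Section Disk.
Variable r : R.
Hypothesis r0 : 0 < r.

Lemma cstokes_fst (g gd : R * R -> C) : good r gd ->
  (forall x y : R, cder (fun t => g (t, y)) x (gd (x, y))) ->
  (forall x y : R, cont (fun t : R => gd (t, y)) x) ->
  (forall x y, x ^+ 2 + y ^+ 2 = r ^+ 2 -> g (x, y) = 0) -> cI r gd = 0.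
Proof.
move=> [[m1 m2] [M hM]] dg cg b0; apply: complexP => /=.
  apply: (@stokes_fst _ (fun p => complex.Re (g p)) _ r M) => //.
  - by move=> x /hM; apply: le_trans; exact: nm_Re.
  - by move=> x y /b0 ->.
  - by move=> x y; exact: cder_Re (dg x y).
  - move=> y x; have [h] := cg x y.
    exact: (@continuous_comp R C R (fun t => gd (t, y)) (fun z => complex.Re z) x h (@continuous_Re R _)).
apply: (@stokes_fst _ (fun p => complex.Im (g p)) _ r M) => //.
- by move=> x /hM; apply: le_trans; exact: nm_Im.
- by move=> x y /b0 ->.
- by move=> x y; exact: cder_Im (dg x y).
- move=> y x; have [h] := cg x y.
  exact: (@continuous_comp R C R (fun t => gd (t, y)) (fun z => complex.Im z) x h (@continuous_Im R _)).
Qed.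

Lemma cstokes_snd (g gd : R * R -> C) : good r gd ->
  (forall x y : R, cder (fun t => g (x, t)) y (gd (x, y))) ->
  (forall x y : R, cont (fun t : R => gd (x, t)) y) ->
  (forall x y, x ^+ 2 + y ^+ 2 = r ^+ 2 -> g (x, y) = 0) -> cI r gd = 0.
Proof.
move=> [[m1 m2] [M hM]] dg cg b0; apply: complexP => /=.
  apply: (@stokes_snd _ (fun p => complex.Re (g p)) _ r M) => //.
  - by move=> x /hM; apply: le_trans; exact: nm_Re.
  - by move=> x y /b0 ->.
  - by move=> x y; exact: cder_Re (dg x y).
  - move=> x y; have [h] := cg x y.
    exact: (@continuous_comp R C R (fun t => gd (x, t)) (fun z => complex.Re z) y h (@continuous_Re R _)).
apply: (@stokes_snd _ (fun p => complex.Im (g p)) _ r M) => //.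
- by move=> x /hM; apply: le_trans; exact: nm_Im.
- by move=> x y /b0 ->.
- by move=> x y; exact: cder_Im (dg x y).
- move=> x y; have [h] := cg x y.
  exact: (@continuous_comp R C R (fun t => gd (x, t)) (fun z => complex.Im z) y h (@continuous_Im R _)).
Qed.

Definition mono a b (x : R * R) : C := toC x ^+ a * cj (toC x) ^+ b.
Definition moment a b := cI r (mono a b).

Lemma good_mono a b : good r (mono a b).
Proof.
by apply: goodM; apply: goodX; [|apply: good_conj]; exact: good_toC.
Qed.

Let k : C := toR (r ^+ 2).

(** The derivative of [u^a v^b (k - u v)] along a curve. For [u = z], [v = zbar] the pair [(du, dv)]
    is [(1, 1)] in the direction of [x] and [(I, -I)] in that of [y]. *)
Definition bump_der (a b : nat) (u v du dv : C) : C :=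
  a%:R * u ^+ a.-1 * du * v ^+ b * (k - u * v) +
  b%:R * u ^+ a * v ^+ b.-1 * dv * (k - u * v) - u ^+ a * v ^+ b * (du * v + u * dv).

Lemma cder_bump a b (u v : R -> C) t du dv : cder u t du -> cder v t dv ->
  cder (fun t => u t ^+ a * v t ^+ b * (k - u t * v t)) t (bump_der a b (u t) (v t) du dv).
Proof.
move=> hu hv.
have ct : cont toR t by split; exact: continuous_toR.
apply: cat_eq (catM ct (catM ct (catX a ct hu) (catX b ct hv))
  (catB (cat_cst _ k t) (catM ct hu hv))) _.
by rewrite /bump_der; ring.
Qed.

Lemma contX (X : topologicalType) (u : X -> C) t n : cont u t -> cont (fun t => u t ^+ n) t.
Proof.
move=> cu; elim: n => [|n IH]; first exact: cont_cst.
by rewrite (_ : (fun t => _) = (fun t => u t * u t ^+ n));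
  [exact: contM|apply/funext => s; rewrite exprS].
Qed.

Lemma cont_bump_der a b (u v : R -> C) t du dv : cont u t -> cont v t ->
  cont (fun t => bump_der a b (u t) (v t) du dv) t.
Proof.
move=> cu cv; rewrite /bump_der.
have cc c : cont (fun _ : R => c) t by exact: cont_cst.
have cX n := contX n cu; have cY n := contX n cv.
apply: contB; first apply: contD.
- apply: contM; last by apply: contB => //; exact: contM.
  by apply: contM => //; apply: contM => //; apply: contM.
- apply: contM; last by apply: contB => //; exact: contM.
  by apply: contM => //; apply: contM => //; apply: contM.
- by apply: contM; [exact: contM|apply: contD; exact: contM].
Qed.

Lemma good_bump_der a b (du dv : C) :
  good r (fun x => bump_der a b (toC x) (cj (toC x)) du dv).
Proof.
have gu := good_toC r0; have gv := good_conj gu.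
have gc (c : C) : good r (fun _ => c) := good_cst r c.
have gX n := goodX n gu; have gY n := goodX n gv.
rewrite /bump_der; apply: goodD; first apply: goodD.
- apply: goodM; last by apply: goodD => //; apply: goodN; exact: goodM.
  by apply: goodM => //; apply: goodM => //; apply: goodM.
- apply: goodM; last by apply: goodD => //; apply: goodN; exact: goodM.
  by apply: goodM => //; apply: goodM => //; apply: goodM.
- by apply: goodN; apply: goodM; [exact: goodM|apply: goodD; exact: goodM].
Qed.

Lemma cder_toC_fst (x y : R) : cder (fun t : R => toC (t, y)) x 1.
Proof. exact: cat_eq (cder_Complex (is_derive_id _ _) (is_derive_cst _ _ _)) _. Qed.

Lemma cder_toC_snd (x y : R) : cder (fun t : R => toC (x, t)) y I.
Proof. exact: cat_eq (cder_Complex (is_derive_cst _ _ _) (is_derive_id _ _)) _. Qed.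

(** Green's formula for [z^(a+1) zbar^b (r^2 - |z|^2)], which vanishes on the
    boundary circle. *)
Lemma moment_rec a b :
  a.+1%:R * k * moment a b = a.+2%:R * moment a.+1 b.+1.
Proof.
pose g x : C := toC x ^+ a.+1 * cj (toC x) ^+ b * (k - toC x * cj (toC x)).
have g0 x y : x ^+ 2 + y ^+ 2 = r ^+ 2 -> g (x, y) = 0.
  move=> e; rewrite /g (_ : k - _ = 0) ?mulr0 //.
  by apply/eqP; rewrite subr_eq0 /k -e; apply/eqP; apply: complexP; rewrite ?ReM ?ImM /=; ring.
pose gx x := bump_der a.+1 b (toC x) (cj (toC x)) 1 1.
pose gy x := bump_der a.+1 b (toC x) (cj (toC x)) I (- I).
have c1 : conjc (1 : C) = 1 by exact: conjc1.
have cI' : conjc I = - I by apply: complexP; rewrite /= ?oppr0.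
have hx : cI r gx = 0.
  apply: (@cstokes_fst g gx _ _ _ g0) => [|x y|x y]; first exact: good_bump_der.
  - have h := cder_toC_fst x y.
    have h' := cder_conj h; rewrite c1 in h'.
    exact: cder_bump h h'.
  - have h := cder_toC_fst x y.
    have h' := cder_conj h.
    apply: (@cont_bump_der a.+1 b (fun t => toC (t, y)) (fun t => cj (toC (t, y)))).
      exact: cder_cont h.
    exact: cder_cont h'.
have hy : cI r gy = 0.
  apply: (@cstokes_snd g gy _ _ _ g0) => [|x y|x y]; first exact: good_bump_der.
  - have h := cder_toC_snd x y.
    have h' := cder_conj h; rewrite cI' in h'.
    exact: cder_bump h h'.
  - have h := cder_toC_snd x y.
    have h' := cder_conj h.
    apply: (@cont_bump_der a.+1 b (fun t => toC (x, t)) (fun t => cj (toC (x, t)))).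
      exact: cder_cont h.
    exact: cder_cont h'.
have gx' : good r gx := good_bump_der _ _ _ _.
have gy' : good r gy := good_bump_der _ _ _ _.
have ggy : good r (fun x => - I * gy x) by apply: goodM => //; exact: good_cst.
have := cID r0 gx' ggy; rewrite (cIZ r0 _ gy') hx hy mulr0 addr0.
have gm i j c : good r (fun x => c * mono i j x).
  by apply: goodM; [exact: good_cst|exact: good_mono].
(* The combination of the two partial derivatives is [2 d/dz], for which [zbar] is a constant; the
   terms in [b] therefore cancel. *)
have -> : (fun x => gx x + - I * gy x) =
  (fun x => 2 * a.+1%:R * k * mono a b x + (- 2 * a.+2%:R) * mono a.+1 b.+1 x).
  apply/funext => x; rewrite /gx /gy /bump_der /mono; cbv beta.
  have II : I * I = -1 :> C by rewrite -expr2 sqr_i.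
  change a.+1.-1 with a; generalize (conjc (toC x) : C); generalize (toC x); move=> u v.
  rewrite (exprS u) (exprS v) -[a.+2%:R]natr1.
  have -> : forall A B D E F : C, A * 1 * B * D + b%:R * E * F * 1 * D - E * B * (1 * v + u * 1)
     + - I * (A * I * B * D + b%:R * E * F * - I * D - E * B * (I * v + u * - I)) =
     A * B * D - (I * I) * (A * B * D) + b%:R * E * F * D + (I * I) * (b%:R * E * F * D)
     - E * B * (v + u) + (I * I) * (E * B * (v - u)).
    by move=> *; ring.
  by rewrite II; ring.
rewrite cID // !cIZ //; try exact: good_mono.
rewrite -/(moment a b) -/(moment a.+1 b.+1) => e.
apply: (@mulfI _ (2 : C)); first by rewrite pnatr_eq0.
apply/eqP; rewrite -subr_eq0; apply/eqP.
by rewrite -[RHS]e; ring.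
Qed.

Lemma moment_conj a b : moment b a = conjc (moment a b).
Proof.
rewrite /moment -(cI_conj r0); last exact: good_mono.
congr (cI r _); apply/funext => x.
by rewrite /mono conjM !conjX conjK mulrC.
Qed.

Lemma k_neq0 : k != 0.
Proof. by rewrite -nm_gt0 nm_real normr_gt0 expf_neq0 // gt_eqF. Qed.

(** The recursion and its conjugate with [a] and [b] exchanged relate the same two moments with
    different factors; eliminating the second moment leaves [(a - b)] times the first. *)
Lemma moment_off a b : a != b -> moment a b = 0.
Proof.
move=> ab; have h1 := moment_rec a b.
have h2 : b.+1%:R * k * moment a b = b.+2%:R * moment a.+1 b.+1.
  have : cj (b.+1%:R * k * moment b a) = cj (b.+2%:R * moment b.+1 a.+1).
    by rewrite moment_rec.
  by rewrite !conjM !conj_nat conj_real (moment_conj b a) (moment_conj b.+1 a.+1).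
have : (a%:R - b%:R) * k * moment a b = 0 :> C.
  have -> : (a%:R - b%:R) * k * moment a b =
    b.+2%:R * (a.+1%:R * k * moment a b) - a.+2%:R * (b.+1%:R * k * moment a b).
    by rewrite -!natr1; ring.
  by rewrite h1 h2; ring.
move/eqP; rewrite !mulf_eq0 (negbTE k_neq0) orbF subr_eq0 eqr_nat (negbTE ab) /=.
by move/eqP.
Qed.

Definition area := fine (mu (rdisk r)).

Lemma moment_diag n : moment n n = toR (area * r ^+ (2 * n) / n.+1%:R).
Proof.
elim: n => [|n IH].
  have -> : moment 0 0 = cI r (fun _ => 1).
    by congr (cI r _); apply/funext => x; rewrite /mono !expr0 mulr1.
  rewrite expr0 mulr1 divr1; apply: complexP => /=.
    by rewrite Rintegral_cst ?mul1r //; exact: measurable_rdisk.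
  by rewrite Rintegral_cst ?mul0r //; exact: measurable_rdisk.
have n2 : n.+2%:R != 0 :> C by rewrite pnatr_eq0.
apply: (mulfI n2); rewrite -moment_rec IH /k.
rewrite -!(rmorph_nat toR) -!rmorphM; congr (toR _).
rewrite (_ : (2 * n.+1)%N = (2 * n).+2); last by rewrite mulnS.
have n0 : 0 <= n%:R :> R by [].
rewrite !exprS; field; rewrite ?pnatr_eq0 //.
by apply/andP; split; apply: lt0r_neq0; lra.
Qed.

Lemma good_psm (a : nat -> C) N : good r (fun x => psm a N (toC x)).
Proof.
apply: good_sum => j; apply: goodM; first exact: good_cst.
by apply: goodX; exact: good_toC.
Qed.

Lemma abs2E (z : C) : z * conjc z = toR (abs2 z).
Proof. by case: z => x y; apply: complexP; rewrite ?ReM ?ImM /abs2 /=; ring. Qed.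

Lemma cI_psm (a : nat -> C) N : cI r (fun x => psm a N (toC x) * cj (psm a N (toC x))) =
  toR (\sum_(j < N) abs2 (a j) * (area * r ^+ (2 * j) / j.+1%:R)).
Proof.
have -> : (fun x => psm a N (toC x) * cj (psm a N (toC x))) =
  (fun x => \sum_(i < N) \sum_(j < N) a i * cj (a j) * mono i j x).
  apply/funext => x; rewrite /psm rmorph_sum mulr_suml; apply: eq_bigr => i _.
  rewrite mulr_sumr; apply: eq_bigr => j _.
  by rewrite rmorphM rmorphXn /mono /=; ring.
have gm i j c : good r (fun x => c * mono i j x).
  by apply: goodM; [exact: good_cst|exact: good_mono].
rewrite (cI_sum r0); last by move=> i; apply: good_sum => j; exact: gm.
rewrite rmorph_sum; apply: eq_bigr => i _.
rewrite (cI_sum r0) // (bigD1 i) //= big1 ?addr0; last first.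
  move=> j ji; rewrite (cIZ r0); last exact: good_mono.
  by rewrite -/(moment i j) moment_off ?mulr0 // eq_sym.
rewrite (cIZ r0); last exact: good_mono.
by rewrite -/(moment i i) moment_diag abs2E -rmorphM.
Qed.

Definition wsr (a : nat -> C) N := \sum_(j < N) abs2 (a j) * (r ^+ (2 * j) / j.+1%:R).

Lemma int_psm (a : nat -> C) N :
  (\int[mu]_(x in rdisk r) (abs2 (psm a N (toC x)))%:E = (area * wsr a N)%:E)%E.
Proof.
have hg : good r (fun x => psm a N (toC x) * cj (psm a N (toC x))).
  by apply: goodM; [|apply: good_conj]; exact: good_psm.
have [h1 _] := good_int r0 hg.
have e : (EFin \o (fun x => complex.Re (psm a N (toC x) * cj (psm a N (toC x))))) =
  (fun x : R * R => (abs2 (psm a N (toC x)))%:E).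
  by apply/funext => x /=; rewrite abs2E.
have := congr1 (@complex.Re R) (cI_psm a N); rewrite /= /Rintegral.
rewrite e in h1; rewrite -[X in fine X](_ : (\int[mu]_(x in rdisk r) (abs2 (psm a N (toC x)))%:E)%E = _).
  move=> h; rewrite -[LHS]fineK; last by apply: integrable_fin_num => //; exact: measurable_rdisk.
  rewrite h /wsr mulr_sumr; congr (_%:E); apply: eq_bigr => j _; ring.
by rewrite -e.
Qed.

End Disk.

Definition wsum (a : nat -> C) N := \sum_(j < N) abs2 (a j) / j.+1%:R.
Definition unit_area := fine (mu (rdisk 1)).
Definition kap := pi^-1 * unit_area.

Lemma unit_area_gt0 : 0 < unit_area.
Proof.
by rewrite /unit_area fine_gt0 // leb2_rdisk_gt0 leb2_rdisk_lty.
Qed.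

Lemma kap_gt0 : 0 < kap.
Proof. by rewrite mulr_gt0 ?invr_gt0 ?pi_gt0 ?unit_area_gt0. Qed.

Lemma wsr1 a N : wsr 1 a N = wsum a N.
Proof. by apply: eq_bigr => j _; rewrite expr1n div1r. Qed.

Lemma abs2_ge0 (z : C) : 0 <= abs2 z.
Proof. by rewrite -nm_sqr exprn_ge0 // nm_ge0. Qed.

Lemma wsr_ge (r : R) a N : 0 <= r <= 1 -> r ^+ (2 * N) * wsum a N <= wsr r a N.
Proof.
move=> /andP[r0 r1]; rewrite /wsum /wsr mulr_sumr; apply: ler_sum => j _.
have -> : r ^+ (2 * N) * (abs2 (a j) / j.+1%:R) = abs2 (a j) * (r ^+ (2 * N) / j.+1%:R) by ring.
rewrite ler_wpM2l ?abs2_ge0 // ler_wpM2r ?invr_ge0 //.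
by apply: ler_wiXn2l => //; rewrite leq_mul2l ltnW //= orbT.
Qed.

Lemma wsr_mono (r : R) a N M : (N <= M)%N -> 0 <= r -> wsr r a N <= wsr r a M.
Proof.
move=> /subnKC <- r0; elim: (M - N)%N => [|m IH]; first by rewrite addn0.
rewrite addnS /wsr big_ord_recr /=; apply: le_trans IH _.
by rewrite lerDl mulr_ge0 ?abs2_ge0 // mulr_ge0 ?invr_ge0 // exprn_ge0.
Qed.

Lemma rdisk_sub (r s : R) : 0 <= r -> r <= s -> rdisk r `<=` rdisk s.
Proof.
move=> r0 rs x /(rdiskE _ r0) h; apply/(rdiskE _ (le_trans r0 rs)).
exact: lt_le_trans rs.
Qed.

Section Series.
Variable a : nat -> C.
Hypothesis ra : rad a.

Let psm_cvg x : rdisk 1 x -> psm a n (toC x) @[n --> \oo] --> psum a (toC x).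
Proof. by move=> /(rdiskE _ ler01); exact: psum_cvg. Qed.

Lemma measurable_psum_Re : measurable_fun (rdisk 1) (fun x => complex.Re (psum a (toC x))).
Proof.
apply: (@measurable_fun_cvg _ _ _ _ (fun n x => complex.Re (psm a n (toC x)))).
  move=> n; have [[h _] _] := good_psm ltr01 a n; exact: measurable_funTS.
move=> x /psm_cvg h.
exact: (@cvg_comp _ _ _ (fun n => psm a n (toC x)) (fun z : C => complex.Re z) _ _ _ h (@continuous_Re R _)).
Qed.

Lemma measurable_psum_Im : measurable_fun (rdisk 1) (fun x => complex.Im (psum a (toC x))).
Proof.
apply: (@measurable_fun_cvg _ _ _ _ (fun n x => complex.Im (psm a n (toC x)))).
  move=> n; have [[_ h] _] := good_psm ltr01 a n; exact: measurable_funTS.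
move=> x /psm_cvg h.
exact: (@cvg_comp _ _ _ (fun n => psm a n (toC x)) (fun z : C => complex.Im z) _ _ _ h (@continuous_Im R _)).
Qed.

Let meas_abs2 (F : R * R -> C) D : measurable_fun D (fun x => complex.Re (F x)) ->
  measurable_fun D (fun x => complex.Im (F x)) ->
  measurable_fun D (fun x => (abs2 (F x))%:E).
Proof.
move=> h1 h2; apply/measurable_EFinP; rewrite /abs2.
by apply: measurable_funD; apply: measurable_funX.
Qed.

Lemma measurable_psum_abs2 : measurable_fun (rdisk 1) (fun x => (abs2 (psum a (toC x)))%:E).
Proof. exact: meas_abs2 measurable_psum_Re measurable_psum_Im. Qed.

Lemma measurable_psm_abs2 D n : measurable_fun D (fun x => (abs2 (psm a n (toC x)))%:E).
Proof.
have [[h1 h2] _] := good_psm ltr01 a n.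
by apply: meas_abs2; exact: measurable_funTS.
Qed.

Lemma cvg_abs2 (u : nat -> C) (l : C) : u n @[n --> \oo] --> l ->
  (abs2 (u n))%:E @[n --> \oo] --> (abs2 l)%:E.
Proof.
move=> h; apply: cvg_EFin; first by apply: nearW.
have hn : nm (u n) @[n --> \oo] --> nm l.
  exact: (@cvg_comp _ _ _ u nm _ _ _ h (@continuous_nm R _)).
rewrite -nm_sqr expr2 (_ : fine \o _ = (fun n => nm (u n) * nm (u n))); first exact: cvgM.
by apply/funext => n; rewrite -expr2 nm_sqr.
Qed.

(** Bessel's inequality on a smaller disk, where the series converges uniformly. *)
Lemma bessel_r (r : R) N : 0 < r < 1 ->
  ((area r * wsr r a N)%:E <= \int[mu]_(x in rdisk r) (abs2 (psum a (toC x)))%:E)%E.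
Proof.
move=> r01; have [r0 r1] := andP r01.
have [B hB] := rad_abs ra r01.
have sub := rdisk_sub (ltW r0) (ltW r1).
have [||||||_ _ h] := @dominated_convergence _ _ _ mu (rdisk r) _
  (fun n x => (abs2 (psm a n (toC x)))%:E) (fun x => (abs2 (psum a (toC x)))%:E)
  (EFin \o (fun=> B ^+ 2)).
- exact: measurable_rdisk.
- by move=> n; exact: measurable_psm_abs2.
- by apply: measurable_funS measurable_psum_abs2 => //; exact: measurable_rdisk.
- by apply: aeW => x xr; apply: cvg_abs2; apply: psm_cvg; exact: sub.
- by apply: (@integrable_rdisk _ r _ (B ^+ 2)) => // x _; rewrite ger0_norm ?sqr_ge0.
- apply: aeW => x n xr; rewrite gee0_abs ?lee_fin ?abs2_ge0 // -nm_sqr.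
  have hh : nm (psm a n (toC x)) <= B.
    apply: le_trans (nm_sum _ _ _) (le_trans _ (hB n)).
    apply: ler_sum => j _; rewrite nmM nmX ler_wpM2l ?nm_ge0 //.
    apply: lerXn2r; rewrite ?nnegrE ?nm_ge0 ?(ltW r0) // ltW //.
    by move/(rdiskE _ (ltW r0)) : xr.
  by apply: lerXn2r; rewrite ?nnegrE ?nm_ge0 ?(le_trans (nm_ge0 _) hh).
rewrite -(cvg_lim _ h) //; apply: lime_ge; first by apply/cvg_ex; eexists; exact: h.
exists N => // M /= NM; rewrite int_psm // lee_fin ler_wpM2l ?wsr_mono ?(ltW r0) //.
by rewrite fine_ge0.
Qed.

Lemma area_cvg : area (1 - n.+2%:R^-1) @[n --> \oo] --> unit_area.
Proof.
pose q n : R := 1 - n.+2%:R^-1.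
have q0 n : 0 <= q n by rewrite subr_ge0 invf_le1 ?ler1n.
have q1 n : q n < 1 by rewrite ltrBlDr ltrDl invr_gt0.
have un : \bigcup_n rdisk (q n) = rdisk 1.
  apply/seteqP; split => x.
    by move=> [n _]; apply: rdisk_sub => //; exact: ltW.
  move=> /(rdiskE _ ler01) x1.
  set m := nm (toC x) in x1 *.
  have e0 : 0 < 1 - m by rewrite subr_gt0.
  have /cvgrPdist_lt /(_ _ e0) [N _ hN] := @cvg_harmonic R.
  exists N => //; apply/(rdiskE _ (q0 N)); rewrite -/m.
  have /= := hN N (leqnn N); rewrite /harmonic /= sub0r normrN ger0_norm ?invr_ge0 // => h.
  have : N.+2%:R^-1 < N.+1%:R^-1 :> R by rewrite ltf_pV2 ?posrE // ltr_nat.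
  by move=> /lt_trans /(_ h) h2; rewrite /q ltrBrDr -ltrBrDl.
have h : (mu \o (fun n => rdisk (q n))) n @[n --> \oo] --> mu (rdisk 1).
  rewrite -un; apply: nondecreasing_cvg_mu.
  - by move=> n; exact: measurable_rdisk.
  - by rewrite un; exact: measurable_rdisk.
  - move=> n m nm'; apply/subsetPset; apply: rdisk_sub => //.
    by rewrite lerD2l lerN2 lef_pV2 ?posrE // ler_nat !ltnS.
apply: fine_cvg; rewrite /unit_area fineK //.
by rewrite ge0_fin_numE // leb2_rdisk_lty.
Qed.

(** The inequality on the disks of radius [1 - 1/(n+2)] passes to the limit with [N] fixed, and the
    areas converge by continuity of the measure. *)
Lemma bessel N : ((unit_area * wsum a N)%:E <=
  \int[mu]_(x in rdisk 1) (abs2 (psum a (toC x)))%:E)%E.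
Proof.
set S := (X in (_ <= X)%E).
have S0 : (0 <= S)%E by apply: integral_ge0 => x _; rewrite lee_fin abs2_ge0.
case: (ltP S +oo%E) => [Sy|]; last by rewrite leye_eq => /eqP ->; rewrite leey.
have Sf : S = (fine S)%:E by rewrite fineK // ge0_fin_numE.
rewrite Sf lee_fin.
pose q n : R := 1 - n.+2%:R^-1.
have q01 n : 0 < q n < 1.
  rewrite subr_gt0 invf_lt1 ?ltr1n //= ltrBlDr ltrDl invr_gt0 //.
have b n : area (q n) * (q n ^+ (2 * N) * wsum a N) <= fine S.
  have [h0 h1] := andP (q01 n).
  rewrite -lee_fin -Sf; apply: (@le_trans _ _ (area (q n) * wsr (q n) a N)%:E).
    by rewrite lee_fin ler_wpM2l ?wsr_ge ?fine_ge0 // !ltW.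
  apply: le_trans (bessel_r N (q01 n)) _; apply: ge0_subset_integral.
  - exact: measurable_rdisk.
  - exact: measurable_rdisk.
  - exact: measurable_psum_abs2.
  - by move=> x _; rewrite lee_fin abs2_ge0.
  - by apply: rdisk_sub; exact: ltW.
have q1 : q n @[n --> \oo] --> (1 : R).
  rewrite -[X in _ --> X]subr0; apply: cvgB; first exact: cvg_cst.
  by have := @cvg_harmonic R; rewrite -cvg_shiftS.
have qX m : q n ^+ m @[n --> \oo] --> (1 : R).
  elim: m => [|m IH]; first exact: cvg_cst.
  by rewrite -[X in _ --> X]mulr1; under eq_fun do rewrite exprS; exact: cvgM.
have lim : area (q n) * (q n ^+ (2 * N) * wsum a N) @[n --> \oo] --> unit_area * (1 * wsum a N).
  apply: cvgM; first exact: area_cvg.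
  by apply: cvgM; [exact: qX|exact: cvg_cst].
rewrite mul1r in lim; rewrite -(cvg_lim _ lim) //.
by apply: limr_le; [apply/cvg_ex; eexists; exact: lim|apply: nearW].
Qed.

(** The opposite inequality, by Fatou's lemma for the partial sums, whose integrals are known
    exactly. *)
Lemma parseval_le (B : R) : (forall N, wsum a N <= B) ->
  (\int[mu]_(x in rdisk 1) (abs2 (psum a (toC x)))%:E <= (unit_area * B)%:E)%E.
Proof.
move=> hB.
have mr : measurable (rdisk 1 : set (R * R)) by exact: measurable_rdisk.
pose F n x := (abs2 (psm a n (toC x)))%:E.
have -> : (\int[mu]_(x in rdisk 1) (abs2 (psum a (toC x)))%:E =
   \int[mu]_(x in rdisk 1) limn_einf (F^~ x))%E.
  apply: eq_integral => x; rewrite inE => /psm_cvg /cvg_abs2 h.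
  by have [-> _] := cvg_limn_einf_sup h.
apply: le_trans (fatou _ _ _ _) _.
- exact: measurable_rdisk.
- by move=> n; exact: measurable_psm_abs2.
- by move=> n x _; rewrite lee_fin abs2_ge0.
have -> : (fun n => (\int[mu]_(x in rdisk 1) F n x)%E) = (fun n => (unit_area * wsum a n)%:E).
  by apply/funext => n; rewrite int_psm // wsr1.
rewrite limn_einf_lim; apply: lime_le; first exact: is_cvg_einfs.
apply: nearW => n; apply: ge_ereal_inf; exists (unit_area * wsum a n)%:E.
  by exists n => /=.
by rewrite lee_fin ler_wpM2l // ltW // unit_area_gt0.
Qed.

End Series.
End Parseval.

(** * The Bergman space and the projection *)

Section Bergman.
Variable R : realType.
Local Notation C := (CC R).
Local Notation nm := (@Normc.normc R).
Local Notation mu := (@leb2 R).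
Local Notation kap := (kap R).

Implicit Types (f g h k : C -> C).

Lemma holoP (f : C -> C) : holo_on (disk (R := R)) f <-> holo f.
Proof.
split => [h z /diskE /h /derivable_cdf|h z /diskE /h [d]]; first by exists (f^`() z).
by move=> /is_derive_cdf [].
Qed.

Lemma holoD (f g : C -> C) : holo f -> holo g -> holo (fun z => f z + g z).
Proof. by move=> hf hg z z1; have [d hd] := hf z z1; have [e he] := hg z z1; exists (d + e); exact: catD. Qed.

Lemma holoM (f g : C -> C) : holo f -> holo g -> holo (fun z => f z * g z).
Proof.
move=> hf hg z z1; have [d hd] := hf z z1; have [e he] := hg z z1.
by exists (d * g z + f z * e); apply: catM => //; exact: cont_id.
Qed.

Lemma holo_cst (c : C) : holo (fun _ => c).
Proof. by move=> z _; exists 0; exact: cat_cst. Qed.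

Lemma holo_id : holo (fun z : C => z).
Proof. by move=> z _; exists 1; exact: cat_id. Qed.

Lemma holoN (f : C -> C) : holo f -> holo (fun z => - f z).
Proof. by move=> hf z z1; have [d hd] := hf z z1; exists (- d); exact: catN. Qed.

Lemma holoB (f g : C -> C) : holo f -> holo g -> holo (fun z => f z - g z).
Proof. by move=> hf hg; apply: holoD => //; exact: holoN. Qed.

Lemma holo_ext (f g : C -> C) : (forall z, nm z < 1 -> f z = g z) -> holo f -> holo g.
Proof.
move=> h hf z z1; have [d hd] := hf z z1; exists d.
apply: (@cdf_near _ f _ _ _ (1 - nm z)) => // [|w hw]; first by rewrite subr_gt0.
by rewrite h // -(subrK z w) (le_lt_trans (nmD _ _)) // -ltrBrDr.
Qed.

Lemma psum_holo (a : nat -> C) : rad a -> holo (psum a).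
Proof. by move=> ra z z1; exists (psum (dfs a) z); exact: psum_cdf. Qed.

Lemma holo_mf f : holo f -> measurable_fun (rdisk 1) (fun x => complex.Re (f (toC x))) /\
  measurable_fun (rdisk 1) (fun x => complex.Im (f (toC x))).
Proof.
move=> /holo_psum [a ra h].
have e x : x \in rdisk 1 -> f (toC x) = psum a (toC x).
  by rewrite inE => /(rdiskE _ ler01) /h.
split.
  apply: (@eq_measurable_fun _ _ _ _ _ (fun x => complex.Re (psum a (toC x)))).
    by move=> x /e ->.
  exact: measurable_psum_Re.
apply: (@eq_measurable_fun _ _ _ _ _ (fun x => complex.Im (psum a (toC x)))).
  by move=> x /e ->.
exact: measurable_psum_Im.
Qed.

Lemma holo_mabs2 f : holo f -> measurable_fun (rdisk 1) (fun x => (abs2 (f (toC x)))%:E).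
Proof.
move=> /holo_mf [h1 h2]; apply/measurable_EFinP; rewrite /abs2.
by apply: measurable_funD; apply: measurable_funX.
Qed.

Lemma pi1_ge0 : 0 <= pi^-1 :> R.
Proof. by rewrite invr_ge0 pi_ge0. Qed.

Lemma sqnormE f : sqnorm f =
  ((pi^-1)%:E * \int[mu]_(x in rdisk 1) (abs2 (f (toC x)))%:E)%E.
Proof. by rewrite /sqnorm diskRR_rdisk. Qed.

Lemma sqnorm_ge0 (f : C -> C) : (0 <= sqnorm f)%E.
Proof.
rewrite sqnormE mule_ge0 ?lee_fin ?pi1_ge0 //.
by apply: integral_ge0 => x _; rewrite lee_fin abs2_ge0.
Qed.

Lemma sqnorm_ext (f g : C -> C) : (forall z, nm z < 1 -> f z = g z) -> sqnorm f = sqnorm g.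
Proof.
move=> h; rewrite !sqnormE; congr (_ * _)%E; apply: eq_integral => x.
by rewrite inE => /(rdiskE _ ler01) /h ->.
Qed.

Lemma sqnorm_le2 (f g h : C -> C) (a b : R) : holo f -> holo g -> holo h -> 0 <= a -> 0 <= b ->
  (forall z, nm z < 1 -> nm (f z) ^+ 2 <= a * nm (g z) ^+ 2 + b * nm (h z) ^+ 2) ->
  (sqnorm f <= a%:E * sqnorm g + b%:E * sqnorm h)%E.
Proof.
move=> hf hg hh a0 b0 le; rewrite !sqnormE.
have mg := holo_mabs2 hg; have mh := holo_mabs2 hh; have mf := holo_mabs2 hf.
have p (u : C -> C) x : (0 <= (abs2 (u (toC x)))%:E)%E by rewrite lee_fin abs2_ge0.
rewrite muleCA [X in (_ + X)%E]muleCA -ge0_muleDr; last 2 first.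
- by rewrite mule_ge0 // integral_ge0.
- by rewrite mule_ge0 // integral_ge0.
apply: lee_wpmul2l; first by rewrite lee_fin pi1_ge0.
rewrite -ge0_integralZl_EFin //; try exact: measurable_rdisk.
rewrite -ge0_integralZl_EFin //; try exact: measurable_rdisk.
rewrite -ge0_integralD //; first last.
- exact: measurable_funeM.
- by move=> x _; rewrite mule_ge0.
- exact: measurable_funeM.
- by move=> x _; rewrite mule_ge0.
- exact: measurable_rdisk.
apply: ge0_le_integral => //.
- exact: measurable_rdisk.
- by apply: emeasurable_funD; exact: measurable_funeM.
move=> x /(rdiskE _ ler01) x1; rewrite -!EFinM -EFinD lee_fin -!nm_sqr; exact: le.
Qed.

Lemma bergmanE f : bergman f <-> holo f /\ (sqnorm f < +oo)%E.
Proof.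
rewrite /bergman holoP /L2D diskRR_rdisk; split => [[hf [_ [_ ?]]] //|[hf ?]].
by have [h1 h2] := holo_mf hf.
Qed.

Lemma bergman_le2 (f g h : C -> C) (a b : R) : holo f -> bergman g -> bergman h -> 0 <= a -> 0 <= b ->
  (forall z, nm z < 1 -> nm (f z) ^+ 2 <= a * nm (g z) ^+ 2 + b * nm (h z) ^+ 2) ->
  bergman f.
Proof.
move=> hf /bergmanE [hg ng] /bergmanE [hh nh] a0 b0 le; apply/bergmanE; split => //.
apply: le_lt_trans (sqnorm_le2 hf hg hh a0 b0 le) _.
by rewrite lte_add_pinfty // lte_mul_pinfty.
Qed.

Lemma nm_sqrD (z w : C) : nm (z + w) ^+ 2 <= 2 * nm z ^+ 2 + 2 * nm w ^+ 2.
Proof.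
have := nmD z w; have := nm_ge0 z; have := nm_ge0 w; have := nm_ge0 (z + w).
move: (nm (z + w)) (nm z) (nm w) => u x y u0 y0 x0 h.
apply: (@le_trans _ _ ((x + y) ^+ 2)); first by apply: lerXn2r; rewrite ?nnegrE // addr_ge0.
by have := sqr_ge0 (x - y); nra.
Qed.

Lemma bergmanD f g : bergman f -> bergman g -> bergman (fun z => f z + g z).
Proof.
move=> bf bg; have [hf _] := proj1 (bergmanE f) bf; have [hg _] := proj1 (bergmanE g) bg.
by apply: (@bergman_le2 _ f g 2 2) => //; [exact: holoD|move=> z _; exact: nm_sqrD].
Qed.

Lemma bergmanM (u f : C -> C) (B : R) : holo u -> (forall z, nm z < 1 -> nm (u z) <= B) ->
  bergman f -> bergman (fun z => u z * f z).
Proof.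
move=> hu hB bf; have [hf _] := proj1 (bergmanE f) bf.
apply: (@bergman_le2 _ f f (B ^+ 2) 0) => //; [exact: holoM|exact: sqr_ge0|].
move=> z z1; rewrite mul0r addr0 nmM exprMn ler_wpM2r ?sqr_ge0 //.
have := hB z z1 => h; apply: lerXn2r; rewrite ?nnegrE ?nm_ge0 //.
exact: le_trans (nm_ge0 _) h.
Qed.

Lemma sqnormM (u f : C -> C) (B : R) : holo u -> holo f -> (forall z, nm z < 1 -> nm (u z) <= B) ->
  (sqnorm (fun z => u z * f z)%R <= (B ^+ 2)%:E * sqnorm f)%E.
Proof.
move=> hu hf hB.
have := @sqnorm_le2 (fun z => u z * f z) f f (B ^+ 2) 0 (holoM hu hf) hf hf (sqr_ge0 B) (lexx 0).
rewrite mul0e adde0; apply => z z1; rewrite mul0r addr0 nmM exprMn ler_wpM2r ?sqr_ge0 //.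
have := hB z z1 => h; apply: lerXn2r; rewrite ?nnegrE ?nm_ge0 //.
exact: le_trans (nm_ge0 _) h.
Qed.

Lemma bergmanZ (c : C) f : bergman f -> bergman (fun z => c * f z).
Proof. by apply: (@bergmanM (fun _ => c) f (nm c)) => //; exact: holo_cst. Qed.

Lemma bergmanN f : bergman f -> bergman (fun z => - f z).
Proof.
move=> /(bergmanZ (-1)); rewrite (_ : (fun z => -1 * f z) = (fun z => - f z)) //.
by apply/funext => z; rewrite mulN1r.
Qed.

Lemma bergmanB f g : bergman f -> bergman g -> bergman (fun z => f z - g z).
Proof. by move=> bf bg; apply: bergmanD => //; exact: bergmanN. Qed.

Lemma bergman_zM f : bergman f -> bergman (fun z => z * f z).
Proof. by apply: (@bergmanM _ _ 1); [exact: holo_id|move=> z /ltW]. Qed.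

Lemma bergman_ext f g : (forall z, nm z < 1 -> f z = g z) -> bergman f -> bergman g.
Proof.
move=> h /bergmanE [hf nf]; apply/bergmanE; split; first exact: holo_ext hf.
by rewrite -(sqnorm_ext h).
Qed.

Section Coef.
Variables (f : C -> C) (a : nat -> C).
Hypotheses (ra : rad a) (fa : forall z, nm z < 1 -> f z = psum a z).

Lemma sqnorm_bessel N : ((kap * wsum a N)%:E <= sqnorm f)%E.
Proof.
rewrite (sqnorm_ext fa) sqnormE /kap -mulrA EFinM.
by apply: lee_wpmul2l; [rewrite lee_fin pi1_ge0|exact: bessel].
Qed.

Lemma sqnorm_parseval (B : R) : (forall N, wsum a N <= B) -> (sqnorm f <= (kap * B)%:E)%E.
Proof.
move=> hB; rewrite (sqnorm_ext fa) sqnormE /kap -mulrA EFinM.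
by apply: lee_wpmul2l; [rewrite lee_fin pi1_ge0|exact: parseval_le].
Qed.

Lemma bergman_coef (B : R) : (forall N, wsum a N <= B) -> bergman f.
Proof.
move=> hB; apply/bergmanE; split.
  by apply: holo_ext (psum_holo ra) => z /fa.
by apply: le_lt_trans (sqnorm_parseval hB) _; rewrite ltry.
Qed.

Definition nD (g : C -> C) : R := fine (sqnorm g).

Lemma nDE g : bergman g -> sqnorm g = (nD g)%:E.
Proof. by move=> /bergmanE [_ h]; rewrite fineK // ge0_fin_numE // sqnorm_ge0. Qed.

Lemma wsum_nD N : bergman f -> kap * wsum a N <= nD f.
Proof. by move=> bf; rewrite -lee_fin -nDE // sqnorm_bessel. Qed.

Lemma wsum_mono (c : nat -> C) n m : (n <= m)%N -> wsum c n <= wsum c m.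
Proof. by rewrite -!wsr1 => h; apply: wsr_mono. Qed.

(** [wsum_nD] makes the norm an upper bound of the partial sums, and [sqnorm_parseval], applied with
    their supremum, makes it the least one. *)
Lemma wsum_cvg : bergman f -> kap * wsum a N @[N --> \oo] --> nD f.
Proof.
move=> bf.
have nd : nondecreasing_seq (fun N => kap * wsum a N).
  by move=> n m h; rewrite ler_pM2l ?kap_gt0 // wsum_mono.
have ub : has_ubound (range (fun N => kap * wsum a N)).
  by exists (nD f) => _ [N _ <-]; exact: wsum_nD.
have h := nondecreasing_cvgn nd ub.
suff -> : nD f = sup (range (fun N => kap * wsum a N)) by [].
apply/eqP; rewrite eq_le; apply/andP; split; last first.
  by apply: ge_sup; [exists (kap * wsum a 0); exists 0%N|move=> _ [N _ <-]; exact: wsum_nD].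
have k0 := kap_gt0 R.
rewrite -lee_fin -nDE //; set S := sup _.
rewrite (_ : S = kap * (S / kap)); last by rewrite mulrC divfK // gt_eqF.
apply: sqnorm_parseval => N; rewrite ler_pdivlMr // mulrC.
by apply: ub_le_sup => //; exists N.
Qed.

End Coef.

Lemma bergman_eq0 f : bergman f -> nD f = 0 -> forall z, nm z < 1 -> f z = 0.
Proof.
move=> bf n0 z z1; have [hf _] := proj1 (bergmanE f) bf.
have [a ra fa] := holo_psum hf.
have a0 n : a n = 0.
  have := wsum_nD ra fa n.+1 bf; rewrite n0 pmulr_rle0 ?kap_gt0 // => h.
  have t j : 0 <= abs2 (a j) / j.+1%:R by rewrite divr_ge0 ?abs2_ge0.
  have := h; rewrite /wsum big_ord_recr /= => h'.
  have s0 : 0 <= \sum_(i < n) abs2 (a i) / i.+1%:R by apply: sumr_ge0.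
  have : abs2 (a n) / n.+1%:R <= 0 by apply: le_trans h'; rewrite lerDr.
  rewrite pmulr_lle0 ?invr_gt0 // -nm_sqr => s1.
  apply/eqP; rewrite -nm_eq0 -sqrf_eq0 eq_le s1 sqr_ge0 //.
by rewrite fa // (@psum_fin _ _ _ 0) ?/psm ?big_ord0.
Qed.

End Bergman.

(** * Pairings and the Bergman projection of [zbar f] *)

Section Projection.
Variable R : realType.
Local Notation C := (CC R).
Local Notation nm := (@Normc.normc R).
Local Notation toR := (real_complex R : R -> C).
Local Notation I := (Complex 0 1 : C).
Local Notation mu := (@leb2 R).
Local Notation cj := (fun z : C => (conjc z : C)).
Local Notation kap := (kap R).
Implicit Types (f g h k : C -> C) (u v : C -> R).

Definition integD u := mu.-integrable (rdisk 1) (EFin \o (fun x => u (toC x))).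

Lemma intDE u : intD u = pi^-1 * Rintegral mu (rdisk 1) (fun x => u (toC x)).
Proof. by rewrite /intD diskRR_rdisk. Qed.

Lemma intD_ext u v : (forall z, nm z < 1 -> u z = v z) -> intD u = intD v.
Proof.
move=> h; rewrite !intDE; congr (_ * _); apply: eq_Rintegral => x.
by rewrite inE => /(rdiskE _ ler01) /h.
Qed.

Lemma integD_ext u v : (forall z, nm z < 1 -> u z = v z) -> integD u -> integD v.
Proof.
move=> h; apply: eq_integrable; first exact: measurable_rdisk.
by move=> x; rewrite inE => /(rdiskE _ ler01) /h /= ->.
Qed.

Lemma integD_D u v : integD u -> integD v -> integD (fun z => u z + v z).
Proof.
move=> hu hv.
have : mu.-integrable (rdisk 1) ((EFin \o (fun x => u (toC x))) \+ (EFin \o (fun x => v (toC x))))%E.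
  by apply: integrableD => //; exact: measurable_rdisk.
by apply: eq_integrable => //; exact: measurable_rdisk.
Qed.

Lemma integD_Z (c : R) u : integD u -> integD (fun z => c * u z).
Proof.
move=> hu.
have : mu.-integrable (rdisk 1) (fun x => c%:E * (EFin \o (fun x => u (toC x))) x)%E.
  by apply: integrableZl => //; exact: measurable_rdisk.
by apply: eq_integrable => //; exact: measurable_rdisk.
Qed.

Lemma intD_D u v : integD u -> integD v ->
  intD (fun z => u z + v z) = intD u + intD v.
Proof.
by move=> hu hv; rewrite !intDE RintegralD ?mulrDr //; exact: measurable_rdisk.
Qed.

Lemma intD_Z (c : R) u : integD u -> intD (fun z => c * u z) = c * intD u.
Proof.
by move=> hu; rewrite !intDE RintegralZl //; [ring|exact: measurable_rdisk].
Qed.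

Lemma integD_abs2 f : bergman f -> integD (fun z => abs2 (f z)).
Proof.
move=> /bergmanE [hf nf]; apply/integrableP; split.
  by have := holo_mabs2 hf.
have e : (\int[mu]_(x in rdisk 1) `|(EFin \o (fun x => abs2 (f (toC x)))) x| =
          \int[mu]_(x in rdisk 1) (abs2 (f (toC x)))%:E)%E.
  by apply: eq_integral => x _; rewrite gee0_abs // lee_fin abs2_ge0.
rewrite e; have i0 : (0 <= \int[mu]_(x in rdisk 1) (abs2 (f (toC x)))%:E)%E.
  by apply: integral_ge0 => x _; rewrite lee_fin abs2_ge0.
rewrite ltNge leye_eq; apply/negP => /eqP ey.
by move: nf; rewrite sqnormE ey gt0_muley ?ltxx // lte_fin invr_gt0 pi_gt0.
Qed.

Lemma intD_abs2 f : bergman f -> intD (fun z => abs2 (f z)) = nD f.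
Proof.
move=> bf; rewrite intDE /nD sqnormE fineM //.
apply: integrable_fin_num; first exact: measurable_rdisk.
exact: integD_abs2.
Qed.

(** Reduces pairings to squared norms, for which integrability and the expression in coefficients
    are already available. *)
Lemma polarization (z w : C) :
  complex.Re (z * cj w) = 1 / 4 * abs2 (z + w) + (- (1 / 4)) * abs2 (z - w).
Proof. by case: z w => [a b] [c d]; rewrite /abs2 /=; field. Qed.

Section Pair.
Variables f k : C -> C.
Hypotheses (bf : bergman f) (bk : bergman k).

Lemma integD_pair : integD (fun z => complex.Re (f z * cj (k z))).
Proof.
apply: (@integD_ext (fun z => 1 / 4 * abs2 (f z + k z) + (- (1 / 4)) * abs2 (f z - k z))).
  by move=> z _; rewrite polarization.
by apply: integD_D; apply: integD_Z; apply: integD_abs2; [exact: bergmanD|exact: bergmanB].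
Qed.

Lemma intD_pair : intD (fun z => complex.Re (f z * cj (k z))) =
  1 / 4 * nD (fun z => f z + k z) + (- (1 / 4)) * nD (fun z => f z - k z).
Proof.
rewrite (@intD_ext _ (fun z => 1 / 4 * abs2 (f z + k z) + (- (1 / 4)) * abs2 (f z - k z))).
  have b1 := bergmanD bf bk; have b2 := bergmanB bf bk.
  by rewrite intD_D ?intD_Z ?intD_abs2 //; try apply: integD_Z; exact: integD_abs2.
by move=> z _; rewrite polarization.
Qed.

End Pair.

Lemma wsum_polar (x y : nat -> C) N :
  wsum (fun n => x n + y n) N - wsum (fun n => x n - y n) N =
  \sum_(j < N) 4 * complex.Re (x j * cj (y j)) / j.+1%:R.
Proof.
rewrite /wsum -sumrB; apply: eq_bigr => j _.
by rewrite polarization -mulrBl; congr (_ / _); field.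
Qed.

(** The coefficients of the Bergman projection of [zbar f]. *)
Definition bshift (a : nat -> C) n : C := toR (n.+1%:R / n.+2%:R) * a n.+1.

Lemma rad_bshift a : rad a -> rad (bshift a).
Proof.
move=> /rad_behead; apply: (@rad_le _ _ _ 1) => n; rewrite nmM ler_wpM2r ?nm_ge0 //.
rewrite nm_real ger0_norm ?divr_ge0 // ler_pdivrMr // mul1r ler_nat //.
Qed.

Lemma wsum_bshift a N : wsum (bshift a) N <= wsum a N.+1.
Proof.
rewrite /wsum big_ord_recl /= -[leLHS]add0r lerD //; first by rewrite divr_ge0 ?abs2_ge0.
apply: ler_sum => j _; rewrite /bump /= add1n /bshift -!nm_sqr nmM nm_real.
rewrite ger0_norm ?divr_ge0 // exprMn.
have -> : (j.+1%:R / j.+2%:R) ^+ 2 * nm (a j.+1) ^+ 2 / j.+1%:R =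
  nm (a j.+1) ^+ 2 * ((j.+1%:R / j.+2%:R) / j.+2%:R) :> R.
  have key (x y u : R) : x != 0 -> y != 0 -> (x / y) ^+ 2 * u / x = u * (x / y / y).
    by move=> x0 y0; field; rewrite ?x0 ?y0.
  by apply: key; rewrite pnatr_eq0.
rewrite ler_wpM2l ?sqr_ge0 // ler_piMl ?invr_ge0 //.
by rewrite ler_pdivrMr // mul1r ler_nat.
Qed.

Lemma bergman_bshift f a : bergman f -> rad a -> (forall z, nm z < 1 -> f z = psum a z) ->
  bergman (psum (bshift a)).
Proof.
move=> bf ra fa; have k0 := kap_gt0 R.
apply: (@bergman_coef _ _ (bshift a) _ _ (nD f / kap)) => //; first exact: rad_bshift.
move=> N; apply: le_trans (wsum_bshift a N) _.
by rewrite ler_pdivlMr // mulrC; exact: (wsum_nD ra fa).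
Qed.

Section Orth.
Variables (f : C -> C) (a : nat -> C).
Hypotheses (bf : bergman f) (ra : rad a) (fa : forall z, nm z < 1 -> f z = psum a z).
Let V := psum (bshift a).
Let bV : bergman V := bergman_bshift bf ra fa.

(** Multiplication by [z] is moved to the other side in coefficients: [a_(j+1) conj(c_j) / (j+2)] is
    [(j+1)/(j+2) a_(j+1)] paired with [c_j] under the weight [1/(j+1)]. *)
Lemma orth_eq k : bergman k ->
  intD (fun z => complex.Re (f z * cj (z * k z))) = intD (fun z => complex.Re (V z * cj (k z))).
Proof.
move=> bk; have [hk _] := proj1 (bergmanE k) bk.
have [c rc kc] := holo_psum hk.
have bzk := bergman_zM bk.
rewrite !intD_pair //.
have rs := rad_shift rc; have rb := rad_bshift ra.
have E1 z : nm z < 1 -> f z + z * k z = psum (fun n => a n + shift c n) z.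
  by move=> z1; rewrite psumD // psum_shift // fa // kc.
have E2 z : nm z < 1 -> f z - z * k z = psum (fun n => a n - shift c n) z.
  by move=> z1; rewrite psumB // psum_shift // fa // kc.
have E3 z : nm z < 1 -> V z + k z = psum (fun n => bshift a n + c n) z.
  by move=> z1; rewrite psumD // kc.
have E4 z : nm z < 1 -> V z - k z = psum (fun n => bshift a n - c n) z.
  by move=> z1; rewrite psumB // kc.
have L1 := wsum_cvg (radD ra rs) E1 (bergmanD bf bzk).
have L2 := wsum_cvg (radD ra (radN rs)) E2 (bergmanB bf bzk).
have L3 := wsum_cvg (radD rb rc) E3 (bergmanD bV bk).
have L4 := wsum_cvg (radD rb (radN rc)) E4 (bergmanB bV bk).
suff e : nD (fun z => f z + z * k z) - nD (fun z => f z - z * k z) =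
         nD (fun z => V z + k z) - nD (fun z => V z - k z).
  by lra.
pose u1 N := kap * wsum (fun n => a n + shift c n) N - kap * wsum (fun n => a n - shift c n) N.
pose u2 N := kap * wsum (fun n => bshift a n + c n) N - kap * wsum (fun n => bshift a n - c n) N.
have K1 : u1 N @[N --> \oo] --> nD (fun z => f z + z * k z) - nD (fun z => f z - z * k z).
  exact: cvgB L1 L2.
have K2 : u2 N @[N --> \oo] --> nD (fun z => V z + k z) - nD (fun z => V z - k z).
  exact: cvgB L3 L4.
(* The shift moves indices by one and [shift c] vanishes at 0, so the partial sum of length [N+1] on
   one side equals that of length [N] on the other. *)
have K3 : u1 N.+1 @[N --> \oo] --> nD (fun z => f z + z * k z) - nD (fun z => f z - z * k z).
  by rewrite cvg_shiftS.
rewrite -(cvg_lim _ K3) // -(cvg_lim _ K2) //; congr (limn _); apply/funext => N.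
rewrite /u1 /u2.
rewrite -!mulrBr !wsum_polar; congr (_ * _).
rewrite big_ord_recl /=.
have -> : complex.Re (a 0%N * conjc (0 : C)) = 0.
  by rewrite (_ : conjc (0 : C) = 0) ?mulr0 //; exact: conjc0.
rewrite mulr0 mul0r add0r; apply: eq_bigr => j _; rewrite /bump /= add1n /bshift.
rewrite -mulrA [X in _ = _ * X / _](_ : _ = (j.+1%:R / j.+2%:R) * complex.Re (a j.+1 * cj (c j))).
  rewrite add0n; have key (x y u : R) : x != 0 -> y != 0 -> 4 * (u / y) = 4 * (x / y * u) / x.
    by move=> x0 y0; field; rewrite ?x0 ?y0.
  by apply: key; rewrite pnatr_eq0.
by rewrite -mulrA mulrC ReMr mulrC.
Qed.

Lemma proj_orth_Re k : bergman k ->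
  intD (fun z => complex.Re ((cj z * f z - V z) * cj (k z))) = 0.
Proof.
move=> bk; have bzk := bergman_zM bk.
rewrite (@intD_ext _ (fun z => complex.Re (f z * cj (z * k z)) + (-1) * complex.Re (V z * cj (k z)))).
  rewrite intD_D ?intD_Z; [|exact: integD_pair|exact: integD_pair|].
    by rewrite orth_eq // mulN1r subrr.
  by apply: integD_Z; exact: integD_pair.
move=> z _; rewrite mulN1r -ReN -ReD; congr (complex.Re _).
by rewrite conjM; ring.
Qed.

End Orth.

Lemma ImI (z w : C) : complex.Im (z * cj w) = complex.Re (z * cj (I * w)).
Proof. by case: z w => [a b] [c d] /=; ring. Qed.

(** The imaginary part of the pairing with [k] is the real part of the pairing with [I * k], so real
    parts for all test functions suffice. *)
Lemma inner0 (X : C -> C) k : bergman k ->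
  (forall k, bergman k -> intD (fun z => complex.Re (X z * cj (k z))) = 0) ->
  inner X k = 0.
Proof.
move=> bk h; rewrite /inner h //; apply: complexP => //=.
rewrite (_ : (fun z => _) = (fun z => complex.Re (X z * cj (I * k z)))).
  exact: (h _ (bergmanZ I bk)).
by apply/funext => z; rewrite -ImI.
Qed.

(** Both orthogonality relations are tested on [h - h']; their difference is its squared norm.
    Integrability of the pairings with [X] permits splitting the integrals. *)
Lemma proj_uniq (X : C -> C) h h' : bergman h -> bergman h' ->
  (forall k, bergman k -> integD (fun z => complex.Re (X z * cj (k z)))) ->
  (forall k, bergman k -> intD (fun z => complex.Re ((X z - h z) * cj (k z))) = 0) ->
  (forall k, bergman k -> intD (fun z => complex.Re ((X z - h' z) * cj (k z))) = 0) ->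
  forall z, nm z < 1 -> h z = h' z.
Proof.
move=> bh bh' iX e e'.
have sp g k : bergman g -> bergman k ->
    intD (fun z => complex.Re ((X z - g z) * cj (k z))) =
    intD (fun z => complex.Re (X z * cj (k z))) - intD (fun z => complex.Re (g z * cj (k z))).
  move=> bg bk.
  rewrite (@intD_ext _ (fun z => complex.Re (X z * cj (k z)) + (-1) * complex.Re (g z * cj (k z)))).
    rewrite intD_D ?intD_Z ?mulN1r //; [exact: integD_pair|exact: iX|].
    by apply: integD_Z; exact: integD_pair.
  by move=> z _; rewrite mulN1r -ReN -ReD; congr (complex.Re _); ring.
pose d z := h z - h' z.
have bd : bergman d by exact: bergmanB.
have n0 : nD d = 0.
  have h1 := e _ bd; have h2 := e' _ bd; rewrite sp // in h1; rewrite sp // in h2.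
  have : intD (fun z => complex.Re (h z * cj (d z))) - intD (fun z => complex.Re (h' z * cj (d z))) = 0.
    by lra.
  rewrite -intD_abs2 // => h3; rewrite -[RHS]h3.
  rewrite (@intD_ext (fun z => abs2 (d z)) (fun z => complex.Re (h z * cj (d z)) + (-1) * complex.Re (h' z * cj (d z)))).
    rewrite intD_D ?intD_Z ?mulN1r //; try exact: integD_pair.
    by apply: integD_Z; exact: integD_pair.
  move=> z _; rewrite mulN1r -ReN -ReD -mulNr -mulrDl -/(d z).
  by rewrite abs2E.
move=> z z1; apply/eqP; rewrite -subr_eq0; apply/eqP.
exact: (bergman_eq0 bd n0 z1).
Qed.

(** [bergman_proj] is a choice: since the explicit candidate meets its specification, so does the
    chosen function, and uniqueness identifies the two on the disk. *)
Lemma toeplitzE (p f : C -> C) (a : nat -> C) (B : R) : holo p ->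
  (forall z, nm z < 1 -> nm (p z) <= B) ->
  bergman f -> rad a -> (forall z, nm z < 1 -> f z = psum a z) ->
  bergman (toeplitz (fun z => conjc z + p z) f) /\
  forall z, nm z < 1 -> toeplitz (fun z => conjc z + p z) f z =
    psum (bshift a) z + p z * f z.
Proof.
move=> hp pB bf ra fa.
set X : C -> C := (fun z => conjc z + p z) \* f.
have bV := bergman_bshift bf ra fa.
have bpf := bergmanM hp pB bf.
pose h z := psum (bshift a) z + p z * f z.
have bh : bergman h by exact: bergmanD.
have oh k : bergman k -> intD (fun z => complex.Re ((X z - h z) * cj (k z))) = 0.
  move=> bk; rewrite -[RHS](proj_orth_Re bf ra fa bk); apply: intD_ext => z _.
  by congr (complex.Re (_ * _)); rewrite /X /h /=; ring.
have iX k : bergman k -> integD (fun z => complex.Re (X z * cj (k z))).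
  move=> bk; apply: (@integD_ext (fun z => complex.Re (f z * cj (z * k z)) + complex.Re (p z * f z * cj (k z)))).
    move=> z _; rewrite -ReD; congr (complex.Re _); rewrite /X /= conjM.
    by rewrite /=; ring.
  by apply: integD_D; [apply: integD_pair => //; exact: bergman_zM|apply: (integD_pair bpf bk)].
have [bT oT] : bergman (toeplitz (fun z => conjc z + p z) f) /\
    forall k, bergman k -> inner (X \- toeplitz (fun z => conjc z + p z) f) k = 0.
  rewrite /toeplitz /bergman_proj -/X; case: xgetP => [? -> //|/(_ h)].
  case; split => // k bk; apply: inner0 => //.
split => //; apply: (proj_uniq bT bh iX) => // k bk.
by have := congr1 (@complex.Re R) (oT _ bk).
Qed.

End Projection.

(** * Functions continuous up to the circle, and bounds by compactness *)

Section DiskAlgebra.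
Variable R : realType.
Local Notation C := (CC R).
Local Notation nm := (@Normc.normc R).
Local Notation D := (@cldisk R).
Implicit Types (f g h p : C -> C).

Lemma compact_cldisk : compact D.
Proof.
pose K : set (R * R) := [set x | nm (toC x) <= 1].
have ct : continuous (@toC R : R * R -> C).
  move=> x; apply: continuous_Complex; [exact: cvg_fst|exact: cvg_snd].
have cK : compact K.
  apply: (@subclosed_compact _ K (`[(-1 : R), 1]%classic `*` `[(-1 : R), 1]%classic)).
  - apply: (@preimage_closed _ _ (fun x => nm (toC x)) [set t : R | t <= 1]).
      by move=> x _; apply: (@continuous_comp _ C R (@toC R) nm); [exact: ct|exact: continuous_nm].
    exact: closed_le.
  - by apply: compact_setX; exact: segment_compact.
  - move=> x /= h; have h1 := le_trans (nm_Re _) h; have h2 := le_trans (nm_Im _) h.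
    by split => /=; rewrite in_itv /= -ler_norml.
have -> : D = (@toC R : R * R -> C) @` K.
  apply/seteqP; split => z.
    move=> /cldiskE z1; exists (complex.Re z, complex.Im z); first by case: z z1.
    by case: z z1.
  by move=> [x h <-]; apply/cldiskE.
apply: continuous_compact cK; exact: continuous_subspaceT.
Qed.

(** Continuity relative to the closed disk, pointwise; values of [f] outside the disk are
    arbitrary. *)
Definition wcont f z := f w @[w --> within D (nbhs z)] --> f z.

Lemma wcontM f g z : wcont f z -> wcont g z -> wcont (fun w => f w * g w) z.
Proof. exact: (@cvgM R[i] C (within D (nbhs z)) _ f g (f z) (g z)). Qed.
Lemma wcontD f g z : wcont f z -> wcont g z -> wcont (fun w => f w + g w) z.
Proof. exact: (@cvgD R[i] C C (within D (nbhs z)) _ f g (f z) (g z)). Qed.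
Lemma wcontV f z : f z != 0 -> wcont f z -> wcont (fun w => (f w)^-1) z.
Proof. exact: (@cvgV R[i] C (within D (nbhs z)) _ f (f z)). Qed.
Lemma wcont_cst (c : C) z : wcont (fun _ => c) z.
Proof. exact: cvg_cst. Qed.
Lemma cont_wcont f z : cont f z -> wcont f z.
Proof. by move=> [h]; apply: cvg_trans h; apply: cvg_app; exact: cvg_within. Qed.
Lemma wcont_id z : wcont (fun w => w) z.
Proof. by apply: cont_wcont; exact: cont_id. Qed.

Lemma wcont_near f g z (r : R) : 0 < r -> nm z <= 1 ->
  (forall w, nm (w - z) < r -> nm w <= 1 -> f w = g w) -> wcont f z -> wcont g z.
Proof.
move=> r0 z1 h; rewrite /wcont -(h z) ?subrr ?nm0 //; apply: cvg_trans; apply: near_eq_cvg.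
rewrite /within; apply/nbhsC; exists r => // w wr /cldiskE w1; exact: h.
Qed.

Lemma wcont_eps f z : wcont f z <-> forall e, 0 < e -> exists2 d, 0 < d &
  forall w, nm (w - z) < d -> nm w <= 1 -> nm (f w - f z) < e.
Proof.
rewrite /wcont cvgC; split => h e /h.
  by move=> /nbhsC[d d0 hd]; exists d => // w wd w1; apply: hd => //; apply/cldiskE.
by move=> [d d0 hd]; apply/nbhsC; exists d => // w wd /cldiskE w1; exact: hd.
Qed.

Lemma wcont_bounded f : (forall z, nm z <= 1 -> wcont f z) ->
  exists2 B, 0 < B & forall z, nm z <= 1 -> nm (f z) <= B.
Proof.
move=> wf.
have cf : {within D, continuous (fun z => nm (f z))}.
  apply/(@subspace_continuousP C D R) => z /cldiskE /wf h.
  exact: (@cvg_comp _ _ _ f nm _ _ _ h (@continuous_nm R _)).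
have /compact_bounded [B [_ hB]] := continuous_compact cf compact_cldisk.
exists (Num.max 1 (B + 1)); first by rewrite lt_max ltr01.
move=> z /cldiskE z1; rewrite -[leLHS]ger0_norm ?nm_ge0 //.
apply: (hB (Num.max 1 (B + 1))); last by exists z.
by rewrite lt_max ltrDl ltr01 orbT.
Qed.

Lemma wcont_lower f : (forall z, nm z <= 1 -> wcont f z) -> (forall z, nm z <= 1 -> f z != 0) ->
  exists2 B, 0 < B & forall z, nm z <= 1 -> nm (f z)^-1 <= B.
Proof.
by move=> wf f0; apply: wcont_bounded => z z1; apply: wcontV; [exact: f0|exact: wf].
Qed.

Lemma disk_algebraP p : disk_algebra p -> holo p /\ forall z, nm z <= 1 -> wcont p z.
Proof.
move=> [/holoP hp /(@subspace_continuousP C D C) cp]; split => // z /cldiskE; exact: cp.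
Qed.

Lemma holo_wcont f z : holo f -> nm z < 1 -> wcont f z.
Proof. by move=> hf z1; apply: cont_wcont; exact: holo_cont. Qed.

End DiskAlgebra.

(** * Reduction to a first order differential operator *)

Section Reduction.
Variable R : realType.
Local Notation C := (CC R).
Local Notation nm := (@Normc.normc R).
Local Notation toR := (real_complex R : R -> C).
Local Notation kap := (kap R).
Implicit Types (f g h p : C -> C) (b : nat -> C).

(** The Bergman weight [1/(n+1)] applied to the coefficients [(n+1) b_n] of [(z G)']. Bounded
    partial sums describe the domain of the operator. *)
Definition ds b N := \sum_(j < N) j.+1%:R * abs2 (b j).
Definition blift b n : C := n.+1%:R * b n.

(** With [G = psum b] and [f = (z G)'], the Toeplitz operator becomes
    [f |-> (1 + z p) G' + p G]. *)
Definition Lop p b z := (1 + z * p z) * psum (dfs b) z + p z * psum b z.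

Lemma rad_lift b : rad b -> rad (blift b).
Proof. exact: rad_natM. Qed.

Lemma abs2M (z w : C) : abs2 (z * w) = abs2 z * abs2 w.
Proof. by rewrite -!nm_sqr nmM exprMn. Qed.

Lemma abs2_nat n : abs2 (n%:R : C) = n%:R ^+ 2.
Proof. by rewrite -nm_sqr nm_nat. Qed.

Lemma wsum_lift b N : wsum (blift b) N = ds b N.
Proof.
apply: eq_bigr => j _; rewrite /blift abs2M abs2_nat.
have key (x u : R) : x != 0 -> x ^+ 2 * u / x = x * u by move=> x0; field; rewrite ?x0.
by apply: key; rewrite pnatr_eq0.
Qed.

Lemma psum_lift b z : rad b -> nm z < 1 -> psum (blift b) z = psum b z + z * psum (dfs b) z.
Proof.
move=> rb z1; have rd := rad_dfs rb.
rewrite -psum_shift // -psumD //; last exact: rad_shift.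
by congr (psum _ z); apply/funext => -[|n]; rewrite /blift /shift /dfs ?addr0 ?mul1r // -natr1; ring.
Qed.

Lemma bshift_lift b : bshift (blift b) = dfs b.
Proof.
apply/funext => n; rewrite /bshift /blift /dfs mulrA; congr (_ * _).
rewrite -(rmorph_nat toR) -rmorphM -(rmorph_nat toR); congr (toR _).
by rewrite divfK // pnatr_eq0.
Qed.

Lemma ds_rad b (B : R) : (forall N, ds b N <= B) -> rad b.
Proof.
move=> h r /andP[r0 r1]; exists (1 + B) => n.
have t j : 0 <= j.+1%:R * abs2 (b j) by rewrite mulr_ge0 ?abs2_ge0.
have hn : nm (b n) ^+ 2 <= B.
  apply: le_trans (h n.+1); rewrite /ds big_ord_recr /= nm_sqr.
  apply: le_trans (_ : n.+1%:R * abs2 (b n) <= _); last by rewrite lerDr sumr_ge0.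
  by rewrite ler_peMl ?abs2_ge0 // ler1n.
have hh : nm (b n) <= 1 + B.
  by have := nm_ge0 (b n); have := sqr_ge0 (nm (b n) - 1); nra.
apply: le_trans (_ : nm (b n) * 1 <= _); last by rewrite mulr1.
by rewrite ler_wpM2l ?nm_ge0 // exprn_ile1 // ltW.
Qed.

Section Symbol.
Variables (p : C -> C) (B : R).
Hypotheses (hp : holo p) (pB : forall z, nm z < 1 -> nm (p z) <= B).
Local Notation T := (toeplitz (fun z => conjc z + p z)).

Lemma bergman_lift b K : (forall N, ds b N <= K) -> bergman (psum (blift b)).
Proof.
move=> h; have rb := ds_rad h.
by apply: (@bergman_coef _ _ (blift b) (rad_lift rb) _ K) => // N; rewrite wsum_lift.
Qed.

Lemma toeplitz_Lop b f : bergman f -> rad b -> (forall z, nm z < 1 -> f z = psum (blift b) z) ->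
  bergman (T f) /\ forall z, nm z < 1 -> T f z = Lop p b z.
Proof.
move=> bf rb fb; have [h1 h2] := toeplitzE hp pB bf (rad_lift rb) fb.
split => // z z1; rewrite h2 // bshift_lift fb // psum_lift // /Lop; ring.
Qed.

Lemma unlift f : bergman f ->
  exists b, rad b /\ forall z, nm z < 1 -> f z = psum (blift b) z.
Proof.
move=> /bergmanE [hf _]; have [a ra fa] := holo_psum hf.
exists (fun n => a n / n.+1%:R).
have e : blift (fun n => a n / n.+1%:R) = a.
  by apply/funext => n; rewrite /blift mulrC divfK // pnatr_eq0.
split; last by rewrite e.
apply: (@rad_le _ a _ 1) ra => n; rewrite nmM nmV nm_nat mul1r.
by rewrite ler_piMr ?nm_ge0 // invf_le1 ?ler1n.
Qed.

(** Invertibility on the side of coefficients. Solutions come with a norm bound, and injectivity is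
    asked of the sequences with bounded [ds], those that come from Bergman functions. *)
Definition solvable := exists c : R, [/\ 0 < c,
  forall g, bergman g -> exists b, (forall z, nm z < 1 -> Lop p b z = g z) /\
     forall N, kap * ds b N <= c * nD g &
  forall b K, (forall N, ds b N <= K) -> (forall z, nm z < 1 -> Lop p b z = 0) ->
     forall n, b n = 0].

Lemma ds_nD f b N : bergman f -> rad b -> (forall z, nm z < 1 -> f z = psum (blift b) z) ->
  kap * ds b N <= nD f.
Proof. by move=> bf rb fb; rewrite -wsum_lift; exact: (wsum_nD (rad_lift rb) fb). Qed.

Lemma nD_ge0 f : 0 <= nD f.
Proof. by rewrite fine_ge0 // sqnorm_ge0. Qed.

Lemma LopB b b' z : rad b -> rad b' -> nm z < 1 ->
  Lop p (fun n => b n - b' n) z = Lop p b z - Lop p b' z.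
Proof.
move=> rb rb' z1; rewrite /Lop psumB //.
rewrite (_ : dfs _ = fun n => dfs b n - dfs b' n); last first.
  by apply/funext => n; rewrite /dfs mulrBr.
by rewrite psumB //; try exact: rad_dfs; ring.
Qed.

Lemma dsB b b' N : ds (fun n => b n - b' n) N <= 2 * ds b N + 2 * ds b' N.
Proof.
rewrite /ds !mulr_sumr -big_split /=; apply: ler_sum => j _.
have := nm_sqrD (b j) (- b' j); rewrite nmN !nm_sqr => h.
have -> : 2 * (j.+1%:R * abs2 (b j)) + 2 * (j.+1%:R * abs2 (b' j)) =
  j.+1%:R * (2 * abs2 (b j) + 2 * abs2 (b' j)) by ring.
exact: ler_wpM2l.
Qed.

Lemma nD0 f : bergman f -> (forall z, nm z < 1 -> f z = 0) -> nD f = 0.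
Proof.
move=> bf h; have r0 : rad (fun _ : nat => 0 : C) by apply: (@rad_fin _ _ 0).
have h0 z : nm z < 1 -> f z = psum (fun _ => 0) z.
  by move=> z1; rewrite h // (@psum_fin _ _ _ 0) ?/psm ?big_ord0.
have /= := @sqnorm_parseval _ f _ r0 h0 0.
rewrite mulr0 nDE // lee_fin => le0.
apply/eqP; rewrite eq_le nD_ge0 andbT; apply: le0 => N.
rewrite /wsum big1 // => j _; by rewrite /abs2 /= expr0n addr0 mul0r.
Qed.

Lemma solvable_invertible : invertible_on_bergman T <-> solvable.
Proof.
have k0 := kap_gt0 R.
split.
  move=> [bT [S [bS [[c [c0 hc]] [ST TS]]]]].
  have hc' g : bergman g -> nD (S g) <= c * nD g.
    move=> bg; rewrite -lee_fin EFinM -!nDE //; [exact: hc|exact: bS].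
  exists c; split => //.
    move=> g bg; have [b [rb eb]] := unlift (bS _ bg).
    exists b; split.
      move=> z z1; have [_ <- //] := toeplitz_Lop (bS _ bg) rb eb.
      by apply: TS => //; apply/diskE.
    by move=> N; apply: le_trans (ds_nD N (bS _ bg) rb eb) (hc' _ bg).
  move=> b K hK L0 n.
  have bf := bergman_lift hK; have rb := ds_rad hK.
  have [bTf eT] := toeplitz_Lop bf rb (fun z _ => erefl).
  have n0 : nD (T (psum (blift b))) = 0.
    by apply: nD0 => // z z1; rewrite eT // L0.
  have s0 : nD (S (T (psum (blift b)))) = 0.
    apply/eqP; rewrite eq_le nD_ge0 andbT.
    by have := hc' _ bTf; rewrite n0 mulr0.
  have f0 z : nm z < 1 -> psum (blift b) z = 0.
    move=> z1; rewrite -(ST _ bf z (proj2 (diskE z) z1)); exact: (bergman_eq0 (bS _ bTf) s0 z1).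
  have := psum_inj0 (rad_lift rb) f0 n.
  by rewrite /blift => /eqP; rewrite mulf_eq0 pnatr_eq0 /= => /eqP.
move=> [c [c0 sol inj]].
split.
  by move=> f bf; have [b [rb fb]] := unlift bf; have [] := toeplitz_Lop bf rb fb.
(* The inverse operator is obtained by choice among bounded solutions, with the zero sequence as
   default value off the Bergman space. *)
have [s hs] : exists s : (C -> C) -> nat -> C, forall g, bergman g ->
    (forall z, nm z < 1 -> Lop p (s g) z = g z) /\ forall N, kap * ds (s g) N <= c * nD g.
  have h g : exists b : nat -> C, bergman g ->
      (forall z, nm z < 1 -> Lop p b z = g z) /\ forall N, kap * ds b N <= c * nD g.
    by case: (pselect (bergman g)) => [/sol [b hb]|nb]; [exists b|exists (fun _ => 0)].
  by have [s hs] := choice h; exists s.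
pose S g := psum (blift (s g)).
have dsb g : bergman g -> forall N, ds (s g) N <= c * nD g / kap.
  by move=> bg N; rewrite ler_pdivlMr // mulrC; have [_] := hs _ bg.
have bS g : bergman g -> bergman (S g) by move=> bg; exact: bergman_lift (dsb _ bg).
exists S; split=> //; split.
  exists c; split => // g bg; rewrite !nDE //; last exact: bS.
  rewrite -EFinM -nDE; last exact: bS.
  have rs := ds_rad (dsb _ bg).
  have -> : c * nD g = kap * (c * nD g / kap) by rewrite [RHS]mulrC divfK // gt_eqF.
  by apply: (@sqnorm_parseval _ _ _ (rad_lift rs) (fun z _ => erefl)) => N; rewrite wsum_lift; exact: dsb.
split.
  move=> f bf z /diskE z1.
  have [b [rb fb]] := unlift bf; have [bT eT] := toeplitz_Lop bf rb fb.
  have [h1 h2] := hs _ bT; have rs := ds_rad (dsb _ bT).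
  have d0 n : s (T f) n - b n = 0.
    apply: (inj (fun n => s (T f) n - b n) (2 * (c * nD (T f) / kap) + 2 * (nD f / kap))).
      move=> N; apply: le_trans (dsB _ _ _) _; apply: lerD.
        by rewrite ler_pM2l ?dsb.
      by rewrite ler_pM2l // ler_pdivlMr // mulrC; exact: ds_nD.
    by move=> u u1; rewrite LopB // h1 // eT // subrr.
  rewrite /S fb //; congr (psum (blift _) z); apply/funext => n.
  by apply/eqP; rewrite -subr_eq0 d0.
move=> g bg z /diskE z1.
have [h1 h2] := hs _ bg; have rs := ds_rad (dsb _ bg).
by have [_ ->] := toeplitz_Lop (bS _ bg) rs (fun z _ => erefl); rewrite ?h1.
Qed.

End Symbol.
End Reduction.

(** * The complex exponential, integrating factors and division by a linear factor *)

Section IntegratingFactor.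
Variable R : realType.
Local Notation C := (CC R).
Local Notation nm := (@Normc.normc R).
Local Notation toR := (real_complex R : R -> C).
Local Notation I := (Complex 0 1 : C).
Local Notation kap := (kap R).
Implicit Types (f g h p u : C -> C) (b : nat -> C) (z w : C).

Definition cexp z : C := toR (expR (complex.Re z)) * cis (complex.Im z).

Lemma cexpD z w : cexp (z + w) = cexp z * cexp w.
Proof.
rewrite /cexp ReD ImD expRD.
have -> : cis (complex.Im z + complex.Im w) = cis (complex.Im z) * cis (complex.Im w).
  by rewrite /cis cosD sinD; apply: complexP; rewrite ?ReM ?ImM /=; ring.
by rewrite rmorphM; ring.
Qed.

Lemma cexp0 : cexp 0 = 1.
Proof. by rewrite /cexp /= expR0 /cis cos0 sin0; apply: complexP; rewrite ?ReM ?ImM /=; ring. Qed.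

Lemma cexpN z : cexp z * cexp (- z) = 1.
Proof. by rewrite -cexpD subrr cexp0. Qed.

Lemma cexp_neq0 z : cexp z != 0.
Proof.
by apply/eqP => h; have := cexpN z; rewrite h mul0r => /eqP; rewrite eq_sym oner_eq0.
Qed.

Lemma nm_cexp z : nm (cexp z) <= expR (nm z).
Proof.
rewrite nmM nm_real nm_cis mulr1 ger0_norm ?expR_ge0 // ler_expR.
exact: le_trans (ler_norm _) (nm_Re z).
Qed.

Lemma nm_cexpV z : nm (cexp z)^-1 <= expR (nm z).
Proof.
have -> : (cexp z)^-1 = cexp (- z).
  by apply: (mulfI (cexp_neq0 z)); rewrite cexpN mulfV // cexp_neq0.
by apply: le_trans (nm_cexp _) _; rewrite nmN.
Qed.

Lemma cont_Rcomp (f : R -> C) (t : C -> R) z : {for z, continuous t} -> cont f (t z) ->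
  cont (fun w => f (t w)) z.
Proof. by move=> ct [cf]; split; exact: (@continuous_comp C R C t f z ct cf). Qed.

(** At 0 the Caratheodory factors of [expR] and [cis] combine into
    [cexp w - 1 - w = A w Re w + B w Im w] with [A] and [B] tending to 0; the addition formula
    carries this to every point. *)
Lemma cexp_cdf z : cdf cexp z (cexp z).
Proof.
have [phi [hphi cphi phi0]] := cder_expR (0 : R).
have [psi [hpsi cpsi psi0]] := cder_cis (0 : R).
have cre : {for (0 : C), continuous (fun z : C => complex.Re z)} by exact: continuous_Re.
have cim : {for (0 : C), continuous (fun z : C => complex.Im z)} by exact: continuous_Im.
pose A w := phi (complex.Re w) * cis (complex.Im w) - 1.
pose B w := psi (complex.Im w) - I.
have cA : cont A 0.
  apply: contB; last exact: cont_cst.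
  apply: contM; first exact: cont_Rcomp.
  by apply: cont_Rcomp => //; exact: cder_cont (cder_cis _).
have cB : cont B 0 by apply: contB; [exact: cont_Rcomp|exact: cont_cst].
have cis0 : cis (0 : R) = 1 by rewrite /cis cos0 sin0.
have A0 : A 0 = 0 by rewrite /A /= phi0 expR0 cis0 rmorph1 mulr1 subrr.
have B0 : B 0 = 0 by rewrite /B /= psi0 cis0 mulr1 subrr.
have id w : cexp w - 1 - w = A w * toR (complex.Re w) + B w * toR (complex.Im w).
  have h1 := hphi (complex.Re w); have h2 := hpsi (complex.Im w).
  rewrite expR0 rmorph1 rmorph0 subr0 in h1; rewrite cis0 rmorph0 subr0 in h2.
  have wE : w = toR (complex.Re w) + I * toR (complex.Im w).
    by apply: complexP; rewrite ?ReD ?ImD ?ReMr ?ImMr /=; ring.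
  have key (E S x y k l v : C) : E - 1 = k * x -> S - 1 = l * y -> v = x + I * y ->
      E * S - 1 - v = (k * S - 1) * x + (l - I) * y.
    move=> eE eS ->; have -> : E * S - 1 - (x + I * y) = (E - 1) * S + (S - 1) - x - I * y by ring.
    by rewrite eE eS; ring.
  exact: key.
apply/cdf_eps => e e0.
have D0 : 0 < e / (2 * nm (cexp z)).
  by rewrite divr_gt0 // mulr_gt0 // nm_gt0 cexp_neq0.
move: cA cB => [/contC/(_ _ D0) [r1 r10 h1]] [/contC/(_ _ D0) [r2 r20 h2]].
exists (Num.min r1 r2); first by rewrite lt_min r10.
move=> w; rewrite lt_min => /andP[w1 w2].
have -> : cexp w - cexp z - cexp z * (w - z) = cexp z * (cexp (w - z) - 1 - (w - z)).
  by rewrite !mulrBr -cexpD (addrC z) subrK mulr1.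
have hA := h1 (w - z); have hB := h2 (w - z); rewrite A0 B0 !subr0 in hA hB.
rewrite [nm (cexp z * _)]nmM id; have := lerD (ler_pM (nm_ge0 _) (normr_ge0 _) (ltW (hA w1)) (nm_Re (w - z)))
  (ler_pM (nm_ge0 _) (normr_ge0 _) (ltW (hB w2)) (nm_Im (w - z))).
move=> h; rewrite -mulrDl -!(nm_real (complex.Re _)) -!(nm_real (complex.Im _)) -!nmM in h.
apply: le_trans (ler_wpM2l (nm_ge0 _) (le_trans (nmD _ _) h)) _.
rewrite le_eqVlt; apply/orP; left; apply/eqP.
have key (x y : R) : x != 0 -> x * ((e / (2 * x) + e / (2 * x)) * y) = e * y.
  by move=> x0; field; rewrite ?x0.
by apply: key; rewrite nm_eq0 cexp_neq0.
Qed.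

Lemma radial_bound f (df : C -> C) (B : R) z :
  (forall w, nm w < 1 -> cdf f w (df w)) -> (forall w, nm w < 1 -> nm (df w) <= B) ->
  nm z < 1 -> nm (f z - f 0) <= B.
Proof.
move=> hd hB z1.
have tz t : 0 <= t <= 1 -> nm (toR t * z) < 1.
  move=> /andP[t0 t1]; rewrite nmM nm_real ger0_norm //.
  by apply: le_lt_trans z1; rewrite ler_piMl ?nm_ge0.
have ct t : cont toR t by split; exact: continuous_toR.
have := @cder_bound _ (fun t => f (toR t * z)) (fun t => df (toR t * z) * (1 * z + toR t * 0)) 0 1 B ler01.
rewrite rmorph1 mul1r rmorph0 mul0r subr0 mulr1; apply.
  move=> t t01; apply: cat_comp; [exact: ct| |exact: hd (tz _ t01)].
  by apply: cat_eq (catM (ct t) (cat_id _ t) (cat_cst _ z t)) _; rewrite mul1r.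
move=> t t01; rewrite mulr0 addr0 nmM.
apply: le_trans (_ : nm (df (toR t * z)) * 1 <= _); last by rewrite mulr1 hB // tz.
by rewrite ler_wpM2l ?nm_ge0 // ltW.
Qed.

Lemma holo_primitive (w : C -> C) : holo w -> exists W, forall z, nm z < 1 -> cdf W z (w z).
Proof.
move=> /holo_psum [a ra wa].
pose c n := a n / n.+1%:R.
have rc : rad c.
  apply: (@rad_le _ a _ 1) ra => n; rewrite nmM nmV nm_nat mul1r.
  by rewrite ler_piMr ?nm_ge0 // invf_le1 ?ler1n.
have e : dfs (shift c) = a.
  by apply/funext => n; rewrite /dfs /shift /c mulrC divfK // pnatr_eq0.
by exists (psum (shift c)) => z z1; have := psum_cdf (rad_shift rc) z1; rewrite e wa.
Qed.

(** [F] is the exponential of a primitive of [w] normalised at 0. The primitive is bounded by [B]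
    along radii, which bounds [F] and its inverse by [exp B]. *)
Lemma integrating_factor (w : C -> C) (B : R) : holo w -> (forall z, nm z < 1 -> nm (w z) <= B) ->
  exists F (K : R), [/\ forall z, nm z < 1 -> cdf F z (w z * F z),
    forall z, F z != 0, forall z, nm z < 1 -> nm (F z) <= K &
    forall z, nm z < 1 -> nm (F z)^-1 <= K].
Proof.
move=> hw hB; have [W hW] := holo_primitive hw.
exists (fun z => cexp (W z - W 0)), (expR B).
have b z : nm z < 1 -> nm (W z - W 0) <= B by move=> z1; exact: (radial_bound hW hB).
split.
- move=> z z1; apply: cat_eq (cat_comp (cont_id z) (catB (hW z z1) (cat_cst _ (W 0) z)) (cexp_cdf _)) _.
  by rewrite subr0 mulrC.
- by move=> z; exact: cexp_neq0.
- by move=> z /b h; apply: le_trans (nm_cexp _) _; rewrite ler_expR.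
- by move=> z /b h; apply: le_trans (nm_cexpV _) _; rewrite ler_expR.
Qed.

Lemma holo_div f (c : C) : holo f -> c != 0 -> nm c < 1 ->
  exists2 u, holo u & forall z, nm z < 1 -> f z = f c + (z - c) * u z.
Proof.
move=> /holo_psum [a ra fa] c0 c1; have [b rb hb] := psum_div ra c0 c1.
exists (psum b); first exact: psum_holo.
by move=> z z1; rewrite !fa // hb.
Qed.

Lemma cdf_inv (c : C) : c != 0 -> cdf (fun w => w^-1) c (- (c ^+ 2)^-1).
Proof.
move=> c0.
(* The value at 0 is dictated by the convention [0^-1 = 0], because the factorisation must hold at
   every point. *)
pose phi w := if w == 0 then c^-1 / c else - w^-1 / c.
have nc : 0 < nm c by rewrite nm_gt0.
have nz w : nm (w - c) < nm c -> w != 0.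
  by apply: contraTneq => ->; rewrite sub0r nmN ltxx.
exists phi; split.
- move=> w; rewrite /phi; case: eqVneq => [->|w0]; first by rewrite invr0; field.
  by field; rewrite w0 c0.
- have [h] : cont (fun w : C => - w^-1 / c) c.
    by apply: contM; [apply: contN; apply: contV => //; exact: cont_id|exact: cont_cst].
  move/contC : h => h; split; apply/contC => e /h [d d0 hd].
  exists (Num.min d (nm c)); first by rewrite lt_min d0.
  move=> w; rewrite lt_min => /andP[wd wc].
  by rewrite /phi (negbTE c0) (negbTE (nz _ wc)); exact: hd.
- by rewrite /phi (negbTE c0); field.
Qed.

Lemma holoV u : holo u -> (forall z, nm z < 1 -> u z != 0) -> holo (fun z => (u z)^-1).
Proof.
move=> hu u0 z z1; have [d hd] := hu z z1.
by eexists; apply: (cat_comp (cont_id z) hd); apply: cdf_inv; exact: u0.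
Qed.

(** Beyond a radius [r] strictly between [|c|] and 1 the factor [|z - c|] is at least [r - |c|];
    inside that radius compactness gives the bound. *)
Lemma bounded_div (w : C -> C) (c : C) (B : R) : holo w -> nm c < 1 ->
  (forall z, nm z < 1 -> nm ((z - c) * w z) <= B) ->
  exists K, forall z, nm z < 1 -> nm (w z) <= K.
Proof.
move=> hw c1 hB.
pose r := (1 + nm c) / 2; have n0 := nm_ge0 c.
have r0 : 0 < r by rewrite /r; lra.
have r1 : r < 1 by rewrite /r; lra.
have cr : nm c < r by rewrite /r; lra.
have [|K K0 hK] := @wcont_bounded _ (fun z => w (toR r * z)).
  move=> z z1; apply: cont_wcont; apply: cont_comp.
    by apply: contM; [exact: cont_cst|exact: cont_id].
  apply: holo_cont => //; rewrite nmM nm_real (gtr0_norm r0).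
  by apply: le_lt_trans r1; rewrite ler_piMr // ltW.
have B0 : 0 <= B by apply: le_trans (nm_ge0 _) (hB 0 _); rewrite nm0.
exists (K + B / (r - nm c)) => z z1.
have d0 : 0 < r - nm c by rewrite subr_gt0.
case: (leP (nm z) r) => zr.
  have := hK (z / toR r); rewrite (mulrC (toR r)) divfK; last by rewrite -nm_gt0 nm_real gtr0_norm.
  rewrite nmM nmV nm_real gtr0_norm // ler_pdivrMr // mul1r => /(_ zr) /le_trans; apply.
  by rewrite lerDl divr_ge0 // ltW.
have zc : r - nm c <= nm (z - c).
  by rewrite lerBlDr (le_trans (ltW zr)) // (le_trans _ (nmD _ _)) // subrK.
apply: le_trans (_ : B / (r - nm c) <= _); last by rewrite lerDr ltW.
rewrite ler_pdivlMr // mulrC; apply: le_trans (hB z z1).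
by rewrite nmM ler_wpM2r ?nm_ge0.
Qed.

Lemma bergman1 : bergman (fun _ : C => 1).
Proof.
pose a n : C := if n == 0%N then 1 else 0.
have ra : rad a by apply: (@rad_fin _ _ 1) => -[|n].
have ea z : nm z < 1 -> 1 = psum a z.
  move=> z1; rewrite (@psum_fin _ _ _ 1) //; last by case.
  by rewrite /psm big_ord1 expr0 mulr1.
apply: (bergman_coef ra ea (B := 1)) => N.
case: N => [|N]; first by rewrite /wsum big_ord0.
rewrite /wsum big_ord_recl big1 ?addr0; last by move=> j _; rewrite /a /abs2 /= expr0n addr0 mul0r.
by rewrite /a /abs2 /= expr0n expr1n addr0 divr1.
Qed.

Lemma bergman_bounded u (B : R) : holo u -> (forall z, nm z < 1 -> nm (u z) <= B) -> bergman u.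
Proof.
move=> hu hB; apply: bergman_ext (bergmanM hu hB bergman1) => z _; exact: mulr1.
Qed.

Section Dirichlet.
Variables (G dG : C -> C) (b : nat -> C).
Hypotheses (rb : rad b) (Gb : forall z, nm z < 1 -> G z = psum b z).

Lemma dG_dfs : (forall z, nm z < 1 -> cdf G z (dG z)) ->
  forall z, nm z < 1 -> dG z = psum (dfs b) z.
Proof.
move=> hG z z1; apply: (cdf_uniq (hG z z1)).
apply: (@cdf_near _ (psum b) _ _ _ (1 - nm z)); rewrite ?subr_gt0 //; last exact: psum_cdf.
move=> w hw; rewrite Gb //.
by rewrite -(subrK z w) (le_lt_trans (nmD _ _)) // -ltrBrDr.
Qed.

(** The weight [j+2] of [ds] at index [j+1] is at most twice the weight [j+1] that the derivative
    gives to [b_(j+1)]; the constant term is paid by the norm of [G]. *)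
Lemma ds_le : (forall z, nm z < 1 -> cdf G z (dG z)) -> bergman G -> bergman dG ->
  forall N, kap * ds b N <= nD G + 2 * nD dG.
Proof.
move=> hG bG bdG N; have k0 := kap_gt0 R.
have h1 := wsum_nD rb Gb 1 bG.
have h2 := wsum_nD (rad_dfs rb) (dG_dfs hG) N bdG.
have : ds b N <= wsum b 1 + 2 * wsum (dfs b) N.
  apply: (@le_trans _ _ (ds b N.+1)).
    by rewrite /ds big_ord_recr /= lerDl mulr_ge0 ?abs2_ge0.
  rewrite /ds big_ord_recl /wsum big_ord1 mul1r divr1 lerD2l mulr_sumr.
  apply: ler_sum => j _; rewrite lift0 /dfs abs2M abs2_nat.
  have key (x u : R) : x != 0 -> 2 * (x ^+ 2 * u / x) = (2 * x) * u.
    by move=> x0; field; rewrite ?x0.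
  rewrite key ?pnatr_eq0 // ler_wpM2r ?abs2_ge0 //.
  by rewrite -natrM ler_nat; lia.
move=> h; have := ler_wpM2l (ltW k0) h; rewrite mulrDr => h'.
by apply: le_trans h' _; lra.
Qed.

End Dirichlet.

Lemma nD_psum b (K : R) : (forall N, ds b N <= K) ->
  [/\ bergman (psum b), nD (psum b) <= kap * K,
      bergman (psum (dfs b)) & nD (psum (dfs b)) <= kap * K].
Proof.
move=> hK; have rb := ds_rad hK; have rd := rad_dfs rb.
have h1 N : wsum b N <= K.
  apply: le_trans (hK N); apply: ler_sum => j _.
  rewrite ler_pdivrMr // mulrAC -expr2 ler_peMl ?abs2_ge0 //.
  by rewrite expr_ge1 // ler1n.
have h2 N : wsum (dfs b) N <= K.
  apply: le_trans (hK N.+1); rewrite /ds big_ord_recl -[leLHS]add0r lerD //.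
    by rewrite mulr_ge0 ?abs2_ge0.
  apply: ler_sum => j _; rewrite lift0 /dfs abs2M abs2_nat.
  have key (x u : R) : x != 0 -> x ^+ 2 * u / x = x * u.
    by move=> x0; field; rewrite ?x0.
  by rewrite key ?pnatr_eq0 // ler_wpM2r ?abs2_ge0 // ler_nat.
have b1 := bergman_coef rb (fun z _ => erefl) h1.
have b2 := bergman_coef rd (fun z _ => erefl) h2.
split => //.
  by rewrite -lee_fin -nDE //; exact: (sqnorm_parseval rb (fun z _ => erefl)).
by rewrite -lee_fin -nDE //; exact: (sqnorm_parseval rd (fun z _ => erefl)).
Qed.

End IntegratingFactor.

(** * Norm inequalities in real form, finite sequences and the harmonic series *)

Section NormLemmas.
Variable R : realType.
Local Notation C := (CC R).
Local Notation nm := (@Normc.normc R).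
Local Notation kap := (kap R).
Implicit Types (f g h p u : C -> C) (b : nat -> C) (z w : C).

Lemma nD_le2 f g h (a b : R) : holo f -> bergman g -> bergman h -> 0 <= a -> 0 <= b ->
  (forall z, nm z < 1 -> nm (f z) ^+ 2 <= a * nm (g z) ^+ 2 + b * nm (h z) ^+ 2) ->
  bergman f /\ nD f <= a * nD g + b * nD h.
Proof.
move=> hf bg bh a0 b0 le; have bf := bergman_le2 hf bg bh a0 b0 le; split => //.
have [hg _] := proj1 (bergmanE g) bg; have [hh _] := proj1 (bergmanE h) bh.
by have := sqnorm_le2 hf hg hh a0 b0 le; rewrite !nDE // -!EFinM -EFinD lee_fin.
Qed.

Lemma nDM u f (B : R) : holo u -> (forall z, nm z < 1 -> nm (u z) <= B) -> bergman f ->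
  bergman (fun z => u z * f z) /\ nD (fun z => u z * f z) <= B ^+ 2 * nD f.
Proof.
move=> hu hB bf; have bu := bergmanM hu hB bf; split => //.
have [hf _] := proj1 (bergmanE f) bf.
by have := sqnormM hu hf hB; rewrite !nDE // -EFinM lee_fin.
Qed.

Lemma half_absorb (x y : R) : y * 2 < x -> x <= x / 2 + y -> False.
Proof. lra. Qed.

Lemma bergman_holo f : bergman f -> holo f.
Proof. by move=> /bergmanE []. Qed.

Lemma nDD f g : bergman f -> bergman g -> nD (fun z => f z + g z) <= 2 * nD f + 2 * nD g.
Proof.
move=> bf bg.
have [|_ //] := nD_le2 (holoD (bergman_holo bf) (bergman_holo bg)) bf bg (ler0n _ 2) (ler0n _ 2).
by move=> z _; exact: nm_sqrD.
Qed.

Lemma sum_fin (t : nat -> R) N M : (forall j, (N <= j)%N -> t j = 0) -> (forall j, 0 <= t j) ->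
  \sum_(j < M) t j <= \sum_(j < N) t j.
Proof.
move=> t0 tp.
have mono n m : (n <= m)%N -> \sum_(j < n) t j <= \sum_(j < m) t j.
  elim: m => [|m IH]; first by rewrite leqn0 => /eqP ->.
  rewrite leq_eqVlt => /orP[/eqP -> //|]; rewrite ltnS => /IH h.
  by rewrite big_ord_recr /= (le_trans h) // lerDl.
case: (leqP M N) => [/mono //|/ltnW NM].
rewrite -(subnKC NM); elim: (M - N)%N => [|k IH]; first by rewrite addn0.
by rewrite addnS big_ord_recr /= t0 ?leq_addr // addr0.
Qed.

Lemma ds_fin b N : (forall j, (N <= j)%N -> b j = 0) -> forall M, ds b M <= ds b N.
Proof.
move=> b0 M; apply: (@sum_fin (fun j => j.+1%:R * abs2 (b j))) => j.
  by move=> /b0 ->; rewrite /abs2 /= expr0n addr0 mulr0.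
by rewrite mulr_ge0 ?abs2_ge0.
Qed.

Lemma wsum_fin b N : (forall j, (N <= j)%N -> b j = 0) -> forall M, wsum b M <= wsum b N.
Proof.
move=> b0 M; apply: (@sum_fin (fun j => abs2 (b j) / j.+1%:R)) => j.
  by move=> /b0 ->; rewrite /abs2 /= expr0n addr0 mul0r.
by rewrite divr_ge0 ?abs2_ge0.
Qed.

Lemma nD_wsum b (K : R) : rad b -> (forall N, wsum b N <= K) ->
  bergman (psum b) /\ nD (psum b) <= kap * K.
Proof.
move=> rb hK; have bb := bergman_coef rb (fun z _ => erefl) hK; split => //.
by rewrite -lee_fin -nDE //; exact: (sqnorm_parseval rb (fun z _ => erefl)).
Qed.

Lemma harmonic_unbounded (K : R) : exists N, K < \sum_(j < N) j.+1%:R^-1.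
Proof.
apply: contrapT => h; apply: (@dvg_harmonic R).
apply: nondecreasing_is_cvgn.
  by apply: nondecreasing_series => n _ _; rewrite /harmonic /= invr_ge0.
exists K => _ [N _ <-]; rewrite /series /= big_mkord leNgt; apply/negP => hK.
by apply: h; exists N.
Qed.

End NormLemmas.

(** * Necessary conditions *)

Section Necessity.
Variable R : realType.
Local Notation C := (CC R).
Local Notation nm := (@Normc.normc R).
Local Notation kap := (kap R).
Implicit Types (f g h u : C -> C) (b : nat -> C) (z w : C).
Variables (p : C -> C) (B : R).
Hypotheses (hp : holo p) (pB : forall z, nm z < 1 -> nm (p z) <= B).

Let B0 : 0 <= B. Proof. by apply: le_trans (nm_ge0 _) (pB (z := 0) _); rewrite nm0. Qed.
Definition qf z := 1 + z * p z.

Lemma holo_qf : holo qf.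
Proof. by apply: holoD; [exact: holo_cst|apply: holoM => //; exact: holo_id]. Qed.

Lemma qf_bound z : nm z < 1 -> nm (qf z) <= 1 + B.
Proof.
move=> z1; apply: le_trans (nmD _ _) _; rewrite nm1 lerD2l nmM -[leRHS]mul1r.
exact: ler_pM (nm_ge0 _) (nm_ge0 _) (ltW z1) (pB z1).
Qed.

Lemma bergman_Lop b (K : R) : (forall N, ds b N <= K) -> bergman (Lop p b).
Proof.
move=> /nD_psum [b1 _ b2 _]; apply: bergmanD.
  exact: (bergmanM holo_qf qf_bound b2).
exact: bergmanM hp pB b1.
Qed.

(** The bounded solution for the right hand side [Lop p b] must be [b] itself, by injectivity. *)
Lemma solvable_below : solvable p -> exists2 c, 0 < c &
  forall b K, (forall N, ds b N <= K) -> forall N, kap * ds b N <= c * nD (Lop p b).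
Proof.
move=> [c [c0 hs hi]]; exists c => // b K hK N.
have [b' [e hb']] := hs _ (bergman_Lop hK).
have k0 := kap_gt0 R.
have hK' n : ds b' n <= c * nD (Lop p b) / kap by rewrite ler_pdivlMr // mulrC.
have bb n : b n = b' n.
  apply/eqP; rewrite -subr_eq0; apply/eqP.
  apply: (hi (fun n => b n - b' n) (2 * K + 2 * (c * nD (Lop p b) / kap))).
    move=> m; apply: le_trans (dsB _ _ _) _.
    by rewrite lerD // ler_wpM2l.
  move=> z z1; rewrite LopB ?e ?subrr //; [exact: (ds_rad hK)|exact: (ds_rad hK')].
have -> : ds b N = ds b' N by apply: eq_bigr => j _; rewrite bb.
exact: hb'.
Qed.

(** The value at 0 is enough for a contradiction: the kernel elements constructed later do not
    vanish there. *)
Lemma solvable_ker (G dG : C -> C) : solvable p ->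
  (forall z, nm z < 1 -> cdf G z (dG z)) -> bergman G -> bergman dG ->
  (forall z, nm z < 1 -> qf z * dG z + p z * G z = 0) -> G 0 = 0.
Proof.
move=> [c [c0 _ hi]] hG bG bdG LG.
have [b rb Gb] := holo_psum (bergman_holo bG).
have h := ds_le rb Gb hG bG bdG; have k0 := kap_gt0 R.
rewrite Gb ?nm0 // psum0 //; apply: (hi b ((nD G + 2 * nD dG) / kap)).
  by move=> N; rewrite ler_pdivlMr // mulrC.
by move=> z z1; rewrite /Lop -(dG_dfs rb Gb hG) // -Gb // LG.
Qed.

(** * A zero of [q] on the circle *)

Section Circle.
Variable zt : C.
Hypotheses (zt1 : nm zt = 1) (wq : wcont qf zt) (qzt : qf zt = 0).

Let cz : C := conjc zt.
Let ncz : nm cz = 1. Proof. by rewrite /cz nm_conj. Qed.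

Lemma nm_circle w : nm (1 - cz * w) = nm (w - zt).
Proof.
have e : cz * zt = 1.
  by rewrite /cz mulrC abs2E -nm_sqr zt1 expr1n.
by rewrite -e -mulrBr nmM ncz mul1r nmBC.
Qed.

(** Near [zt] continuity gives [e]; at distance at least [d] from [zt] the bound [1 + B] is at most
    [(1 + B)/d] times that distance. *)
Lemma qf_near_circle (e : R) : 0 < e -> exists2 K, 0 <= K &
  forall w, nm w < 1 -> nm (qf w) <= e + K * nm (1 - cz * w).
Proof.
move=> e0; have [d d0 hd] := proj1 (wcont_eps qf zt) wq e e0.
have K0 : 0 <= (1 + B) / d by rewrite divr_ge0 ?addr_ge0 // ltW.
exists ((1 + B) / d) => // w w1; rewrite nm_circle.
have [h|h] := ltP (nm (w - zt)) d.
  have := hd w h (ltW w1); rewrite qzt subr0 => /ltW /le_trans; apply.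
  by rewrite lerDl mulr_ge0 ?nm_ge0.
apply: le_trans (qf_bound w1) _; rewrite -[leLHS]add0r lerD ?(ltW e0) //.
by rewrite mulrAC ler_pdivlMr // ler_wpM2l // addr_ge0.
Qed.

(** Coefficients of the [G] that vanishes at 0 and whose derivative is the truncated geometric
    sum. *)
Let gb N n : C := if n is m.+1 then (if (m < N)%N then cz ^+ m / m.+1%:R else 0) else 0.

Let gb_fin N j : (N.+1 <= j)%N -> gb N j = 0.
Proof. by case: j => // j; rewrite ltnS /gb ltnNge => ->. Qed.

Let gb_abs N m : (m < N)%N -> abs2 (gb N m.+1) = (m.+1%:R ^+ 2)^-1.
Proof.
by move=> h; rewrite -nm_sqr /gb h nmM nmX nmV ncz expr1n mul1r nm_nat exprVn.
Qed.

Let gb_dfs N m : dfs (gb N) m = if (m < N)%N then cz ^+ m else 0.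
Proof.
rewrite /dfs /gb; case: ifP => _; last by rewrite mulr0.
by rewrite mulrC divfK // pnatr_eq0.
Qed.

Let H N : R := \sum_(j < N) j.+1%:R^-1.

Let ds_gb N : H N <= ds (gb N) N.+1.
Proof.
rewrite /ds big_ord_recl [X in X + _](_ : _ = 0) ?add0r; last first.
  by rewrite /abs2 /= expr0n addr0 mulr0.
apply: ler_sum => j _; rewrite lift0 gb_abs //.
have key (x y : R) : 0 < x -> x <= y -> x^-1 <= y / x ^+ 2.
  move=> x0 xy; rewrite ler_pdivlMr ?exprn_gt0 // expr2 mulKf // gt_eqF //.
by apply: key; rewrite ?ltr0n // ler_nat.
Qed.

(** The norm of [G] itself stays bounded in [N]. The induction uses the telescoping bound
    [1/(m^2 (m+1)) <= 1/m - 1/(m+1)]. *)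
Let wsum_gb N M : wsum (gb N) M <= 1.
Proof.
have h n : wsum (gb N) n.+1 <= 1 - n.+1%:R^-1.
  elim: n => [|n IH].
    by rewrite /wsum big_ord1 /= invr1 subrr /abs2 /= expr0n addr0 mul0r.
  rewrite /wsum big_ord_recr -[nat_of_ord _]/n.+1; apply: le_trans (lerD IH (_ : _ <= n.+1%:R^-1 - n.+2%:R^-1)) _.
    have key (x : R) : 0 < x -> (x + 1)^-1 = x^-1 - x^-1 / (x + 1).
      by move=> x0; field; rewrite !gt_eqF // addr_gt0.
    have x1 : 1 <= n.+1%:R :> R by rewrite ler1n.
    have x0 : 0 < n.+1%:R :> R by rewrite ltr0n.
    rewrite -(natr1 n.+1) {2}(key n.+1%:R) // opprB addrCA subrr addr0.
    rewrite ler_wpM2r ?invr_ge0 ?addr_ge0 ?(ltW x0) //.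
    have [h|h] := ltnP n N; last by rewrite gb_fin // /abs2 /= expr0n addr0 invr_ge0.
    by rewrite gb_abs // lef_pV2 ?posrE ?exprn_gt0 // expr2 ler_peMl // ltW.
  by rewrite addrA subrK.
apply: le_trans (wsum_mono (gb N) (leqnSn M)) _; apply: le_trans (h M) _.
by rewrite gerBl invr_ge0.
Qed.

Let wsum_dgb N M : wsum (dfs (gb N)) M <= H N.
Proof.
apply: le_trans (@wsum_fin _ _ N _ M) _.
  by move=> j; rewrite gb_dfs ltnNge => ->.
apply: ler_sum => j _; rewrite gb_dfs ltn_ord -nm_sqr nmX ncz !expr1n div1r //.
Qed.

Let gb_geo N z : nm z < 1 -> (1 - cz * z) * psum (dfs (gb N)) z = 1 - (cz * z) ^+ N.
Proof.
move=> z1; rewrite (@psum_fin _ _ _ N) // => [|n]; last by rewrite gb_dfs ltnNge => ->.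
have -> : psm (dfs (gb N)) N z = \sum_(j < N) (cz * z) ^+ j.
  by apply: eq_bigr => j _; rewrite gb_dfs ltn_ord exprMn.
have h := subrX1 (cz * z) N; have -> : 1 - (cz * z) ^+ N = - ((cz * z) ^+ N - 1) by ring.
by rewrite h; ring.
Qed.

Lemma circle_not_solvable : ~ solvable p.
Proof.
move=> /solvable_below [c c0 hc]; have k0 := kap_gt0 R.
(* With this [e] the term [4 c e^2 kap (H N)] equals half of [kap (H N)] and is absorbed on the
   left. *)
pose e := Num.sqrt (8 * c)^-1.
have e2 : e ^+ 2 = (8 * c)^-1 by rewrite sqr_sqrtr // invr_ge0 mulr_ge0 // ltW.
have e0 : 0 < e by rewrite sqrtr_gt0 invr_gt0 mulr_gt0.
have [K K0 hK] := qf_near_circle e0.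
(* [N] is chosen so that the remaining half of [kap (H N)] exceeds the terms independent of [N]: one
   from [K] and the bounded function [1 - (cz z)^N], one from [p G]. *)
have [N hN] := harmonic_unbounded ((16 * c * K ^+ 2 * nD (fun _ : C => 1) + 2 * c * (B ^+ 2 * kap)) * 2 / kap).
have dsb := ds_fin (@gb_fin N).
have [b1 n1 b2 n2] := nD_psum dsb; have rb := ds_rad dsb.
have [_ w1] := nD_wsum rb (wsum_gb N).
have [_ w2] := nD_wsum (rad_dfs rb) (wsum_dgb N).
set h := psum (dfs (gb N)) in b2 n2 w2.
have [bq nq] : bergman (fun z => qf z * h z) /\
    nD (fun z => qf z * h z) <= (2 * e ^+ 2) * nD h + (8 * K ^+ 2) * nD (fun _ : C => 1).
  apply: nD_le2 => //.
  - by apply: holoM; [exact: holo_qf|exact: bergman_holo].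
  - exact: bergman1.
  - by rewrite mulr_ge0 // sqr_ge0.
  - by rewrite mulr_ge0 // sqr_ge0.
  move=> z z1; rewrite nm1 expr1n mulr1 [nm (_ * h z)]nmM.
  have h1 : nm (qf z) * nm (h z) <= e * nm (h z) + K * 2.
    apply: le_trans (ler_wpM2r (nm_ge0 _) (hK z z1)) _.
    rewrite mulrDl lerD2l -mulrA ler_wpM2l // -nmM gb_geo //.
    apply: le_trans (nmB _ _) _; rewrite nm1 nmX nmM ncz mul1r -[2]/(1 + 1) lerD2l.
    by rewrite exprn_ile1 ?nm_ge0 // ltW.
  have h0 : 0 <= nm (qf z) * nm (h z) by rewrite mulr_ge0 ?nm_ge0.
  have key (x a d : R) : 0 <= x -> x <= a + d -> x ^+ 2 <= 2 * a ^+ 2 + 2 * d ^+ 2.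
    move=> x0 xd; have : x ^+ 2 <= (a + d) ^+ 2 by rewrite lerXn2r // nnegrE // (le_trans x0).
    move/le_trans; apply; rewrite -subr_ge0 (_ : _ - _ = (a - d) ^+ 2) ?sqr_ge0 //; ring.
  have := key _ _ _ h0 h1; rewrite !exprMn; move/le_trans; apply.
  by rewrite le_eqVlt; apply/orP; left; apply/eqP; ring.
have [bp np] := nDM hp pB b1.
have := hc _ _ dsb N.+1; have := ds_gb N.
have := nDD bq bp; rewrite -[nD (fun z => _ + _)]/(nD (Lop p (gb N))).
rewrite ltr_pdivrMr // in hN; rewrite -/(H N) in hN.
move: nq np w1 w2 hN; rewrite e2; set L := nD (Lop _ _); set D := ds _ _.
set x := nD h; set y := nD (psum _); set t := nD (fun z => qf z * h z); set s := nD (fun z => p z * _).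
set o := nD _; move=> nq np w1 w2 hN hL hD hcc.
have a1 : kap * H N <= c * L by apply: le_trans hcc; rewrite ler_wpM2l // ltW.
have a2 : L <= 2 * (2 * (8 * c)^-1 * (kap * H N) + 8 * K ^+ 2 * o) + 2 * (B ^+ 2 * (kap * 1)).
  apply: le_trans hL _; rewrite lerD // ler_wpM2l //.
    apply: le_trans nq _; rewrite lerD2r ler_wpM2l //.
    by rewrite mulr_ge0 // invr_ge0 mulr_ge0 // ltW.
  by apply: le_trans np _; rewrite ler_wpM2l // sqr_ge0.
have a3 := le_trans a1 (ler_wpM2l (ltW c0) a2).
have e4 : c * (2 * (2 * (8 * c)^-1 * (kap * H N) + 8 * K ^+ 2 * o) + 2 * (B ^+ 2 * (kap * 1))) =
  kap * H N / 2 + (16 * c * K ^+ 2 * o + 2 * c * (B ^+ 2 * kap)).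
  by field; rewrite gt_eqF.
rewrite e4 in a3; move: hN a3; rewrite (mulrC (H N)).
exact: half_absorb.
Qed.

End Circle.

End Necessity.

(** * The zero-free case, the normal form at a simple zero and resonance *)

Section NormalForm.
Variable R : realType.
Local Notation C := (CC R).
Local Notation nm := (@Normc.normc R).
Implicit Types (f g h u w F : C -> C) (b : nat -> C) (z : C).
Variables (p : C -> C) (B : R).
Hypotheses (hp : holo p) (pB : forall z, nm z < 1 -> nm (p z) <= B).
Hypothesis wp : forall z, nm z <= 1 -> wcont p z.
Local Notation qf := (qf p).

Lemma qf_wcont z : nm z <= 1 -> wcont qf z.
Proof.
move=> z1; apply: wcontD; first exact: wcont_cst.
by apply: wcontM; [exact: wcont_id|exact: wp].
Qed.

Lemma cdf_inv_factor w F : (forall z, nm z < 1 -> cdf F z (w z * F z)) ->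
  (forall z, F z != 0) ->
  (forall z, nm z < 1 -> cdf (fun z => (F z)^-1) z (- (w z / F z))).
Proof.
move=> hF F0 z z1.
apply: cat_eq (cat_comp (cont_id z) (hF z z1) (cdf_inv (F0 z))) _.
by have := F0 z; move=> h; field.
Qed.

(** Compactness bounds [1/q], so the integrating factor [F] of [p/q] has a bounded inverse [G]. Then
    [G] and [G' = - (p/q) G] are Bergman functions, and [G] does not vanish at 0. *)
Lemma zero_free_not_solvable : (forall z, nm z <= 1 -> qf z != 0) -> ~ solvable p.
Proof.
move=> q0 hs; have [L L0 hL] := wcont_lower qf_wcont q0.
have hw : holo (fun z => p z * (qf z)^-1).
  apply: holoM => //; apply: holoV; first exact: holo_qf.
  by move=> z z1; rewrite q0 // ltW.
have wB z : nm z < 1 -> nm (p z * (qf z)^-1) <= B * L.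
  by move=> z1; rewrite nmM; apply: ler_pM (nm_ge0 _) (nm_ge0 _) (pB z1) (hL _ (ltW z1)).
have [F [K [hF F0 FK FVK]]] := integrating_factor hw wB.
have hG := cdf_inv_factor hF F0.
have holG : holo (fun z => (F z)^-1) by move=> z z1; exists (- (p z * (qf z)^-1 / F z)); exact: hG.
have bG := bergman_bounded holG FVK.
have bdG : bergman (fun z => - (p z * (qf z)^-1 / F z)).
  by apply: bergmanN; exact: bergmanM hw wB bG.
suff : (F 0)^-1 = 0 by move=> /eqP; rewrite invr_eq0 (negbTE (F0 0)).
apply: (solvable_ker hs hG bG bdG) => z z1.
by have q1 := q0 z (ltW z1); have f1 := F0 z; field; rewrite q1 f1.
Qed.

Variables (z0 dq : C).
Hypotheses (z01 : nm z0 < 1) (q0 : qf z0 = 0) (hdq : cdf qf z0 dq).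

(** The bounds make [G = H / F] an isomorphism of the domain and multiplication by [u / F] one of
    the Bergman space, so that only the operator on [H] remains to be inverted. *)
Record nform (al : C) u w F (K : R) : Prop := NForm {
  nf_u : holo u; nf_w : holo w;
  nf_F : forall z, nm z < 1 -> cdf F z (w z * F z);
  nf_u0 : forall z, nm z < 1 -> u z != 0; nf_F0 : forall z, F z != 0;
  nf_uK : forall z, nm z < 1 -> nm (u z) <= K; nf_uV : forall z, nm z < 1 -> nm (u z)^-1 <= K;
  nf_FK : forall z, nm z < 1 -> nm (F z) <= K; nf_FV : forall z, nm z < 1 -> nm (F z)^-1 <= K;
  nf_wK : forall z, nm z < 1 -> nm (w z) <= K;
  nf_q : forall z, nm z < 1 -> qf z = (z - z0) * u z;
  nf_p : forall z, nm z < 1 -> p z = u z * ((z - z0) * w z - al) }.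

Lemma z0_neq0 : z0 != 0.
Proof.
apply/eqP => h; have : 1 + z0 * p z0 = 0 := q0.
by rewrite h mul0r addr0 => /eqP; rewrite oner_eq0.
Qed.

Lemma p_z0 : p z0 = - z0^-1.
Proof.
apply: (mulfI z0_neq0); rewrite mulrN mulfV ?z0_neq0 //.
by apply/eqP; rewrite -addr_eq0 addrC; apply/eqP; exact: q0.
Qed.

Hypotheses (dq0 : dq != 0) (uniq0 : forall z, nm z < 1 -> qf z = 0 -> z = z0)
  (circ : forall z, nm z = 1 -> qf z != 0).

Lemma normal_form : exists u w F K, nform (z0 * dq)^-1 u w F K.
Proof.
have [u hu qu'] := holo_div (holo_qf hp) z0_neq0 z01.
have qu z : nm z < 1 -> qf z = (z - z0) * u z by move=> /qu'; rewrite q0 add0r.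
have ez0 : u z0 = dq.
  have [d hd] := hu z0 z01.
  have h := catM (cont_id z0) (catB (cat_id id z0) (cat_cst id z0 z0)) hd.
  apply: (cdf_uniq _ hdq); apply: (@cdf_near _ (fun y => (y - z0) * u y) _ _ _ (1 - nm z0)).
  - by rewrite subr_gt0.
  - by move=> w hw; rewrite qu // -(subrK z0 w) (le_lt_trans (nmD _ _)) // -ltrBrDr.
  by apply: cat_eq h _; rewrite subrr mul0r addr0 subr0 mul1r.
have u0 z : nm z < 1 -> u z != 0.
  move=> z1; apply/eqP => h; move: dq0; rewrite -ez0 -(uniq0 z1) ?h ?eqxx //.
  by rewrite qu // h mulr0.
have [K1 hK1] : exists K, forall z, nm z < 1 -> nm (u z) <= K.
  by apply: (bounded_div hu z01 (B := 1 + B)) => z z1; rewrite -qu // (qf_bound pB).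
have [K2 hK2] : exists K, forall z, nm z < 1 -> nm (u z)^-1 <= K.
  (* [u] is extended to the circle by the quotient [q / (z - z0)]. The extension is continuous and
     has no zero on the closed disk, so compactness bounds its inverse. *)
  pose U z := if nm z < 1 then u z else qf z / (z - z0).
  have qz z : nm z <= 1 -> z != z0 -> U z = qf z / (z - z0).
    move=> z1 zz; rewrite /U; case: ifP => // h.
    by rewrite qu // mulrAC mulfV ?mul1r // subr_eq0.
  have [||K _ hK] := @wcont_lower _ U.
  - move=> z z1; have [zl|zg] := ltP (nm z) 1.
      apply: (@wcont_near _ u _ _ (1 - nm z)); rewrite ?subr_gt0 //; last exact: holo_wcont.
      move=> w hw _; rewrite /U ifT //.
      by rewrite -(subrK z w) (le_lt_trans (nmD _ _)) // -ltrBrDr.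
    have zz (w : C) : nm (w - z) < 1 - nm z0 -> w != z0.
      apply: contraTneq => ->; rewrite -leNgt lerBlDr.
      by rewrite (le_trans zg) // -nmBC -{1}(subrK z0 z) nmD.
    apply: (@wcont_near _ (fun w : C => qf w / (w - z0)) _ _ (1 - nm z0)); rewrite ?subr_gt0 //.
      by move=> w hw w1; rewrite qz // zz.
    apply: wcontM; first exact: qf_wcont.
    apply: wcontV; last by apply: wcontD; [exact: wcont_id|exact: wcont_cst].
    by rewrite subr_eq0 zz // subrr nm0 subr_gt0.
  - move=> z z1; rewrite /U; case: ifPn => [/u0 //|h].
    rewrite mulf_neq0 //; first by apply: circ; apply/eqP; rewrite eq_le z1 leNgt.
    by rewrite invr_eq0 subr_eq0; apply: contraNneq h => ->.
  by exists K => z z1; have := hK z (ltW z1); rewrite /U z1.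
have hpu : holo (fun z => p z * (u z)^-1) by apply: holoM => //; exact: holoV.
have [w hw wE] := holo_div hpu z0_neq0 z01.
(* Origin of [al]: [p z0 = - z0^-1] because [z0] is a zero of [q], and [u z0] is the derivative of
   [q] at [z0]. *)
have e0 : p z0 * (u z0)^-1 = - (z0 * dq)^-1 by rewrite p_z0 ez0 invfM mulNr.
have pE z : nm z < 1 -> p z = u z * ((z - z0) * w z - (z0 * dq)^-1).
  move=> z1; rewrite addrC -e0 -wE // mulrC divfK // u0 //.
have [K3 hK3] : exists K, forall z, nm z < 1 -> nm (w z) <= K.
  apply: (bounded_div hw z01 (B := B * K2 + nm (- (z0 * dq)^-1))) => z z1.
  have -> : (z - z0) * w z = p z * (u z)^-1 - (- (z0 * dq)^-1) by rewrite wE // e0; ring.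
  apply: le_trans (nmB _ _) _; rewrite lerD2r nmM.
  by apply: ler_pM (nm_ge0 _) (nm_ge0 _) (pB z1) (hK2 z z1).
have [F [K4 [hF F0 FK FVK]]] := integrating_factor hw hK3.
pose K := Num.max (Num.max K1 K2) (Num.max K3 K4).
by exists u, w, F, K; split => // z z1; rewrite /K !le_max ?hK1 ?hK2 ?hK3 ?FK ?FVK ?orbT.
Qed.

Section Substitution.
Variables (al : C) (u w F : C -> C) (K : R).
Hypothesis nf : nform al u w F K.

(** Since [F' = w F], the division by [F] produces the term [- (z - z0) w H], which cancels the
    regular part of [p / u] and leaves the constant [al]. *)
Lemma nf_Lop (H : C -> C) (dH : C) z : nm z < 1 -> cdf H z dH ->
  cdf (fun z => H z / F z) z ((dH - w z * H z) / F z) /\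
  qf z * ((dH - w z * H z) / F z) + p z * (H z / F z) = u z / F z * ((z - z0) * dH - al * H z).
Proof.
move=> z1 hH; have F0 := nf_F0 nf; split.
  apply: cat_eq (catM (cont_id z) hH (cdf_inv_factor (nf_F nf) F0 z1)) _.
  by have f0 := F0 z; field.
by rewrite (nf_q nf z1) (nf_p nf z1); have f0 := F0 z; field.
Qed.

Let K0 : 0 <= K.
Proof. by apply: le_trans (nm_ge0 _) (nf_uK nf (z := 0) _); rewrite nm0. Qed.

Lemma holo_nfV : holo (fun z => (F z)^-1).
Proof. by move=> z z1; exists (- (w z / F z)); exact: (cdf_inv_factor (nf_F nf) (nf_F0 nf) z1). Qed.

Lemma holo_nf : holo F.
Proof. by move=> z z1; exists (w z * F z); exact: (nf_F nf z1). Qed.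

Lemma nf_bergman (H dH : C -> C) : bergman H -> bergman dH ->
  [/\ bergman (fun z => H z / F z), bergman (fun z => (dH z - w z * H z) / F z),
    nD (fun z => H z / F z) <= K ^+ 2 * nD H &
    nD (fun z => (dH z - w z * H z) / F z) <= K ^+ 2 * (2 * nD dH + 2 * (K ^+ 2 * nD H))].
Proof.
move=> bH bdH.
have fz (f : C -> C) : (fun z => f z / F z) = (fun z => (F z)^-1 * f z).
  by apply/funext => z; rewrite mulrC.
have [b1 n1] := nDM holo_nfV (nf_FV nf) bH.
have [b2 n2] := nDM (nf_w nf) (nf_wK nf) bH.
have b3 := bergmanN b2; have b4 := bergmanD bdH b3.
have n4 := nDD bdH b3.
have n3 : nD (fun z => - (w z * H z)) <= K ^+ 2 * nD H.
  apply: le_trans n2; have [||_] := @nD_le2 _ _ _ (fun _ => 0) 1 0 (bergman_holo b3) b2 _ ler01 (lexx 0).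
  - by apply: bergman_ext (bergmanZ 0 b2) => z _; rewrite mul0r.
  - by move=> z _; rewrite nmN mul0r addr0 mul1r.
  - by rewrite mul0r mul1r addr0.
have [b5 n5] := nDM holo_nfV (nf_FV nf) b4.
rewrite fz (fz (fun z => dH z - w z * H z)); split => //.
apply: le_trans n5 _; rewrite ler_wpM2l ?sqr_ge0 // (le_trans n4) // lerD2l ler_wpM2l //.
Qed.

End Substitution.

Lemma resonant_not_solvable n (u w F : C -> C) (K : R) : nform n.+1%:R u w F K -> ~ solvable p.
Proof.
move=> nf hs.
pose H z := (z - z0) ^+ n.+1; pose dH z := n.+1%:R * (z - z0) ^+ n.
have hH z : cdf H z (dH z).
  apply: cat_eq (catX n.+1 (cont_id z) (catB (cat_id id z) (cat_cst id z0 z))) _.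
  by rewrite subr0 mulr1.
have bX k : bergman (fun z => (z - z0) ^+ k).
  have h : holo (fun z => z - z0) by apply: holoB; [exact: holo_id|exact: holo_cst].
  apply: (@bergman_bounded _ _ (2 ^+ k)); first elim: k => [|k IH].
  - by apply: holo_ext (holo_cst 1) => z _; rewrite expr0.
  - by apply: holo_ext (holoM h IH) => z _; rewrite exprS.
  move=> z z1; rewrite nmX lerXn2r ?nnegrE ?nm_ge0 //.
  by apply: le_trans (nmB _ _) _; have := z01; lra.
have bdH : bergman dH by apply: bergmanZ; exact: bX.
have [b1 b2 _ _] := nf_bergman nf (bX n.+1) bdH.
have e := solvable_ker hs (fun z lz => proj1 (nf_Lop nf lz (hH z))) b1 b2 _.
suff : H 0 / F 0 = 0.
  move=> /eqP; rewrite mulf_eq0 invr_eq0 (negbTE (nf_F0 nf 0)) orbF.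
  by rewrite /H sub0r expf_eq0 oppr_eq0 (negbTE z0_neq0).
apply: e => z z1; rewrite (proj2 (nf_Lop nf z1 (hH z))) /H /dH exprS; ring.
Qed.

End NormalForm.

(** * Taylor coefficients and bounded functionals *)

Section Functionals.
Variable R : realType.
Local Notation C := (CC R).
Local Notation nm := (@Normc.normc R).
Local Notation kap := (kap R).
Implicit Types (f g h k : C -> C) (a b : nat -> C) (z w : C) (phi : (C -> C) -> C).

Definition taylor g : nat -> C :=
  xget (fun _ => 0) [set a | rad a /\ forall z, nm z < 1 -> g z = psum a z].

Lemma taylorP g : holo g -> rad (taylor g) /\ forall z, nm z < 1 -> g z = psum (taylor g) z.
Proof.
move=> /holo_psum [a ra ga]; rewrite /taylor.
by case: xgetP => [b _ [] //|/(_ a)]; case.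
Qed.

Lemma taylorE g a : rad a -> (forall z, nm z < 1 -> g z = psum a z) -> taylor g = a.
Proof.
move=> ra ga; have hg : holo g by apply: holo_ext (psum_holo ra) => z /ga.
have [rt gt] := taylorP hg; apply/funext; apply: psum_inj => // z z1.
by rewrite -gt // ga.
Qed.

Lemma taylor_ext f g : (forall z, nm z < 1 -> f z = g z) -> taylor f = taylor g.
Proof.
move=> h; rewrite /taylor; congr xget; apply/seteqP; split => a [ra e]; split => // z z1.
  by rewrite -h // e.
by rewrite h // e.
Qed.

Lemma taylor_lin (x : C) f g : holo f -> holo g ->
  taylor (fun z => x * f z + g z) = fun n => x * taylor f n + taylor g n.
Proof.
move=> /taylorP [rf ff] /taylorP [rg gg]; apply: taylorE; first by apply: radD => //; exact: radZ.
by move=> z z1; rewrite psumD ?psumZ ?ff ?gg //; exact: radZ.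
Qed.

Lemma taylor_mulX f : holo f -> taylor (fun z => z * f z) = shift (taylor f).
Proof.
move=> /taylorP [rf ff]; apply: taylorE; first exact: rad_shift.
by move=> z z1; rewrite psum_shift // -ff.
Qed.

Lemma holo_Xn m : holo (fun z : C => z ^+ m).
Proof.
elim: m => [|m IH]; first by apply: holo_ext (holo_cst 1) => z _; rewrite expr0.
by apply: holo_ext (holoM (@holo_id R) IH) => z _; rewrite exprS.
Qed.

Lemma taylor_mulXn f m i : holo f -> (i < m)%N -> taylor (fun z => z ^+ m * f z) i = 0.
Proof.
move=> hf; elim: m i => // m IH i im.
rewrite (@taylor_ext _ (fun z => z * (z ^+ m * f z))); last by move=> z _; rewrite exprS mulrA.
by rewrite taylor_mulX; [case: i im => // i; exact: IH|exact: holoM (@holo_Xn m) hf].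
Qed.

Definition basis j : nat -> C := fun n => if n == j then 1 else 0.

Lemma basis_fin j n : (j.+1 <= n)%N -> basis j n = 0.
Proof. by rewrite /basis; case: eqVneq => // ->; rewrite ltnn. Qed.

Lemma rad_basis j : rad (basis j).
Proof. exact: rad_fin (@basis_fin j). Qed.

Lemma taylor_Xn m : taylor (fun z => z ^+ m) = basis m.
Proof.
apply: taylorE; first exact: rad_basis.
move=> z z1; rewrite (psum_fin (@basis_fin m)) // /psm big_ord_recr /= {2}/basis eqxx mul1r.
rewrite big1 ?add0r // => j _; rewrite /basis ltn_eqF ?mul0r //.
Qed.

Lemma bergman_Xn m : bergman (fun z : C => z ^+ m).
Proof.
apply: (@bergman_bounded _ _ 1); first exact: holo_Xn.
by move=> z z1; rewrite nmX exprn_ile1 ?nm_ge0 // ltW.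
Qed.

Lemma rad_addn a m : rad a -> rad (fun n => a (n + m)%N).
Proof.
move=> ra; elim: m => [|m IH]; first by move: ra; congr rad; apply/funext => n; rewrite addn0.
by move: (rad_behead IH); congr rad; apply/funext => n; rewrite addnS addSn.
Qed.

Lemma psum_mulXn a m z : rad a -> (forall n, (n < m)%N -> a n = 0) -> nm z < 1 ->
  psum a z = z ^+ m * psum (fun n => a (n + m)%N) z.
Proof.
move=> ra a0 z1; elim: m a ra a0 => [|m IH] a ra a0.
  by rewrite expr0 mul1r; congr (psum _ z); apply/funext => n; rewrite addn0.
have -> : a = shift (fun n => a n.+1) by apply/funext => -[|n] //; rewrite /= a0.
rewrite psum_shift //; last exact: rad_behead.
rewrite IH; [|exact: rad_behead|by move=> n nm; rewrite a0].
rewrite exprS -mulrA; congr (_ * (_ * psum _ z)).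
by apply/funext => n; rewrite addnS.
Qed.

(** Linearity is stated for all analytic functions and boundedness for Bergman functions, so that a
    Bergman function may be decomposed into pieces known only to be analytic. *)
Record bounded_functional phi : Prop := BoundedFunctional {
  bf_ext : forall f g, (forall z, nm z < 1 -> f z = g z) -> phi f = phi g;
  bf_lin : forall (x : C) f g, holo f -> holo g ->
    phi (fun z => x * f z + g z) = x * phi f + phi g;
  bf_bound : exists2 M, 0 <= M & forall g, bergman g -> nm (phi g) ^+ 2 <= M * nD g }.

Lemma bf_coef i : bounded_functional (fun g => taylor g i).
Proof.
split; [by move=> f g /taylor_ext ->|by move=> x f g hf hg; rewrite taylor_lin|].
have k0 := kap_gt0 R.
exists (i.+1%:R / kap); first by rewrite divr_ge0 // ltW.
move=> g bg; have [rt gt] := taylorP (bergman_holo bg).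
have := wsum_nD rt gt i.+1 bg; rewrite /wsum big_ord_recr /= => h.
rewrite mulrAC ler_pdivlMr // nm_sqr.
have h2 : kap * (abs2 (taylor g i) / i.+1%:R) <= nD g.
  apply: le_trans h; apply: ler_wpM2l; first exact: ltW.
  rewrite lerDr sumr_ge0 // => j _.
  by rewrite divr_ge0 ?abs2_ge0.
by rewrite [leRHS]mulrC -ler_pdivrMr ?ltr0n // [_ * kap]mulrC -mulrA.
Qed.

Lemma coef_bound g : bergman g -> forall n, nm (taylor g n) <= Num.sqrt (nD g / kap) * n.+1%:R.
Proof.
move=> bg n; have k0 := kap_gt0 R; have [rt gt] := taylorP (bergman_holo bg).
have d0 : 0 <= nD g / kap by rewrite divr_ge0 ?nD_ge0 // ltW.
rewrite -(@ler_pXn2r _ 2) ?nnegrE ?nm_ge0 ?mulr_ge0 ?sqrtr_ge0 //.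
rewrite exprMn sqr_sqrtr // mulrAC ler_pdivlMr // nm_sqr.
have := wsum_nD rt gt n.+1 bg; rewrite /wsum big_ord_recr /= => h.
have h2 : kap * (abs2 (taylor g n) / n.+1%:R) <= nD g.
  apply: le_trans h; apply: ler_wpM2l; first exact: ltW.
  rewrite lerDr sumr_ge0 // => j _.
  by rewrite divr_ge0 ?abs2_ge0.
have n1 : 1 <= n.+1%:R :> R by rewrite ler1n.
apply: le_trans (_ : nD g * n.+1%:R <= _).
  by rewrite mulrC -ler_pdivrMr ?ltr0n // -mulrA.
by rewrite ler_wpM2l ?nD_ge0 // expr2 ler_peMl.
Qed.

(** Quadratic growth of the coefficients serves evaluation, where they grow like [n+1], as well as
    differentiation, where they grow like [(n+1)(n+2)]. *)
Lemma psum_bound z : nm z < 1 -> exists2 M, 0 <= M & forall a (s : R), 0 <= s ->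
  (forall n, nm (a n) <= s * n.+1%:R ^+ 2) -> nm (psum a z) <= s * M.
Proof.
move=> z1; pose r := (1 + nm z) / 2; have n0 := nm_ge0 z.
have r0 : 0 < r by rewrite /r; lra.
have r1 : r < 1 by rewrite /r; lra.
have zr : nm z < r by rewrite /r; lra.
have r01 : 0 < r < 1 by rewrite r0.
have ra : rad (fun n => n.+1%:R * (n.+1%:R * (1 : C))).
  apply: rad_natM; apply: rad_natM => s /andP[s0 s1]; exists 1 => n.
  by rewrite nm1 mul1r exprn_ile1 // ltW.
have [K hK] := ra _ r01.
have K0 : 0 <= K by apply: le_trans (hK 0%N); rewrite mulr_ge0 ?nm_ge0 // exprn_ge0 // ltW.
have q1 : 0 < 1 - nm z / r by rewrite subr_gt0 ltr_pdivrMr // mul1r.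
exists (K / (1 - nm z / r)); first by rewrite divr_ge0 // ltW.
move=> a s s0 ha; have := @psum_tail _ a z r (s * K) 0 r0 zr _.
rewrite /psm big_ord0 subr0 expr0 mulr1 mulrA; apply => n.
apply: le_trans (_ : s * n.+1%:R ^+ 2 * r ^+ n <= _).
  by rewrite ler_wpM2r // exprn_ge0 // ltW.
rewrite -mulrA ler_wpM2l //; have := hK n.
by rewrite mulr1 nmM !nm_nat -expr2.
Qed.

Lemma bf_eval z : nm z < 1 -> bounded_functional (fun g => g z).
Proof.
move=> z1; split => [f g h| //|]; first exact: h.
have [M M0 hM] := psum_bound z1; have k0 := kap_gt0 R.
exists (M ^+ 2 / kap); first by rewrite divr_ge0 ?sqr_ge0 // ltW.
move=> g bg; have [_ gt] := taylorP (bergman_holo bg).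
have d0 : 0 <= nD g / kap by rewrite divr_ge0 ?nD_ge0 // ltW.
have := hM (taylor g) _ (sqrtr_ge0 (nD g / kap)) _; rewrite -gt // => h.
have : nm (g z) <= Num.sqrt (nD g / kap) * M.
  apply: h => n; apply: le_trans (coef_bound bg n) _.
  by rewrite ler_wpM2l ?sqrtr_ge0 // expr2 ler_peMl // ler1n.
move=> h'; have := lerXn2r 2 (nm_ge0 _) _ h'; rewrite nnegrE mulr_ge0 ?sqrtr_ge0 // => /(_ isT).
rewrite exprMn (sqr_sqrtr d0) => /le_trans; apply.
by rewrite (_ : M ^+ 2 / kap * nD g = nD g / kap * M ^+ 2) //; ring.
Qed.

Lemma bf_deriv z : nm z < 1 -> bounded_functional (fun g => psum (dfs (taylor g)) z).
Proof.
move=> z1; split => [f g /taylor_ext -> //|x f g hf hg|].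
  have [rf _] := taylorP hf; have [rg _] := taylorP hg.
  have r1 := rad_dfs rf; have r2 := rad_dfs rg; have r3 := radZ x r1.
  rewrite taylor_lin // -psumZ // -psumD //; congr (psum _ z); apply/funext => n.
  by rewrite /dfs; ring.
have [M M0 hM] := psum_bound z1; have k0 := kap_gt0 R.
exists ((2 * M) ^+ 2 / kap); first by rewrite divr_ge0 ?sqr_ge0 // ltW.
move=> g bg.
have d0 : 0 <= nD g / kap by rewrite divr_ge0 ?nD_ge0 // ltW.
have s0 := sqrtr_ge0 (nD g / kap).
(* The factor 2 comes from [(n+1)(n+2) <= 2 (n+1)^2]. *)
have h' : nm (psum (dfs (taylor g)) z) <= Num.sqrt (nD g / kap) * 2 * M.
  apply: hM => [|n]; first by rewrite mulr_ge0.
  rewrite /dfs nmM nm_nat; apply: le_trans (ler_wpM2l (ler0n _ _) (coef_bound bg n.+1)) _.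
  rewrite mulrCA -mulrA ler_wpM2l // expr2 mulrCA ler_wpM2l //.
  by rewrite -natrM ler_nat; lia.
have := lerXn2r 2 (nm_ge0 _) _ h'; rewrite nnegrE !mulr_ge0 // => /(_ isT).
rewrite -mulrA exprMn (sqr_sqrtr d0) => /le_trans; apply.
by rewrite (_ : (2 * M) ^+ 2 / kap * nD g = nD g / kap * (2 * M) ^+ 2) //; ring.
Qed.

Lemma bf_sum n (c : nat -> C) (phi : nat -> (C -> C) -> C) :
  (forall i, bounded_functional (phi i)) ->
  bounded_functional (fun g => \sum_(i < n) c i * phi i g).
Proof.
move=> h; elim: n => [|n [e l [M M0 hM]]].
  split => [f g _|x f g _ _|]; rewrite ?big_ord0 ?mulr0 ?addr0 //.
  by exists 0 => // g _; rewrite big_ord0 nm0 expr0n mul0r.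
have [e' l' [M' M'0 hM']] := h n.
split.
- by move=> f g fg; rewrite !big_ord_recr /= (e f g) // (e' f g).
- by move=> x f g hf hg; rewrite !big_ord_recr /= l // l' //; ring.
exists (2 * M + 2 * (nm (c n) ^+ 2 * M')).
  by rewrite addr_ge0 ?mulr_ge0 ?exprn_ge0 ?nm_ge0.
move=> g bg; rewrite big_ord_recr /=; apply: le_trans (nm_sqrD _ _) _.
have h2 : nm (c n * phi n g) ^+ 2 <= nm (c n) ^+ 2 * (M' * nD g).
  by rewrite nmM exprMn; apply: ler_wpM2l; [rewrite exprn_ge0 ?nm_ge0|exact: hM'].
have -> : (2 * M + 2 * (nm (c n) ^+ 2 * M')) * nD g =
  2 * (M * nD g) + 2 * (nm (c n) ^+ 2 * (M' * nD g)) by ring.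
by apply: lerD; apply: ler_wpM2l => //; exact: hM.
Qed.

End Functionals.

(** * Two functionals that vanish on the multiples of [q] obstruct surjectivity *)

Section TwoZeros.
Variable R : realType.
Local Notation C := (CC R).
Local Notation nm := (@Normc.normc R).
Local Notation kap := (kap R).
Implicit Types (f g h k : C -> C) (a b : nat -> C) (z w : C) (phi : (C -> C) -> C).
Variables (p : C -> C) (B : R).
Hypotheses (hp : holo p) (pB : forall z, nm z < 1 -> nm (p z) <= B).
Local Notation qf := (qf p).
Variables phi1 phi2 : (C -> C) -> C.
Hypotheses (bf1 : bounded_functional phi1) (bf2 : bounded_functional phi2).
Hypotheses (phi1q : forall k, holo k -> phi1 (fun z => qf z * k z) = 0)
  (phi2q : forall k, holo k -> phi2 (fun z => qf z * k z) = 0).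
Hypothesis indep : forall m (c1 c2 : C),
  (forall k, bergman k -> c1 * phi1 (fun z => z ^+ m * k z) + c2 * phi2 (fun z => z ^+ m * k z) = 0) ->
  c1 = 0 /\ c2 = 0.

Lemma holo_Lop b : rad b -> holo (Lop p b).
Proof.
move=> rb; apply: holoD; apply: holoM; [exact: holo_qf|exact/psum_holo/rad_dfs|by []|exact: psum_holo].
Qed.

Lemma Lop_lin (x : C) a b z : rad a -> rad b -> nm z < 1 ->
  Lop p (fun n => x * a n + b n) z = x * Lop p a z + Lop p b z.
Proof.
move=> ra rb z1; have rx := radZ x ra; rewrite /Lop psumD // psumZ //.
have r1 := rad_dfs ra; have r2 := rad_dfs rb; have r3 := radZ x r1.
have -> : dfs (fun n => x * a n + b n) = fun n => x * dfs a n + dfs b n.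
  by apply/funext => n; rewrite /dfs; ring.
by rewrite psumD // psumZ //; ring.
Qed.

(** Taylor coefficients of index below [m] vanish on the functions [z^m k], so on those a
    combination reduces to its last two terms; this is why [indep] is stated for multiples of
    [z^m]. *)
Let phi m i : (C -> C) -> C :=
  if (i < m)%N then (fun g => taylor g i) else if i == m then phi1 else phi2.

Let bf_phi m i : bounded_functional (phi m i).
Proof. by rewrite /phi; case: ifP => _; [exact: bf_coef|case: ifP]. Qed.

Lemma kernel_vector m : exists c : nat -> C,
  (exists2 i, (i < m.+2)%N & c i != 0) /\
  forall j, (j < m.+1)%N -> \sum_(i < m.+2) c i * phi m i (Lop p (basis R j)) = 0.
Proof.
pose A := \matrix_(i < m.+2, j < m.+1) (phi m i (Lop p (basis R j)) : R[i]).
have : kermx A != 0.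
  rewrite kermx_eq0 /row_free neq_ltn; apply/orP; left.
  by rewrite ltnS rank_leq_col.
move=> /rowV0Pn [v /sub_kermxP vA v0].
exists (fun n => v 0 (inord n)); split.
  have /rV0Pn [i vi] := v0.
  by exists i => //; rewrite inord_val.
move=> j jm; have /matrixP /(_ 0 (Ordinal jm)) := vA.
by rewrite !mxE => e; rewrite -[RHS]e; apply: eq_bigr => i _; rewrite mxE inord_val.
Qed.

Lemma two_functionals_not_solvable : ~ solvable p.
Proof.
move=> [c [c0 hs _]]; have k0 := kap_gt0 R.
(* Large enough for [B^2 c / (m+1)^2 <= 1/2], the gain of one pass of [step]. *)
have [m hm] : exists m : nat, B ^+ 2 * c * 2 <= m.+1%:R.
  exists (Num.bound (B ^+ 2 * c * 2)).
  have y0 : 0 <= B ^+ 2 * c * 2 by rewrite mulr_ge0 // mulr_ge0 ?sqr_ge0 // ltW.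
  by apply: le_trans (ltW (archi_boundP y0)) _; rewrite ler_nat.
have [v [[i0 i0m vi0] hv]] := kernel_vector m.
pose psi g := \sum_(i < m.+2) v i * phi m i g.
have [pe pl [M M0 hM]] : bounded_functional psi by apply: bf_sum => i; exact: bf_phi.
have psi_test k : holo k -> psi (fun z => z ^+ m * k z) =
    v m * phi1 (fun z => z ^+ m * k z) + v m.+1 * phi2 (fun z => z ^+ m * k z).
  move=> hk; rewrite /psi !big_ord_recr /= big1 ?add0r; last first.
    by move=> i _; rewrite /phi ltn_ord taylor_mulXn // mulr0.
  by rewrite /phi ltnn eqxx ltnNge leqnSn /= gtn_eqF.
have psi_q k : holo k -> psi (fun z => qf z * (z ^+ m * k z)) = 0.
  move=> hk; have hq := holo_qf hp; have h1 := holoM (@holo_Xn R m) hk.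
  rewrite (pe _ (fun z => z ^+ m * (qf z * k z))); last by move=> z _; rewrite mulrCA.
  rewrite psi_test; last exact: holoM.
  rewrite (bf_ext bf1 (g := fun z => qf z * (z ^+ m * k z))); last by move=> z _; rewrite mulrCA.
  rewrite (bf_ext bf2 (g := fun z => qf z * (z ^+ m * k z))); last by move=> z _; rewrite mulrCA.
  by rewrite phi1q // phi2q // !mulr0 addr0.
pose trunc b n : nat -> C := fun i => if (i < n)%N then b i else 0.
have rad_trunc b n : rad (trunc b n).
  by apply: (@rad_fin _ _ n) => i ni; rewrite /trunc ltnNge ni.
have psi_trunc b n : (n <= m.+1)%N -> psi (Lop p (trunc b n)) = 0.
  elim: n => [_|n IH nm1].
    rewrite (pe _ (fun z => (-1) * Lop p (trunc b 0) z + Lop p (trunc b 0) z)).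
      by rewrite pl ?mulN1r ?addNr //; apply: holo_Lop.
    move=> z z1; rewrite mulN1r addNr.
    have h0 (a : nat -> C) : (forall i, a i = 0) -> psum a z = 0.
      by move=> a0; rewrite (@psum_fin _ _ _ 0) // /psm big_ord0.
    by rewrite /Lop !h0 ?mulr0 ?addr0 // => i; rewrite /dfs /trunc /= mulr0.
  rewrite (pe _ (fun z => b n * Lop p (basis R n) z + Lop p (trunc b n) z)).
    rewrite pl; [|exact/holo_Lop/rad_basis|exact/holo_Lop].
    have -> : psi (Lop p (basis R n)) = 0 by exact: (hv n nm1).
    by rewrite (IH (ltnW nm1)) mulr0 addr0.
  move=> z z1; rewrite -Lop_lin //; last exact: rad_basis.
  congr (Lop p _ z); apply/funext => i; rewrite /trunc /basis ltnS leq_eqVlt.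
  by case: eqVneq => [->|_] /=; rewrite ?ltnn ?mulr1 ?addr0 // mulr0 add0r.
(* Write [g = L b] and cut [b] after index [m]. [psi] kills [L] of the head by the choice of [v],
   and the term [q x'] of the tail [x] because [x'] is a multiple of [z^m]; so [psi g = psi (p x)]
   with [p x] small. *)
have step K : 0 <= K -> (forall g, bergman g -> nm (psi g) ^+ 2 <= K * nD g) ->
    forall g, bergman g -> nm (psi g) ^+ 2 <= K / 2 * nD g.
  move=> K0 hK g bg; have [b [eg hb]] := hs g bg.
  have hb' n : ds b n <= c * nD g / kap by rewrite ler_pdivlMr // mulrC.
  have rb := ds_rad hb'.
  (* The tail starts at index [m+1], so its derivative starts exactly at [z^m]. *)
  pose t : nat -> C := fun i => if (i < m.+1)%N then 0 else b i.
  have rt : rad t.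
    apply: (rad_le (K := 1)) rb => i; rewrite mul1r /t; case: ifP => // _.
    by rewrite nm0 nm_ge0.
  (* On indices [i >= m+1] the Bergman weight [1/(i+1)] is at most [(m+1)^-2] times the weight [i+1]
     of [ds]. *)
  have wt n : wsum t n <= c * nD g / kap / m.+1%:R ^+ 2.
    apply: le_trans (_ : ds b n / m.+1%:R ^+ 2 <= _); last first.
      by rewrite ler_wpM2r // invr_ge0 sqr_ge0.
    rewrite /ds mulr_suml; apply: ler_sum => i _; rewrite /t; case: ltnP => hi.
      by rewrite /abs2 /= expr0n addr0 mul0r !mulr_ge0 ?invr_ge0 ?sqr_ge0 ?addr_ge0 ?sqr_ge0.
    rewrite mulrAC [leRHS]mulrC; apply: ler_wpM2l; first exact: abs2_ge0.
    have key (x y : R) : 0 < x -> x <= y -> y^-1 <= y / x ^+ 2.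
      move=> x0 xy; have y0 := lt_le_trans x0 xy.
      rewrite ler_pdivlMr ?exprn_gt0 // ler_pdivrMl // -expr2.
      by rewrite lerXn2r // nnegrE ltW.
    by apply: key; rewrite ?ltr0n // ler_nat; apply: leq_trans hi _.
  have [bx nx] := nD_wsum rt wt; have [bpx npx] := nDM hp pB bx.
  have d0 n : (n < m)%N -> dfs t n = 0 by move=> h; rewrite /dfs /t ltnS h mulr0.
  have rdt := rad_dfs rt.
  pose k := psum (fun n => dfs t (n + m)).
  have hk : holo k.
    exact/psum_holo/rad_addn.
  have -> : psi g = psi (fun z => p z * psum t z).
    rewrite (pe g (fun z => 1 * Lop p (trunc b m.+1) z + (1 * (qf z * (z ^+ m * k z)) + p z * psum t z))).
      have hqk : holo (fun z => qf z * (z ^+ m * k z)).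
        by apply: holoM; [exact: holo_qf|apply: holoM => //; exact: holo_Xn].
      have hpx := bergman_holo bpx.
      rewrite pl; [|exact: holo_Lop|].
        by rewrite psi_trunc // pl // psi_q // !mulr0 !add0r.
      apply: holoD => //; apply: holo_ext hqk => z _; by rewrite mul1r.
    move=> z z1; rewrite -eg // -psum_mulXn // [1 * (qf z * _)]mul1r -[qf z * _ + _]/(Lop p t z).
    rewrite -Lop_lin //; congr (Lop p _ z); apply/funext => i.
    by rewrite /trunc /t mul1r; case: ifP => _; rewrite ?addr0 ?add0r.
  apply: le_trans (hK _ bpx) _; rewrite -mulrA ler_wpM2l //.
  apply: le_trans npx _; apply: le_trans (ler_wpM2l (sqr_ge0 B) nx) _.
  have -> : B ^+ 2 * (kap * (c * nD g / kap / m.+1%:R ^+ 2)) = (B ^+ 2 * c / m.+1%:R ^+ 2) * nD g.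
    have key (a d e x y : R) : x != 0 -> a * (x * (d * e / x / y)) = a * d / y * e.
      by move=> x0; rewrite (mulrAC _ x^-1) (mulrC x) divfK //; ring.
    by apply: key; rewrite gt_eqF.
  apply: ler_wpM2r; first exact: nD_ge0.
  have m1 : 1 <= m.+1%:R :> R by rewrite ler1n.
  have m0 : 0 < m.+1%:R :> R by rewrite ltr0n.
  rewrite ler_pdivrMr ?exprn_gt0 // ler_pdivlMl // mulrC (le_trans hm) // expr2 ler_peMl // ltW.
have steps n g : bergman g -> nm (psi g) ^+ 2 <= M / 2 ^+ n * nD g.
  elim: n g => [|n IH] g bg; first by rewrite expr0 divr1; exact: hM.
  have -> : M / 2 ^+ n.+1 = M / 2 ^+ n / 2 by rewrite (exprSr 2 n) invfM mulrA.
  by apply: step IH g bg; rewrite divr_ge0 // exprn_ge0.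
have psi0 g : bergman g -> psi g = 0.
  move=> bg; apply/eqP; rewrite -nm_eq0 -[_ == 0]sqrf_eq0 -[_ == 0]negbK; apply/negP => h.
  have x0 : 0 < nm (psi g) ^+ 2 by rewrite lt_neqAle eq_sym h exprn_ge0 ?nm_ge0.
  have y0 : 0 <= M * nD g / nm (psi g) ^+ 2.
    by rewrite divr_ge0 ?(ltW x0) // mulr_ge0 ?nD_ge0.
  have := archi_boundP y0; set n := Num.bound _; rewrite ltr_pdivrMr // ltNge => /negP; apply.
  have s2 : 0 < 2 ^+ n :> R by rewrite exprn_gt0.
  have := steps n g bg; rewrite mulrAC ler_pdivlMr // mulrC; apply: le_trans.
  rewrite ler_wpM2r ?(ltW x0) // -natrX ler_nat ltnW // ltn_expl //.
(* Once [psi] vanishes, the functions [z^m k] and [indep] remove the last two entries of [v], and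
   the monomial [z^i0] with [i0 < m] then removes the entry that was nonzero. *)
have [vm vm1] : v m = 0 /\ v m.+1 = 0.
  apply: (indep (m := m)) => k bk; rewrite -psi_test; last exact: bergman_holo.
  apply: psi0; apply: (bergmanM (B := 1)) bk; first exact: holo_Xn.
  by move=> z z1; rewrite nmX exprn_ile1 ?nm_ge0 // ltW.
move/eqP: vi0; apply; have [hi|hi] := ltnP i0 m; last first.
  move: i0m hi; rewrite ltnS leq_eqVlt => /orP[/eqP -> //|]; rewrite ltnS => h1 h2.
  by have /eqP -> : i0 == m by rewrite eqn_leq h1.
have := psi0 _ (bergman_Xn R i0); rewrite /psi !big_ord_recr /= vm vm1 !mul0r !addr0.
rewrite (bigD1 (Ordinal hi)) //= big1 ?addr0 => [|j /eqP ji].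
  by rewrite /phi hi taylor_Xn /basis eqxx mulr1.
rewrite /phi ltn_ord taylor_Xn /basis; case: eqVneq => [e|_]; last by rewrite mulr0.
by case: ji; apply: val_inj.
Qed.

End TwoZeros.

(** * Two distinct zeros, a double zero, and the necessary conditions together *)

Section Instances.
Variable R : realType.
Local Notation C := (CC R).
Local Notation nm := (@Normc.normc R).
Implicit Types (f g h k : C -> C) (a b : nat -> C) (z w : C) (phi : (C -> C) -> C).
Variables (p : C -> C) (B : R).
Hypotheses (hp : holo p) (pB : forall z, nm z < 1 -> nm (p z) <= B).
Local Notation qf := (qf p).

Lemma bergman_subr (c : C) : bergman (fun z => z - c).
Proof.
apply: (@bergman_bounded _ _ (1 + nm c)); first exact: holoB (@holo_id R) (holo_cst c).
by move=> z z1; apply: le_trans (nmB _ _) _; rewrite lerD2r ltW.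
Qed.

Lemma cdf_taylor g z : holo g -> nm z < 1 -> cdf g z (psum (dfs (taylor g)) z).
Proof.
move=> hg z1; have [d hd] := hg z z1; have [rg gE] := taylorP hg.
suff -> : psum (dfs (taylor g)) z = d by [].
apply: (cdf_uniq _ hd).
apply: (@cdf_near _ (psum (taylor g)) _ _ _ (1 - nm z)); rewrite ?subr_gt0 //; last exact: psum_cdf.
by move=> w hw; rewrite gE // -(subrK z w) (le_lt_trans (nmD _ _)) // -ltrBrDr.
Qed.

(** Independence is tested on [z - z1] and [z - z0], each of which isolates one evaluation; the
    factor [z^m] does no harm because zeros of [q] are nonzero. *)
Lemma two_zeros_not_solvable (z0 z1 : C) : nm z0 < 1 -> nm z1 < 1 -> z0 != z1 ->
  qf z0 = 0 -> qf z1 = 0 -> ~ solvable p.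
Proof.
move=> l0 l1 z01 q0 q1.
have n0 := z0_neq0 q0; have n1 := z0_neq0 q1.
apply: (two_functionals_not_solvable hp pB (bf_eval l0) (bf_eval l1)).
- by move=> k _; rewrite q0 mul0r.
- by move=> k _; rewrite q1 mul0r.
move=> m c1 c2 h; split.
  have := h _ (bergman_subr z1); rewrite subrr !mulr0 addr0 => /eqP.
  by rewrite !mulf_eq0 subr_eq0 (negbTE z01) orbF expf_eq0 (negbTE n0) andbF orbF => /eqP.
have := h _ (bergman_subr z0); rewrite subrr !mulr0 add0r => /eqP.
by rewrite !mulf_eq0 subr_eq0 (eq_sym z1) (negbTE z01) orbF expf_eq0 (negbTE n1) andbF orbF => /eqP.
Qed.

(** Evaluation and derivative at [z0] both vanish on multiples of [q]. The test function [z - z0]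
    isolates the derivative, and the constant 1 then isolates the evaluation. *)
Lemma double_zero_not_solvable (z0 : C) : nm z0 < 1 -> qf z0 = 0 -> cdf qf z0 0 -> ~ solvable p.
Proof.
move=> l0 q0 dq0; have n0 := z0_neq0 q0; have hq := holo_qf hp.
have ps (f : C -> C) (d : C) : holo f -> cdf f z0 d -> psum (dfs (taylor f)) z0 = d.
  by move=> hf; apply: cdf_uniq; exact: cdf_taylor.
apply: (two_functionals_not_solvable hp pB (bf_eval l0) (bf_deriv l0)).
- by move=> k _; rewrite q0 mul0r.
- move=> k hk; apply: ps; first exact: holoM.
  have [d hd] := hk z0 l0.
  by apply: cat_eq (catM (cont_id z0) dq0 hd) _; rewrite q0 !mul0r addr0.
move=> m c1 c2 h.
have c20 : c2 = 0.
  have := h _ (bergman_subr z0); rewrite subrr !mulr0 add0r (ps _ (z0 ^+ m)).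
  - by move=> /eqP; rewrite mulf_eq0 expf_eq0 (negbTE n0) andbF orbF => /eqP.
  - by apply: holoM; [exact: holo_Xn|exact: bergman_holo (bergman_subr z0)].
  have := catM (cont_id z0) (catX m (cont_id z0) (cat_id id z0)) (catB (cat_id id z0) (cat_cst id z0 z0)).
  by move/cat_eq; apply; rewrite subrr subr0 mulr0 add0r mulr1.
split => //; have := h _ (bergman1 R); rewrite c20 mul0r addr0 mulr1 => /eqP.
by rewrite mulf_eq0 expf_eq0 (negbTE n0) andbF orbF => /eqP.
Qed.

Hypothesis wp : forall z, nm z <= 1 -> wcont p z.

Lemma solvable_necessary : solvable p ->
  (forall z, nm z = 1 -> qf z != 0) /\
  exists z0 dq : C, [/\ nm z0 < 1, qf z0 = 0, forall z, nm z < 1 -> qf z = 0 -> z = z0,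
    cdf qf z0 dq /\ dq != 0 & forall n : nat, z0 * dq != n.+1%:R^-1].
Proof.
move=> hs.
have circ z : nm z = 1 -> qf z != 0.
  move=> z1; apply/eqP => h.
  by apply: (circle_not_solvable hp pB z1 (qf_wcont wp _) h hs); rewrite z1.
split=> //.
have [z0 z01 q0] : exists2 z0, nm z0 < 1 & qf z0 = 0.
  apply: contrapT => h; apply: (zero_free_not_solvable hp pB wp _ hs) => z z1.
  move: z1; rewrite le_eqVlt => /orP[/eqP/circ //|z1].
  by apply/eqP => qz; apply: h; exists z.
have [dq hdq] := holo_qf hp z01.
have dq0 : dq != 0.
  by apply/eqP => e; move: hdq; rewrite e => hd; exact: double_zero_not_solvable z01 q0 hd hs.
have uq z : nm z < 1 -> qf z = 0 -> z = z0.
  move=> z1 qz; apply: contrapT => /eqP zz.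
  exact: (two_zeros_not_solvable z1 z01 zz qz q0 hs).
exists z0, dq; split => // n; apply/eqP => e.
have [u [w [F [K nf]]]] := normal_form hp pB wp z01 q0 hdq dq0 uq circ.
rewrite e invrK in nf.
exact: (resonant_not_solvable z01 q0 nf hs).
Qed.

End Instances.

(** * Sufficiency *)

Section Recursion.
Variable R : realType.
Local Notation C := (CC R).
Local Notation nm := (@Normc.normc R).
Local Notation toR := (real_complex R : R -> C).
Implicit Types (g y : nat -> C) (z : C).

(** Cauchy-Schwarz with weights; adding a term needs only [2 S v <= W v^2 + Q], which follows from
    [S^2 <= W Q]. *)
Lemma sqr_sum_le (w x : nat -> R) N : (forall j, 0 <= w j) ->
  (\sum_(j < N) w j * x j) ^+ 2 <= (\sum_(j < N) w j) * \sum_(j < N) w j * x j ^+ 2.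
Proof.
move=> w0.
have key (S W Q u v : R) : 0 <= W -> 0 <= Q -> 0 <= u -> S ^+ 2 <= W * Q ->
    (S + u * v) ^+ 2 <= (W + u) * (Q + u * v ^+ 2).
  move=> W0 Q0 u0 h.
  have h2 : 2 * S * v <= W * v ^+ 2 + Q.
    move: W0; rewrite le_eqVlt => /orP[/eqP e|W0].
      move: h; rewrite -e mul0r => h.
      have -> : S = 0 by apply/eqP; rewrite -sqrf_eq0 eq_le h sqr_ge0.
      by rewrite mulr0 !mul0r add0r.
    rewrite -(ler_pM2l W0); have := sqr_ge0 (W * v - S); nra.
  have := ler_wpM2l u0 h2; nra.
elim: N => [|N IH]; first by rewrite !big_ord0 expr0n mul0r.
rewrite !big_ord_recr /=; apply: key => //; first exact: sumr_ge0.
by apply: sumr_ge0 => j _; rewrite mulr_ge0 ?sqr_ge0.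
Qed.

Lemma sum_shift_le (t : nat -> R) j N : (forall m, 0 <= t m) ->
  \sum_(n < N) t (n + j)%N <= \sum_(m < N + j) t m.
Proof.
move=> t0; elim: N => [|N IH]; first by rewrite big_ord0 sumr_ge0.
by rewrite addSn !big_ord_recr /= lerD2r.
Qed.

Lemma psum_behead (a : nat -> C) z : rad a -> nm z < 1 ->
  psum a z = a 0%N + z * psum (fun n => a n.+1) z.
Proof.
move=> ra z1; have rb := rad_behead ra.
pose b n := a n.+1; rewrite -/b in rb *.
pose c n : C := if n is 0 then a 0%N else 0.
have c0 n : (1 <= n)%N -> c n = 0 by case: n.
have e : a = fun n => c n + shift b n.
  by apply/funext => -[|n]; rewrite /c /b /= ?addr0 ?add0r.
rewrite {1}e psumD ?psum_shift //; [|exact: rad_fin c0|exact: rad_shift].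
by rewrite (psum_fin c0) // /psm big_ord1 expr0 mulr1.
Qed.

(** * The backward recursion [y_n = g_n + bt_n y_(n+1)] *)

Section Solve.
Variables (bt : nat -> C) (C0 r : R).
Hypotheses (r0 : 0 < r) (r1 : r < 1) (C00 : 0 <= C0).
Let pk n j := \prod_(i < j) bt (n + i)%N.
Hypothesis pkb : forall n j, nm (pk n j) <= C0 * r ^+ j.

Let pkS n j : pk n j.+1 = bt n * pk n.+1 j.
Proof.
rewrite /pk big_ord_recl addn0; congr (_ * _); apply: eq_bigr => i _.
by rewrite lift0 addnS.
Qed.

(** Any number strictly between [r] and 1 would do: a sequence satisfying [rad] is [O(rho^-n)],
    while products of [j] ratios are [O(r^j)]. *)
Let rho := (1 + r) / 2.
Let rho0 : 0 < rho. Proof. by have := r0; have := r1; rewrite /rho; lra. Qed.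
Let rho1 : rho < 1. Proof. by have := r0; have := r1; rewrite /rho; lra. Qed.
Let rrho : r < rho. Proof. by have := r0; have := r1; rewrite /rho; lra. Qed.
Let crho0 : toR rho != 0. Proof. by rewrite -nm_gt0 nm_real gtr0_norm rho0. Qed.
Let nrho : nm (toR rho) < 1. Proof. by rewrite nm_real gtr0_norm ?rho0 ?rho1. Qed.

(** Unrolling gives [y n = pk n J * y (n + J)], which is bounded by a multiple of [(r/rho)^J] and so
    tends to 0. *)
Lemma backward_unique y : rad y -> (forall n, y n = bt n * y n.+1) -> forall n, y n = 0.
Proof.
move=> ry yS n.
have yJ J : y n = pk n J * y (n + J)%N.
  elim: J n => [|J IH] n; first by rewrite /pk big_ord0 mul1r addn0.
  by rewrite pkS -mulrA addnS -addSn -IH -yS.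
have [K hK] := ry rho (introT andP (conj rho0 rho1)).
have b J : nm (y n) <= (C0 * K / rho ^+ n) * (r / rho) ^+ J.
  have e0 : 0 < rho ^+ n by rewrite exprn_gt0.
  have e1 : 0 < rho ^+ J by rewrite exprn_gt0.
  have h := hK (n + J)%N; rewrite exprD in h.
  rewrite (yJ J) nmM; apply: le_trans (_ : C0 * r ^+ J * (K / (rho ^+ n * rho ^+ J)) <= _).
    apply: ler_pM; rewrite ?nm_ge0 //.
    by rewrite ler_pdivlMr // mulr_gt0.
  rewrite [(r / rho) ^+ J]expr_div_n invfM; move: (rho ^- n) (rho ^- J) (r ^+ J) => a b' x.
  by rewrite le_eqVlt; apply/orP; left; apply/eqP; ring.
have q : 0 <= r / rho < 1 by rewrite divr_ge0 ?ltW //= ltr_pdivrMr // mul1r.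
have h := geo_cvg0 (C0 * K / rho ^+ n) q.
apply/eqP; rewrite -nm_eq0 eq_le nm_ge0 andbT -(cvg_lim _ h) //; apply: limr_ge.
  by apply/cvg_ex; eexists; exact: h.
exact: nearW.
Qed.

Variable g : nat -> C.
Hypotheses (rg : rad g) (K : R) (gK : forall N, wsum g N <= K).
(** The unrolled solution is the sum over [j] of [pk n j * g (n + j)]. Dividing the terms by [rho^j]
    presents it as a power series evaluated at [rho], inside the disk of convergence. *)
Let term n j := pk n j * g (n + j)%N / toR rho ^+ j.
Definition back_sol n := psum (term n) (toR rho).

Lemma rad_term n : rad (term n).
Proof.
have q0 : 0 < r / rho by rewrite divr_gt0.
have q1 : r / rho < 1 by rewrite ltr_pdivrMr // mul1r.
have [L hL] := rad_addn n rg (introT andP (conj q0 q1)).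
move=> s /andP[s0 s1]; exists (C0 * L) => j.
have e1 : 0 < rho ^+ j by rewrite exprn_gt0.
have s0' : 0 <= s ^+ j by rewrite exprn_ge0 // ltW.
rewrite /term !nmM nmV nmX nm_real gtr0_norm //.
apply: le_trans (_ : nm (pk n j) * nm (g (n + j)%N) / rho ^+ j * 1 <= _).
  apply: ler_wpM2l; first by rewrite divr_ge0 ?(ltW e1) // mulr_ge0 ?nm_ge0.
  by rewrite exprn_ile1 // ltW.
rewrite mulr1; apply: le_trans (_ : C0 * r ^+ j * nm (g (n + j)%N) / rho ^+ j <= _).
  by rewrite ler_wpM2r ?invr_ge0 ?(ltW e1) // ler_wpM2r ?nm_ge0.
rewrite -!mulrA ler_wpM2l //; have := hL j; rewrite expr_div_n addnC.
by rewrite mulrCA.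
Qed.

Lemma back_solE n : back_sol n = g n + bt n * back_sol n.+1.
Proof.
rewrite /back_sol psum_behead //; last exact: rad_term.
congr (_ + _); first by rewrite /term /pk big_ord0 mul1r addn0 divr1.
rewrite -!psumZ //; [|exact: rad_term|exact/rad_behead/rad_term].
congr (psum _ _); apply/funext => j; rewrite /term pkS addnS addSn exprS.
by rewrite invfM; have := crho0; move=> h; field; rewrite h expf_neq0.
Qed.

Variable D : R.
Hypotheses (hD : forall N, \sum_(j < N) j.+1%:R * r ^+ j <= D).

(** Cauchy-Schwarz with the weights [r^j] bounds [|y_n|^2] by a sum of [r^j |g_(n+j)|^2]. After
    exchanging the sums, [n+j+1 <= (n+1)(j+1)] moves the Bergman weight from [n] to [n+j] at the
    cost of the factor [j+1], whence the form of [D]. *)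
Lemma back_sol_bound N : wsum back_sol N <= C0 ^+ 2 * (D * (D * K)).
Proof.
pose u J n := psm (term n) J (toR rho).
have rj j : 0 <= r ^+ j by rewrite exprn_ge0 // ltW.
have D0 : 0 <= D by have := hD 0; rewrite big_ord0.
have K0 : 0 <= K by have := gK 0; rewrite /wsum big_ord0.
have uE J n : u J n = \sum_(j < J) pk n j * g (n + j)%N.
  by apply: eq_bigr => j _; rewrite /term divfK // expf_neq0.
have u2 J n : abs2 (u J n) <= C0 ^+ 2 * (D * \sum_(j < J) r ^+ j * nm (g (n + j)%N) ^+ 2).
  rewrite -nm_sqr; apply: le_trans (_ : (C0 * \sum_(j < J) r ^+ j * nm (g (n + j)%N)) ^+ 2 <= _).
    rewrite lerXn2r ?nnegrE ?nm_ge0 //.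
      by rewrite mulr_ge0 // sumr_ge0 // => j _; rewrite mulr_ge0 ?nm_ge0.
    rewrite uE; apply: le_trans (nm_sum _ _ _) _; rewrite mulr_sumr; apply: ler_sum => j _.
    by rewrite nmM mulrA ler_wpM2r ?nm_ge0.
  rewrite exprMn ler_wpM2l ?sqr_ge0 //.
  apply: le_trans (sqr_sum_le (fun j => nm (g (n + j)%N)) J rj) _.
  rewrite ler_wpM2r //; first by apply: sumr_ge0 => j _; rewrite mulr_ge0 ?sqr_ge0.
  apply: le_trans (hD J); apply: ler_sum => j _.
  by rewrite ler_peMl // ler1n.
have wu J : wsum (u J) N <= C0 ^+ 2 * (D * (D * K)).
  apply: le_trans (_ : \sum_(n < N) (C0 ^+ 2 * D) * (\sum_(j < J) r ^+ j * (nm (g (n + j)%N) ^+ 2 / n.+1%:R)) <= _).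
    apply: ler_sum => n _; rewrite ler_pdivrMr ?ltr0n //; apply: le_trans (u2 J n) _.
    set S := \sum_(j < J) _; set T := \sum_(j < J) _.
    have -> : C0 ^+ 2 * D * T * n.+1%:R = C0 ^+ 2 * (D * (T * n.+1%:R)) by ring.
    rewrite ler_wpM2l ?sqr_ge0 // ler_wpM2l // /T mulr_suml.
    by apply: ler_sum => j _; rewrite -mulrA divfK // pnatr_eq0.
  rewrite -mulr_sumr -mulrA ler_wpM2l ?sqr_ge0 // ler_wpM2l // exchange_big /=.
  apply: le_trans (ler_wpM2r K0 (hD J)); rewrite mulr_suml; apply: ler_sum => j _.
  rewrite -mulr_sumr mulrAC [leRHS]mulrC ler_wpM2l //.
  apply: le_trans (ler_wpM2l (ler0n _ _) (gK (N + j)%N)).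
  have t0 m : 0 <= abs2 (g m) / m.+1%:R by rewrite divr_ge0 ?abs2_ge0.
  apply: le_trans (ler_wpM2l (ler0n _ _) (sum_shift_le j N t0)).
  rewrite mulr_sumr; apply: ler_sum => n _; rewrite nm_sqr mulrCA.
  apply: ler_wpM2l; first exact: abs2_ge0.
  rewrite ler_pdivlMr ?ltr0n // mulrC ler_pdivrMr ?ltr0n // -natrM ler_nat; lia.
have cu n : abs2 (u J n) @[J --> \oo] --> abs2 (back_sol n).
  have h := psum_cvg (rad_term n) nrho.
  have -> : abs2 (back_sol n) = nm (back_sol n) ^+ 2 by rewrite nm_sqr.
  under eq_fun do rewrite -nm_sqr.
  rewrite expr2; under eq_fun do rewrite expr2.
  by apply: cvgM; apply: (cvg_comp _ _ h); exact: continuous_nm.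
have : wsum (u J) N @[J --> \oo] --> wsum back_sol N.
  rewrite /wsum; elim: N {wu} => [|N IH].
    by under eq_fun do rewrite big_ord0; rewrite big_ord0; exact: cvg_cst.
  under eq_fun do rewrite big_ord_recr /=; rewrite big_ord_recr /=.
  by apply: cvgD => //; apply: cvgMl.
move=> h; rewrite -(cvg_lim _ h) //; apply: limr_le; first by apply/cvg_ex; eexists; exact: h.
exact: nearW.
Qed.

End Solve.

(** The first [N] ratios affect only the constant; the induction peels off [bt 0]. The summands of
    the new constant serve the empty product, the products starting later and those starting at
    0. *)
Lemma prod_geometric (bt : nat -> C) (r : R) N : 0 < r ->
  (forall n, (N <= n)%N -> nm (bt n) <= r) ->
  exists2 C0, 0 <= C0 & forall n j, nm (\prod_(i < j) bt (n + i)%N) <= C0 * r ^+ j.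
Proof.
move=> r0; elim: N bt => [|N IH] bt h.
  exists 1 => // n j; rewrite mul1r; elim: j => [|j IHj].
    by rewrite big_ord0 nm1 expr0.
  by rewrite big_ord_recr /= nmM exprSr ler_pM ?nm_ge0 // h.
have [C0 C00 hC] := IH (fun n => bt n.+1) (fun n hn => h n.+1 hn).
have b0 : 0 <= nm (bt 0%N) / r * C0 by rewrite mulr_ge0 // divr_ge0 ?nm_ge0 // ltW.
exists (1 + C0 + nm (bt 0%N) / r * C0); first by rewrite !addr_ge0.
move=> [|n] j; have rj : 0 <= r ^+ j by rewrite exprn_ge0 // ltW.
  case: j rj => [|j] rj.
    by rewrite big_ord0 nm1 expr0 mulr1 -addrA lerDl addr_ge0.
  rewrite big_ord_recl nmM.
  apply: le_trans (_ : nm (bt 0%N) / r * C0 * r ^+ j.+1 <= _); last first.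
    by rewrite ler_wpM2r // lerDr addr_ge0.
  rewrite exprS mulrA -[X in _ <= X * _]mulrA (mulrC C0) !mulrA divfK ?gt_eqF //.
  rewrite -[leRHS]mulrA; apply: ler_wpM2l; first exact: nm_ge0.
  apply: le_trans (hC 0%N j); rewrite le_eqVlt; apply/orP; left; apply/eqP.
  by congr nm; apply: eq_bigr => i _; rewrite lift0.
apply: le_trans (_ : C0 * r ^+ j <= _); last by rewrite ler_wpM2r // -addrA addrCA lerDl addr_ge0.
apply: le_trans (hC n j); rewrite le_eqVlt; apply/orP; left; apply/eqP.
by congr nm; apply: eq_bigr => i _; rewrite addSn.
Qed.

Lemma nm_sub_nat n (al : C) : n%:R - nm al <= nm (n%:R - al).
Proof. by rewrite lerBlDr -(nm_nat R n) (le_trans _ (nmD _ _)) // subrK. Qed.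

(** The ratios converge to [z0], so from some index on their modulus is at most [(1 + |z0|)/2]. *)
Lemma ratio_geometric (z0 al : C) : nm z0 < 1 ->
  exists r C0 : R, [/\ 0 < r < 1, 0 <= C0 & forall n j,
    nm (\prod_(i < j) (z0 * (n + i).+1%:R / ((n + i).+1%:R - al))) <= C0 * r ^+ j].
Proof.
move=> z1; pose r := (1 + nm z0) / 2; have n0 := nm_ge0 z0.
have r0 : 0 < r by rewrite /r; lra.
have r1 : r < 1 by rewrite /r; lra.
have rz : 0 < r - nm z0 by rewrite /r; lra.
have y0 : 0 <= r * nm al / (r - nm z0) by rewrite divr_ge0 ?(ltW rz) // mulr_ge0 ?nm_ge0 // ltW.
pose N := Num.bound (r * nm al / (r - nm z0)).
have [|C0 C00 hC] := @prod_geometric (fun n => z0 * n.+1%:R / (n.+1%:R - al)) r N r0.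
  move=> n Nn.
  have h : r * nm al <= (r - nm z0) * n.+1%:R.
    rewrite [leRHS]mulrC -ler_pdivrMr //; apply: le_trans (ltW (archi_boundP y0)) _.
    by rewrite ler_nat ltnW.
  rewrite nmM nmV nmM nm_nat.
  (* A vanishing denominator gives the ratio 0 by the convention on inverses. *)
  have [->|d0] := eqVneq (nm (n.+1%:R - al)) 0; first by rewrite invr0 mulr0 ltW.
  have dp : 0 < nm (n.+1%:R - al) by rewrite lt_neqAle eq_sym d0 nm_ge0.
  rewrite ler_pdivrMr //; apply: le_trans (ler_wpM2l (ltW r0) (nm_sub_nat n.+1 al)).
  by rewrite mulrBr; move: h; rewrite mulrBl; lra.
by exists r, C0; split => //; rewrite r0.
Qed.

(** For large [n] one has [|n - al| >= n - |al| >= (n+1)/2]; the finitely many other indices are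
    covered by the sum [S], whose denominators are nonzero by hypothesis. *)
Lemma denominator_bound (al : C) : (forall n : nat, n%:R != al) ->
  exists2 C1 : R, 0 <= C1 & forall n, n.+1%:R <= C1 * nm (n%:R - al).
Proof.
move=> hal; pose N := Num.bound (2 * nm al + 2).
have y0 : 0 <= 2 * nm al + 2 by rewrite addr_ge0 // mulr_ge0 ?nm_ge0.
have d0 n : 0 < nm (n%:R - al) by rewrite nm_gt0 subr_eq0.
pose S := \sum_(i < N) i.+1%:R / nm (i%:R - al).
have S0 : 0 <= S by apply: sumr_ge0 => i _; rewrite divr_ge0 ?nm_ge0.
exists (2 + S); first by rewrite addr_ge0.
move=> n; rewrite mulrDl; have [h|h] := ltnP n N.
  rewrite -[leLHS]add0r lerD ?mulr_ge0 ?nm_ge0 // -ler_pdivrMr //.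
  rewrite /S (bigD1 (Ordinal h)) //= lerDl sumr_ge0 // => i _.
  by rewrite divr_ge0 ?nm_ge0.
have := nm_sub_nat n al; have := archi_boundP y0; rewrite -/N => h1 h2.
have h3 : N%:R <= n%:R :> R by rewrite ler_nat.
have h4 : 0 <= S * nm (n%:R - al) by rewrite mulr_ge0 ?nm_ge0.
have key (x u a d e : R) : 2 * a + 2 < d -> e - a <= x -> d <= e -> 0 <= u ->
  e + 1 <= 2 * x + u by lra.
by rewrite -natr1; apply: key h1 h2 h3 h4.
Qed.

End Recursion.

(** * Bounded inversion when [al] is not a natural number *)

Section Sufficiency.
Variable R : realType.
Local Notation C := (CC R).
Local Notation nm := (@Normc.normc R).
Local Notation kap := (kap R).
Implicit Types (f g h u w F : C -> C) (a b y : nat -> C) (z : C).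
Variable p : C -> C.
Local Notation qf := (qf p).
Variables (z0 al : C) (u w F : C -> C) (K : R).
Hypotheses (z01 : nm z0 < 1) (nf : nform p z0 al u w F K).
Hypothesis hal : forall n : nat, n%:R != al.

(** With [y_n = (n - al) h_n] the recursion for [h] becomes [y_n - bt n * y_(n+1) = g_n]. *)
Let bt n : C := z0 * n.+1%:R / (n.+1%:R - al).

Lemma euler_psum (h : nat -> C) z : rad h -> nm z < 1 ->
  (z - z0) * psum (dfs h) z - al * psum h z =
  psum (fun n => (n%:R - al) * h n - bt n * ((n.+1%:R - al) * h n.+1)) z.
Proof.
move=> rh z1; have rd := rad_dfs rh.
rewrite mulrBl -psum_shift // -psumZ // -psumZ // -psumB //; last 2 first.
- exact: rad_shift.
- exact: radZ.
rewrite -psumB //; [|by apply: radD; [exact: rad_shift|apply: radN; exact: radZ]|exact: radZ].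
congr (psum _ z); apply/funext => n; rewrite /bt.
have -> : z0 * n.+1%:R / (n.+1%:R - al) * ((n.+1%:R - al) * h n.+1) = z0 * n.+1%:R * h n.+1.
  by rewrite mulrA divfK // subr_eq0.
by case: n => [|n]; rewrite /shift /dfs; ring.
Qed.

(** For existence, [g] is multiplied by [F / u], the recursion is solved for [y], and the way back
    goes through [h] and [G = H / F], with a bound at each stage. For uniqueness [H = F G] need only
    be analytic, since [backward_unique] assumes no more than [rad]. *)
Lemma sufficient_solvable : solvable p.
Proof.
have k0 := kap_gt0 R.
have [r [C0 [/andP[r0 r1] C00 hC]]] := ratio_geometric al z01.
have hbt n j : nm (\prod_(i < j) bt (n + i)%N) <= C0 * r ^+ j by exact: hC.
have [C1 C10 hC1] := denominator_bound hal.
have hK0 : 0 <= K by apply: le_trans (nm_ge0 _) (nf_uK nf (z := 0) _); rewrite nm0.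
have [D hD] : exists D, forall N, \sum_(j < N) j.+1%:R * r ^+ j <= D.
  have ra : rad (fun n => n.+1%:R * (1 : C)).
    apply: rad_natM => s /andP[s0 s1]; exists 1 => n.
    by rewrite nm1 mul1r exprn_ile1 // ltW.
  have [D hD] := rad_abs ra (introT andP (conj r0 r1)); exists D => N.
  apply: le_trans (hD N); apply: ler_sum => j _.
  by rewrite mulr1 nm_nat.
have D0 : 0 <= D by have := hD 0; rewrite big_ord0.
have al0 n : n%:R - al != 0 by rewrite subr_eq0.
have F0 := nf_F0 nf.
(* The factors come from the division by [n - al], from the backward solution and from the
   multiplication by [F / u], in this order. *)
pose L := C1 ^+ 2 * (C0 ^+ 2 * (D * D)) * (K * K) ^+ 2.
have L0 : 0 <= L by rewrite /L !mulr_ge0 ?exprn_ge0 ?mulr_ge0.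
(* The two summands are the bounds of [nf_bergman] for [G] and for [G'], combined as in [ds_le];
   adding 1 below makes the constant positive. *)
pose c := K ^+ 2 * L + 2 * (K ^+ 2 * (2 * L + 2 * (K ^+ 2 * L))).
have c0 : 0 <= c by rewrite /c addr_ge0 ?mulr_ge0 ?addr_ge0 ?mulr_ge0 ?exprn_ge0.
exists (c + 1); split.
- by rewrite ltr_pwDr.
- move=> g bg.
  have huV := holoV (nf_u nf) (nf_u0 nf).
  have [bg' ng'] : bergman (fun z => F z * (u z)^-1 * g z) /\
      nD (fun z => F z * (u z)^-1 * g z) <= (K * K) ^+ 2 * nD g.
    apply: nDM bg; first by apply: holoM huV; exact: (holo_nf nf).
    by move=> z z1; rewrite nmM; apply: ler_pM (nm_ge0 _) (nm_ge0 _) (nf_FK nf z1) (nf_uV nf z1).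
  have [ra ea] := taylorP (bergman_holo bg'); set a := taylor _ in ra ea.
  pose W := (K * K) ^+ 2 * nD g / kap.
  have wa N : wsum a N <= W.
    by rewrite ler_pdivlMr // mulrC (le_trans (wsum_nD ra ea N bg')).
  pose y := back_sol bt r a.
  have yE n : y n = a n + bt n * y n.+1 := back_solE r0 r1 C00 hbt ra n.
  have wy N := back_sol_bound r0 r1 C00 hbt ra wa hD N.
  pose h n := y n / (n%:R - al).
  have hh N : ds h N <= C1 ^+ 2 * (C0 ^+ 2 * (D * (D * W))).
    apply: le_trans (ler_wpM2l (exprn_ge0 2 C10) (wy N)).
    rewrite /wsum mulr_sumr; apply: ler_sum => n _.
    rewrite -!nm_sqr /h nmM nmV expr_div_n -/y.
    have x0 : 0 < nm (n%:R - al) by rewrite nm_gt0.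
    have key (x m v : R) : 0 < x -> 0 < m -> 0 <= v -> m <= C1 * x ->
        m * (v / x ^+ 2) <= C1 ^+ 2 * (v / m).
      move=> xp mp v0 mx; rewrite mulrCA [leRHS]mulrCA ler_wpM2l //.
      rewrite ler_pdivrMr ?exprn_gt0 // mulrAC ler_pdivlMr // -expr2 -exprMn.
      by rewrite lerXn2r // nnegrE ?(ltW mp) // (le_trans (ltW mp)).
    by apply: key; rewrite ?ltr0n ?exprn_ge0 ?nm_ge0.
  have rh := ds_rad hh.
  have [bH nH bdH ndH] := nD_psum hh.
  have eL : kap * (C1 ^+ 2 * (C0 ^+ 2 * (D * (D * W)))) = L * nD g.
    have key (x c1 e v t : R) : x != 0 -> x * (c1 * (e * (D * (D * (v * t / x))))) = c1 * (e * (D * D)) * v * t.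
      by move=> x0; field; rewrite x0.
    by rewrite /W /L key // gt_eqF.
  rewrite eL in nH ndH.
  have cH z : nm z < 1 -> cdf (psum h) z (psum (dfs h) z) by exact: psum_cdf.
  have [bG bdG nG ndG] := nf_bergman nf bH bdH.
  have [b rb Gb] := holo_psum (bergman_holo bG).
  have hG z (lz : nm z < 1) := nf_Lop nf lz (cH z lz).
  have hG1 z (lz : nm z < 1) := proj1 (hG z lz).
  exists b; split.
    move=> z z1; rewrite /Lop -(dG_dfs rb Gb hG1) // -Gb // -[1 + z * p z]/(qf z) (proj2 (hG z z1)).
    rewrite euler_psum //.
    rewrite (_ : (fun n => _) = a); last first.
      apply/funext => n; rewrite /h ![_ * (y _ / _)]mulrC !divfK // yE; ring.
    rewrite -ea //; have u0 := nf_u0 nf z1; have f0 := F0 z.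
    by field; rewrite f0 u0.
  move=> N; apply: le_trans (ds_le rb Gb hG1 bG bdG N) _.
  have n0 := nD_ge0 g.
  have K2 : 0 <= K ^+ 2 by rewrite exprn_ge0.
  have i1 := le_trans nG (ler_wpM2l K2 nH).
  have i2 : 2 * nD (psum (dfs h)) + 2 * (K ^+ 2 * nD (psum h)) <= 2 * (L * nD g) + 2 * (K ^+ 2 * (L * nD g)).
    exact: lerD (ler_wpM2l (ler0n _ 2) ndH) (ler_wpM2l (ler0n _ 2) (ler_wpM2l K2 nH)).
  have i3 := le_trans ndG (ler_wpM2l K2 i2).
  apply: le_trans (lerD i1 (ler_wpM2l (ler0n _ 2) i3)) _.
  move: n0; move: (nD g) => x x0; rewrite -subr_ge0 /c.
  by rewrite (_ : _ - _ = x) //; move: (K ^+ 2) (L) => k l; ring.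
move=> b M hM LG.
have [bG _ bdG _] := nD_psum hM; have rb := ds_rad hM.
have hF := holo_nf nf; have hG := bergman_holo bG.
have cG z : nm z < 1 -> cdf (psum b) z (psum (dfs b) z) by exact: psum_cdf.
have hH := holoM hF hG.
have [rh eh] := taylorP hH; set h := taylor _ in rh eh.
have cH z : nm z < 1 -> psum (dfs h) z = w z * F z * psum b z + F z * psum (dfs b) z.
  move=> z1; apply: (cdf_uniq (cdf_taylor hH z1)).
  exact: catM (cont_id z) (nf_F nf z1) (cG z z1).
have e z : nm z < 1 -> (z - z0) * psum (dfs h) z - al * psum h z = 0.
  move=> z1; have := LG z z1; rewrite /Lop -[1 + z * p z]/(qf z) (nf_q nf z1) (nf_p nf z1) => l0.
  rewrite cH // -eh //; have u0 := nf_u0 nf z1.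
  apply: (mulfI u0); rewrite mulr0.
  transitivity (F z * ((z - z0) * u z * psum (dfs b) z + u z * ((z - z0) * w z - al) * psum b z)).
    by ring.
  by rewrite l0 mulr0.
pose y n := (n%:R - al) * h n.
have ry : rad y.
  have -> : y = fun n => (n.+1%:R * h n) + (- (1 + al)) * h n.
    by apply/funext => n; rewrite /y -natr1; ring.
  by apply: radD; [exact: rad_natM|exact: radZ].
have yS n : y n = bt n * y n.+1.
  have rr : rad (fun n => (n%:R - al) * h n - bt n * ((n.+1%:R - al) * h n.+1)).
    have -> : (fun n => (n%:R - al) * h n - bt n * ((n.+1%:R - al) * h n.+1)) =
        fun n => y n - z0 * dfs h n.
      apply/funext => k; congr (_ - _); rewrite /bt /dfs.
      by rewrite [LHS]mulrA divfK // mulrA.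
    by apply: radD => //; apply: radN; apply: radZ; exact: rad_dfs.
  have := psum_inj0 rr _ n; move=> /(_ _)/eqP; rewrite subr_eq0 => /(_ _)/eqP; apply.
  by move=> z z1; rewrite -euler_psum // e.
have y0 := backward_unique r0 r1 hbt ry yS.
have h0 n : h n = 0.
  by have /eqP := y0 n; rewrite mulf_eq0 (negbTE (al0 n)) => /eqP.
apply: psum_inj0 => // z z1.
have := eh z z1; rewrite (@psum_fin _ h _ 0) ?/psm ?big_ord0 // => /eqP.
by rewrite mulf_eq0 (negbTE (F0 z)) => /eqP.
Qed.

End Sufficiency.

Theorem theorem2p5 (R : realType) (p : CC R -> CC R) :
  disk_algebra p ->
  (invertible_on_bergman (toeplitz (fun z => conjc z + p z))
   <->
   ((forall z : CC R, circle z -> 1 + z * p z != 0) /\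
    (exists z0 : CC R,
       [/\ disk z0, 1 + z0 * p z0 = 0,
           (forall z : CC R, disk z -> 1 + z * p z = 0 -> z = z0),
           derive1 (fun z : CC R => 1 + z * p z) z0 != 0 &
           forall n : nat,
             z0 ^+ 2 * derive1 p z0 - (n.+2)%:R / (n.+1)%:R != 0]))).
Proof.
move=> /disk_algebraP [hp wp]; have [B B0 hB] := wcont_bounded wp.
have pB (z : CC R) : Normc.normc z < 1 -> Normc.normc (p z) <= B by move=> z1; exact: hB (ltW z1).
(* From [dq = p z0 + z0 p'(z0)] and [z0 p z0 = -1] one gets [z0^2 p'(z0) = 1 + z0 dq], and
   [(n+2)/(n+1) = 1 + 1/(n+1)]. *)
have cond (z0 dq : CC R) n : Normc.normc z0 < 1 -> qf p z0 = 0 -> cdf (qf p) z0 dq ->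
    z0 ^+ 2 * derive1 p z0 - (n.+2)%:R / (n.+1)%:R = z0 * dq - n.+1%:R^-1.
  move=> z01 q0 hdq; have [d hd] := hp z0 z01.
  have h := catD (cat_cst id 1 z0) (catM (cont_id z0) (cat_id id z0) hd).
  rewrite (cdf_uniq hdq h) (derive1_cdf hd).
  have e : z0 * p z0 = -1 by apply/eqP; rewrite -addr_eq0 addrC; apply/eqP; exact: q0.
  have n0 : n.+1%:R != 0 :> R[i] by rewrite pnatr_eq0.
  have -> : n.+2%:R / n.+1%:R = 1 + n.+1%:R^-1 :> CC R.
    by rewrite -(natr1 n.+1) mulrDl mulfV // mul1r.
  by rewrite add0r mul1r mulrDr e; ring.
rewrite (solvable_invertible hp pB); split.
  move=> /(solvable_necessary hp pB wp) [circ [z0 [dq [z01 q0 uq [hdq dq0] hn]]]].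
  split; first by move=> z /circleE; exact: circ.
  exists z0; split => //.
  - exact/diskE.
  - by move=> z /diskE z1 qz; exact: uq.
  - by rewrite (derive1_cdf hdq).
  - by move=> n; rewrite (cond _ _ _ z01 q0 hdq) subr_eq0.
move=> [circ [z0 [/diskE z01 q0 uq dq0 hn]]].
have [dq hdq] := holo_qf hp z01.
have ne0 : dq != 0 by move: dq0; rewrite (derive1_cdf hdq).
have uq' (z : CC R) : Normc.normc z < 1 -> qf p z = 0 -> z = z0 by move=> /diskE; exact: uq.
have circ' (z : CC R) : Normc.normc z = 1 -> qf p z != 0 by move=> /circleE; exact: circ.
have [u [w [F [K nf]]]] := normal_form hp pB wp z01 q0 hdq ne0 uq' circ'.
(* The value 0 is excluded because [al] is an inverse; each positive integer [n+1] is excluded by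
   the condition with index [n]. *)
apply: (sufficient_solvable z01 nf) => -[|n].
  by rewrite eq_sym invr_eq0 mulf_neq0 // (z0_neq0 q0).
apply/eqP => e; have := hn n; rewrite (cond _ _ _ z01 q0 hdq) e invrK subrr eqxx //.
Qed.
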